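(* Let $M$ be a compact 3-manifold with torus boundary, $\mathcal T$ an ordered ideal triangulation of the interior of $M$ with $N$ tetrahedra, $\pi=\pi_1(M)$, $\alpha:\pi\to\mathbb Z$ a group homomorphism and $\rho:\pi\to\mathrm{SL}_n(\mathbb C)$ a representation, such that the cellular chain complex of $M$ with local coefficients twisted by $\alpha\otimes\rho$ is acyclic, so that the twisted Alexander polynomial $\Delta_{\alpha\otimes\rho}(t)$ is defined. Let $\mathbf B\in M_{N\times N}(\mathbb Z[\pi])$ be the twisted Neumann--Zagier matrix of $\mathcal T$ and let $\mathbf B_{\alpha\otimes\rho}(t)\in M_{nN\times nN}(\mathbb C[t^{\pm1}])$ be the block matrix obtained from $\mathbf B$ by replacing each $\gamma\in\pi$ by $t^{\alpha(\gamma)}\rho(\gamma)$. Then either $\det\mathbf B_{\alpha\otimes\rho}(t)=0$ or $$\det \mathbf B_{\alpha\otimes\rho}(t)\doteq \Delta_{\alpha\otimes\rho}(t)\,\det\bigl(\rho(\gamma)\,t^{\alpha(\gamma)}-I_n\bigr)^m$$ for some peripheral curve $\gamma$ and some integer $m\ge1$, where $I_n$ is the $n\times n$ identity matrix and $\doteq$ denotes equality up to multiplication by $\pm t^k$, $k\in\mathbb Z$.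
   Context: $M$ is connected and oriented, $\partial M$ is a torus. A peripheral curve is a closed curve on $\partial M$; it determines an element of $\pi$ up to conjugation. Ideal triangulation: $\mathcal T$ presents the interior of $M$ as finitely many tetrahedra with vertices removed, with faces identified in pairs. It has tetrahedra $\Delta_1,\dots,\Delta_N$ and equally many edges $e_1,\dots,e_N$. $\mathcal T$ is ordered if the vertices of each tetrahedron are labeled by $0,1,2,3$ and every face-pairing respects the vertex-order. Shape parameters: each edge of $\Delta_j$ is assigned one of $z_j,z_j',z_j''$, opposite edges having the same parameter, the three pairs of opposite edges getting the three different parameters. For ordered $\mathcal T$, the edges $(01)$ and $(23)$ of $\Delta_j$ get $z_j$; the other two pairs get $z_j',z_j''$ so that around each vertex the cyclic order $z_j\to z_j'\to z_j''$ follows one fixed convention with respect to the orientation of $M$. Twisted Neumann--Zagier matrix: let $\widetilde{\mathcal T}$ be the ideal triangulation of the universal cover induced by $\mathcal T$, on which $\pi$ acts on the left by deck transformations. Choose lifts $\widetilde e_i$ of $e_i$ and $\widetilde\Delta_j$ of $\Delta_j$. For $\square\in\{\ ,',''\}$ and $\gamma\in\pi$, let $G^\square_\gamma$ be the $N\times N$ integer matrix whose $(i,j)$-entry is the number of edges of $\gamma\cdot\widetilde\Delta_j$ assigned to $z_j^\square$ and identified with $\widetilde e_i$ in $\widetilde{\mathcal T}$. Put $\mathbf G^\square=\sum_{\gamma\in\pi}G^\square_\gamma\otimes\gamma\in M_{N\times N}(\mathbb Z[\pi])$ (a finite sum) and $\mathbf B=\mathbf G''-\mathbf G'$. Changing lifts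 multiplies $\mathbf B$ on the left and right by diagonal matrices with entries in $\pi$, so $\det\mathbf B_{\alpha\otimes\rho}(t)$ is well defined up to $\pm t^k$. Twisted Alexander polynomial: let $\mathcal D$ be the 2-dimensional cell complex dual to $\mathcal T$ (one vertex per tetrahedron, one edge per face, one 2-cell per edge of $\mathcal T$), onto which $M$ deformation retracts. The cellular chain complex of the universal cover of $\mathcal D$ is a complex of free left $\mathbb Z[\pi]$-modules of ranks $N,2N,N$ in degrees $2,1,0$. Using bases given by lifts of cells, write the boundary maps as matrices acting on row vectors from the right and replace each $\gamma\in\pi$ by the block $t^{\alpha(\gamma)}\rho(\gamma)$ to get $P_2\in M_{nN\times 2nN}(\mathbb C[t^{\pm1}])$ and $P_1\in M_{2nN\times nN}(\mathbb C[t^{\pm1}])$, $P_2P_1=0$. Acyclic means acyclic over $\mathbb C(t)$, i.e. $P_1,P_2$ both have rank $nN$ over $\mathbb C(t)$. Then $\Delta_{\alpha\otimes\rho}(t)\in\mathbb C(t)$ is the torsion of this complex (Wada's invariant), defined up to $\doteq$ by $$\Delta_{\alpha\otimes\rho}(t)\doteq\frac{\det\begin{pmatrix}P_2\\ b\end{pmatrix}}{\det(bP_1)}$$ for any $b\in M_{nN\times 2nN}(\mathbb C[t^{\pm1}])$ with $\det(bP_1)\neq0$ (independent of $b$). *)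

(* Defs.v *)
From HB Require Import structures.
From Stdlib Require Export Relation_Operators.
From mathcomp Require Export all_boot all_order all_algebra.
From mathcomp Require Export generic_quotient fraction.
From mathcomp Require Export mxtens complex.
From mathcomp Require Export boolp classical_sets fsbigop reals.

Set Implicit Arguments.
Unset Strict Implicit.
Unset Printing Implicit Defensive.

Import GRing.Theory.
Local Open Scope ring_scope.

(* Face [a] of a tetrahedron is the one opposite to its vertex [a].  A pair
   [(X, a)] is a face of the tetrahedron [X], and [(X, (u, v))] with [u < v] is
   an edge of [X].  Since the gluings respect the vertex order, a face pairing
   of a collection of tetrahedra is given by an involution of their faces: face
   [a] is glued to face [b] by the increasing bijection between the vertices
   other than [a] and the vertices other than [b]. *)

Definition edge4 : Type := ('I_4 * 'I_4)%type.

Definition is_edge (e : edge4) : bool := (e.1 < e.2)%N.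

(* only used for [v != a] *)
Definition face_map (a b v : 'I_4) : 'I_4 :=
  if unlift a v is Some i then lift b i else b.

Definition edge_map (a b : 'I_4) (e : edge4) : edge4 :=
  (face_map a b e.1, face_map a b e.2).

Section Gluing.
Variables (X : Type) (g : X * 'I_4 -> X * 'I_4).

Definition edge_glued (x y : X * edge4) : Prop :=
  exists a : 'I_4,
    [/\ a != x.2.1, a != x.2.2
      & y = ((g (x.1, a)).1, edge_map a (g (x.1, a)).2 x.2)].

Definition same_edge : X * edge4 -> X * edge4 -> Prop :=
  clos_refl_sym_trans _ edge_glued.

Definition vertex_glued (x y : X * 'I_4) : Prop :=
  exists a : 'I_4,
    a != x.2 /\ y = ((g (x.1, a)).1, face_map a (g (x.1, a)).2 x.2).

Definition same_vertex : X * 'I_4 -> X * 'I_4 -> Prop :=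
  clos_refl_sym_trans _ vertex_glued.

End Gluing.

(* Ordered ideal triangulations (of the interior) of compact connected oriented
   3-manifolds [M] whose boundary is a torus.
   - [positive j] tells whether the vertex order 0123 of the tetrahedron [j]
     agrees with the orientation of [M].  As the orientation induced on face [a]
     is (-1)^a times the one given by the vertex order, [glue_oriented] says that
     the face pairings reverse the induced orientations (in particular no face
     is glued to itself).
   - The triangles cutting off the ideal vertices form a triangulation of the
     boundary of [M]; [one_cusp] says that it is connected, hence so is [M].
   - [edge_of] numbers the edges of the triangulation.  The boundary has [4 * N]
     triangles, [6 * N] edges and two vertices for each edge of the
     triangulation, so it is a torus exactly when there are [N] edges. *)
Record ordered_triangulation (N : nat) := OrderedTriangulation {
  glue : 'I_N * 'I_4 -> 'I_N * 'I_4;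
  glueK : involutive glue;
  positive : 'I_N -> bool;
  glue_oriented : forall f : 'I_N * 'I_4,
    positive f.1 (+) odd f.2 != positive (glue f).1 (+) odd (glue f).2;
  one_cusp : forall x y : 'I_N * 'I_4, same_vertex glue x y;
  edge_of : 'I_N * edge4 -> 'I_N;
  edge_of_surj : forall i : 'I_N, exists2 x, is_edge x.2 & edge_of x = i;
  edge_ofP : forall x y : 'I_N * edge4, is_edge x.2 -> is_edge y.2 ->
    (edge_of x = edge_of y <-> same_edge glue x y)
}.

(* Number of primes on the shape parameter of the edge [e] of a tetrahedron of
   orientation [o]: 01 and 23 get z, and in a positive tetrahedron 02 and 13 get
   z' while 03 and 12 get z''. *)
Definition primes_of (o : bool) (e : edge4) : nat :=
  (let s := e.1 + e.2 in
   if s == 3 then (if o then 2 else 1)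
   else if odd s then 0 else (if o then 1 else 2))%N.

(* The face of a tetrahedron of orientation [o] through which one leaves it when
   turning around its edge [e = (u, v)] in the positive direction.  With
   [a] and [b] the two other vertices, it is [a] when the order [u, v, a, b] is
   positive for the orientation of [M]; if [a < b], the sign of the permutation
   [u, v, a, b] is [(-1) ^ (u + v + 1)]. *)
Definition exit_face (o : bool) (e : edge4) : 'I_4 :=
  nth ord0 [seq a <- enum 'I_4 | (a != e.1) && (a != e.2)]
      (o != odd (e.1 + e.2)%N).

Section DualComplex.
Variables (N : nat) (T : ordered_triangulation N).

(* An edge path of the dual complex is given by its initial tetrahedron and by
   the sequence of the faces that it crosses. *)
Definition cross (j : 'I_N) (a : 'I_4) : 'I_N := (glue T (j, a)).1.

Definition path_end (j : 'I_N) (s : seq 'I_4) : 'I_N := foldl cross j s.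

Definition rotate (x : 'I_N * edge4) : 'I_N * edge4 :=
  let a := exit_face (positive T x.1) x.2 in
  ((glue T (x.1, a)).1, edge_map a (glue T (x.1, a)).2 x.2).

(* boundary of the dual 2-cell of an edge *)
Definition edge_loop (x : 'I_N * edge4) : seq 'I_4 :=
  [seq exit_face (positive T y.1) y.2 | y <- orbit rotate x].

Inductive homotopy_step (j : 'I_N) : seq 'I_4 -> seq 'I_4 -> Prop :=
| BacktrackStep s1 s2 a :
    homotopy_step j (s1 ++ [:: a; (glue T (path_end j s1, a)).2] ++ s2)
                    (s1 ++ s2)
| EdgeLoopStep s1 s2 e : is_edge e ->
    homotopy_step j (s1 ++ edge_loop (path_end j s1, e) ++ s2) (s1 ++ s2).

(* homotopy, relative to the end points, of edge paths starting at [j] *)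
Definition homotopic (j : 'I_N) : seq 'I_4 -> seq 'I_4 -> Prop :=
  clos_refl_sym_trans _ (homotopy_step j).

(* the triangles of the boundary crossed by a path, [None] if the path leaves
   the boundary *)
Fixpoint link_end (x : 'I_N * 'I_4) (s : seq 'I_4) : option ('I_N * 'I_4) :=
  if s is a :: s' then
    if a == x.2 then None
    else link_end ((glue T (x.1, a)).1, face_map a (glue T (x.1, a)).2 x.2) s'
  else Some x.

Fixpoint rev_path (j : 'I_N) (s : seq 'I_4) : seq 'I_4 :=
  if s is a :: s' then rcons (rev_path (cross j a) s') (glue T (j, a)).2
  else [::].

Lemma path_end_cat j s t : path_end j (s ++ t) = path_end (path_end j s) t.
Proof. by rewrite /path_end foldl_cat. Qed.

Lemma rotate_turn (x : 'I_N * edge4) : is_edge x.2 ->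
  let a := exit_face (positive T x.1) x.2 in
  let y := rotate x in
  [/\ is_edge y.2, exit_face (~~ positive T y.1) y.2 = (glue T (x.1, a)).2
    & edge_map (glue T (x.1, a)).2 a y.2 = x.2].
Proof.
case: x => j [u v] /= uv; rewrite /rotate /=.
have /= := glue_oriented T (j, exit_face (positive T j) (u, v)).
case: (glue T (j, _)) => k b /=.
move: (positive T j) (positive T k) uv => o o' uv {j k}.
pose exitn p c d := nth 0%N [seq a <- iota 0 4 | (a != c) && (a != d)]
                        (p != odd (c + d)).
have exitE p (e : edge4) : val (exit_face p e) = exitn p e.1 e.2.
  have nthE s i : val (nth (ord0 : 'I_4) s i) = nth 0%N (map val s) i.
    by elim: s i => [|y s IH] [|i] //=; rewrite IH.
  by rewrite /exit_face nthE /exitn -val_enum_ord [in RHS]filter_map.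
pose mapn c d w := if w == c then d else bump d (unbump c w).
have mapE (c d w : 'I_4) : val (face_map c d w) = mapn (val c) (val d) (val w).
  rewrite /face_map /mapn val_eqE; case: unliftP => [i|] -> /=.
    by rewrite eq_sym (negPf (neq_lift _ _)) bumpK.
  by rewrite eqxx.
pose ok p p' c d w := let a := exitn p c d in
  let c' := mapn a w c in let d' := mapn a w d in
  (c < d)%N ==> (p (+) odd a != p' (+) odd w) ==>
  [&& (c' < d')%N, exitn (~~ p') c' d' == w, mapn w a c' == c
    & mapn w a d' == d].
have okT p p' : all (fun c => all (fun d => all (ok p p' c d) (iota 0 4))
                  (iota 0 4)) (iota 0 4).
  by case: p; case: p'; vm_compute.
have in4 (w : 'I_4) : val w \in iota 0 4 by rewrite mem_iota /=.
move: (okT o o') => /allP/(_ _ (in4 u))/allP/(_ _ (in4 v))/allP/(_ _ (in4 b)).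
rewrite /ok -[exitn o _ _](exitE o (u, v)) -!mapE => /implyP/(_ uv)/implyP h1 h2.
have {h1 h2} /and4P[h1 h2 /eqP h3 /eqP h4] := h1 h2.
split=> //; first by apply/val_inj; rewrite exitE; apply/eqP.
by congr pair; apply/val_inj.
Qed.

Lemma iter_order_rotate (x : 'I_N * edge4) : is_edge x.2 ->
  iter (order rotate x) rotate x = x.
Proof.
move=> ex; apply: (@iter_order_in _ _ [pred y | is_edge y.2]) => //.
  by move=> y ey; have [] := rotate_turn ey.
pose back (y : 'I_N * edge4) : 'I_N * edge4 :=
  let b := exit_face (~~ positive T y.1) y.2 in
  ((glue T (y.1, b)).1, edge_map b (glue T (y.1, b)).2 y.2).
have backK : {in [pred y | is_edge y.2], cancel rotate back}.
  move=> y ey; have [_ h1 h2] := rotate_turn ey.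
  rewrite /back h1; move: h2; rewrite /rotate /=.
  set a := exit_face _ _ => h2.
  by rewrite -surjective_pairing glueK /= h2; case: (y).
exact: can_in_inj backK.
Qed.

Lemma edge_loop_closed j e : is_edge e -> path_end j (edge_loop (j, e)) = j.
Proof.
move=> ee; rewrite /edge_loop /orbit.
have H n x : path_end x.1 [seq exit_face (positive T y.1) y.2
   | y <- traject rotate x n] = (iter n rotate x).1.
  by elim: n x => [//|n IH x]; rewrite iterSr -IH.
by rewrite (H _ (j, e)) iter_order_rotate.
Qed.

Lemma homotopic_end j s t : homotopic j s t -> path_end j s = path_end j t.
Proof.
elim=> {s t} [s t []|//|s t _ ->//|s t r _ -> _ ->//].
  move=> s1 s2 a; rewrite !path_end_cat; congr path_end.
  rewrite /path_end /= /cross; set k := foldl _ _ _.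
  by rewrite -surjective_pairing glueK.
by move=> s1 s2 e ee; rewrite !path_end_cat edge_loop_closed.
Qed.

Lemma homotopic_catr j s t r : homotopic j s t -> homotopic j (s ++ r) (t ++ r).
Proof.
elim=> {s t} [s t [s1 s2 a|s1 s2 e ee]|s|s t _|s t u _ + _].
- by apply: rst_step; rewrite -!catA; constructor.
- by apply: rst_step; rewrite -!catA; constructor.
- exact: rst_refl.
- exact: rst_sym.
- exact: rst_trans.
Qed.

Lemma homotopic_catl j s t r :
  homotopic (path_end j r) s t -> homotopic j (r ++ s) (r ++ t).
Proof.
elim=> {s t} [s t [s1 s2 a|s1 s2 e ee]|s|s t _|s t u _ + _].
- apply: rst_step; rewrite -path_end_cat (catA r s1 (_ ++ _)) (catA r s1 s2).
  exact: BacktrackStep.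
- apply: rst_step; rewrite -path_end_cat (catA r s1 (_ ++ _)) (catA r s1 s2).
  exact: EdgeLoopStep.
- exact: rst_refl.
- exact: rst_sym.
- exact: rst_trans.
Qed.

Lemma rev_path_end j s : path_end (path_end j s) (rev_path j s) = j.
Proof.
elim: s j => //= a s IH j.
rewrite -cats1 path_end_cat IH /path_end /= /cross.
by rewrite -surjective_pairing glueK.
Qed.

Lemma rev_pathr j s : homotopic j (s ++ rev_path j s) [::].
Proof.
elim: s j => [|a s IH] j /=; first exact: rst_refl.
rewrite -cats1 catA.
apply: (@rst_trans _ _ _ ([:: a] ++ [::] ++ [:: (glue T (j, a)).2])).
  by apply: (@homotopic_catl j _ _ [:: a]); apply: homotopic_catr; apply: IH.
by apply: rst_step; apply: (@BacktrackStep j [::] [::] a).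
Qed.

Lemma rev_pathl j s : homotopic (path_end j s) (rev_path j s ++ s) [::].
Proof.
elim: s j => [|a s IH] j /=; first exact: rst_refl.
rewrite -cats1 -catA; apply: rst_trans (IH _).
apply: rst_step.
have := @BacktrackStep (path_end j (a :: s)) (rev_path (cross j a) s) s
          (glue T (j, a)).2.
rewrite [path_end (path_end _ _) _](rev_path_end (cross j a) s).
by rewrite /cross -surjective_pairing glueK.
Qed.

End DualComplex.

Section UniversalCover.
Variables (N : nat) (T : ordered_triangulation N) (base : 'I_N).

Definition homotopicb : rel (seq 'I_4) :=
  fun s t => `[< homotopic T base s t >].

Lemma homotopicb_refl : reflexive homotopicb.
Proof. by move=> s; apply/asboolP; exact: rst_refl. Qed.

Lemma homotopicb_sym : symmetric homotopicb.
Proof.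
by move=> s t; apply/idP/idP => /asboolP h; apply/asboolP; exact: rst_sym.
Qed.

Lemma homotopicb_trans : transitive homotopicb.
Proof.
by move=> s t r /asboolP h /asboolP h'; apply/asboolP; exact: rst_trans h h'.
Qed.

Canonical homotopicb_equiv : equiv_rel (seq 'I_4) :=
  EquivRel homotopicb homotopicb_refl homotopicb_sym homotopicb_trans.

(* Tetrahedra of the triangulation induced on the universal cover: homotopy
   classes of edge paths starting at the base tetrahedron. *)
Definition utet : Type := {eq_quot homotopicb}%qT.
HB.instance Definition _ := Choice.on utet.
HB.instance Definition _ := EqQuotient.on utet.

Definition uclass (s : seq 'I_4) : utet := \pi_utet%qT s.

Definition uproj (X : utet) : 'I_N := path_end T base (repr X).

(* lift of the edge path crossing the faces [s] that starts at [X] *)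
Definition uwalk (X : utet) (s : seq 'I_4) : utet := uclass (repr X ++ s).

(* face pairing of the universal cover *)
Definition uglue (F : utet * 'I_4) : utet * 'I_4 :=
  (uwalk F.1 [:: F.2], (glue T (uproj F.1, F.2)).2).

(* the fundamental group of the dual complex, based at the base tetrahedron *)
Definition pi1 : Type := {X : utet | uproj X == base}.
HB.instance Definition _ := Choice.on pi1.

Lemma uclassP s t : reflect (homotopic T base s t) (uclass s == uclass t).
Proof. by rewrite /uclass eqmodE; exact: asboolP. Qed.

Lemma repr_uclass s : homotopic T base (repr (uclass s)) s.
Proof. by apply/uclassP; rewrite /uclass reprK. Qed.

Lemma uproj_class s : uproj (uclass s) = path_end T base s.
Proof. exact: homotopic_end (repr_uclass s). Qed.

Definition pi1_class (s : seq 'I_4) (h : path_end T base s = base) : pi1 :=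
  Sub (uclass s) (introT eqP (etrans (uproj_class s) h)).

Definition pi1_path (g : pi1) : seq 'I_4 := repr (val g).

Lemma pi1_end (g : pi1) : path_end T base (pi1_path g) = base.
Proof. exact: eqP (valP g). Qed.

Lemma pi1_mul_end (g h : pi1) :
  path_end T base (pi1_path g ++ pi1_path h) = base.
Proof. by rewrite path_end_cat !pi1_end. Qed.

Lemma pi1_inv_end (g : pi1) :
  path_end T base (rev_path T base (pi1_path g)) = base.
Proof. by have := rev_path_end T base (pi1_path g); rewrite pi1_end. Qed.

Definition pi1_one : pi1 := pi1_class (erefl : path_end T base [::] = base).
Definition pi1_mul (g h : pi1) : pi1 := pi1_class (pi1_mul_end g h).
Definition pi1_inv (g : pi1) : pi1 := pi1_class (pi1_inv_end g).

Lemma pi1_eqP s (hs : path_end T base s = base) (g : pi1) :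
  homotopic T base s (pi1_path g) -> pi1_class hs = g.
Proof.
move=> h; apply/val_inj/eqP => /=.
by rewrite -[val g](reprK) -/(uclass _); apply/uclassP.
Qed.

Lemma pi1_path_class s (hs : path_end T base s = base) :
  homotopic T base (pi1_path (pi1_class hs)) s.
Proof. exact: repr_uclass. Qed.

Lemma pi1_catr (g : pi1) s t : homotopic T base s t ->
  homotopic T base (pi1_path g ++ s) (pi1_path g ++ t).
Proof. by move=> h; apply: homotopic_catl; rewrite pi1_end. Qed.

Lemma pi1_mulA : associative pi1_mul.
Proof.
move=> g h k; apply: pi1_eqP.
apply: rst_trans (rst_sym _ _ _ _ (pi1_path_class _)).
apply: rst_trans (pi1_catr _ (pi1_path_class _)) _.
rewrite catA; apply: homotopic_catr; apply: rst_sym; exact: pi1_path_class.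
Qed.

Lemma pi1_mul1 : left_id pi1_one pi1_mul.
Proof. by move=> g; apply: pi1_eqP; exact: (homotopic_catr _ (pi1_path_class _)). Qed.

Lemma pi1_mulr1 : right_id pi1_one pi1_mul.
Proof.
move=> g; apply: pi1_eqP; rewrite -[X in homotopic _ _ _ X]cats0.
exact: pi1_catr (pi1_path_class _).
Qed.

Lemma pi1_mulV : left_inverse pi1_one pi1_inv pi1_mul.
Proof.
move=> g; apply: pi1_eqP; apply: rst_trans (rst_sym _ _ _ _ (pi1_path_class _)).
apply: rst_trans (homotopic_catr _ (pi1_path_class _)) _.
by have := rev_pathl T base (pi1_path g); rewrite pi1_end.
Qed.

Lemma pi1_mulrV : right_inverse pi1_one pi1_inv pi1_mul.
Proof.
move=> g; apply: pi1_eqP; apply: rst_trans (rst_sym _ _ _ _ (pi1_path_class _)).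
apply: rst_trans (pi1_catr _ (pi1_path_class _)) _.
exact: rev_pathr.
Qed.

HB.instance Definition _ :=
  isGroup.Build pi1 pi1_mulA pi1_mul1 pi1_mulr1 pi1_mulV pi1_mulrV.

(* left action by deck transformations *)
Definition deck (g : pi1) (X : utet) : utet := uclass (pi1_path g ++ repr X).

(* [g] is conjugate to a closed path [s] of triangles around the ideal vertex
   [v] of the projection of [X]; the conjugating path is the class [X]. *)
Definition peripheral (g : pi1) : Prop :=
  exists (X : utet) (v : 'I_4) (s : seq 'I_4),
    link_end T (uproj X, v) s = Some (uproj X, v) /\ deck g X = uwalk X s.

(* Lifts of the tetrahedra, of the edges and of the faces.  A lift of an edge of
   the triangulation is given as an edge of some tetrahedron of the universal
   cover.  A lift of a face is given as a face [(X, a)] of one of the two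
   adjacent tetrahedra, and its dual edge is oriented away from [X]. *)
Record lifts := Lifts {
  tet_lift : 'I_N -> utet;
  tet_liftP : forall j, uproj (tet_lift j) = j;
  edge_lift : 'I_N -> utet * edge4;
  edge_liftP : forall i, is_edge (edge_lift i).2 /\
    edge_of T (uproj (edge_lift i).1, (edge_lift i).2) = i;
  face_lift : 'I_(N + N) -> utet * 'I_4;
  face_liftP : forall f : 'I_N * 'I_4, exists! k : 'I_(N + N),
    let f' := (uproj (face_lift k).1, (face_lift k).2) in
    f = f' \/ f = glue T f'
}.

Section Matrices.
Variable L : lifts.

(* Matrices over Z[pi] are given by the family of their coefficient matrices,
   indexed by the elements of pi. *)

Definition NZ_G (k : nat) (g : pi1) : 'M[int]_N :=
  \matrix_(i, j) #|[set e : edge4 |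
    [&& is_edge e, primes_of (positive T j) e == k
      & `[< same_edge uglue (deck g (tet_lift L j), e) (edge_lift L i) >]]]|%:Z.

Definition NZ_B (g : pi1) : 'M[int]_N := NZ_G 2%N g - NZ_G 1%N g.

Definition boundary1 (g : pi1) : 'M[int]_(N + N, N) :=
  \matrix_(k, j) ((deck g (tet_lift L j) == (uglue (face_lift L k)).1)%:Z
                  - (deck g (tet_lift L j) == (face_lift L k).1)%:Z).

(* how many times the boundary of the 2-cell dual to the [i]-th edge leaves the
   tetrahedron [F.1] through its face [F.2] *)
Definition exits (i : 'I_N) (F : utet * 'I_4) : nat :=
  #|[set e : edge4 |
    [&& is_edge e, exit_face (positive T (uproj F.1)) e == F.2
      & `[< same_edge uglue (F.1, e) (edge_lift L i) >]]]|.

Definition boundary2 (g : pi1) : 'M[int]_(N, N + N) :=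
  \matrix_(i, k)
    let F := (deck g (face_lift L k).1, (face_lift L k).2) in
    (exits i F)%:Z - (exits i (uglue F))%:Z.

End Matrices.

End UniversalCover.

(* the field C(t) *)
Notation Ct R := {fraction {poly R[i]}}.

Definition tvar (R : realType) : Ct R := tofrac 'X.

Definition doteq (R : realType) (x y : Ct R) : Prop :=
  exists (b : bool) (k : int), x = (-1) ^+ b * tvar R ^ k * y.

(* the subring C[t, t^-1] of C(t) *)
Definition is_laurent (R : realType) (x : Ct R) : Prop :=
  exists (p : {poly R[i]}) (k : nat), x = tofrac p / tvar R ^+ k.

Section Twisting.
Variables (R : realType) (G : groupType) (n : nat).
Variables (alpha : G -> int) (rho : G -> 'M[R[i]]_n).

(* t^alpha(g) rho(g) *)
Definition twist1 (g : G) : 'M[Ct R]_n :=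
  tvar R ^ alpha g *: map_mx (fun c => tofrac c%:P) (rho g).

(* the block matrix obtained by the substitution g |-> t^alpha(g) rho(g) in a
   matrix over Z[G], i.e. in a finitely supported family of integer matrices *)
Definition twist (p q : nat) (A : G -> 'M[int]_(p, q)) : 'M[Ct R]_(p * n, q * n) :=
  \sum_(g \in [set: G]) (map_mx intr (A g) *t twist1 g).

End Twisting.

Definition is_SL_rep (R : realType) (G : groupType) (n : nat)
    (rho : G -> 'M[R[i]]_n) : Prop :=
  (forall g, \det (rho g) = 1)
  /\ (forall g h, rho (g * h)%g = rho g *m rho h).

Section Torsion.
Variables (R : realType) (N n : nat).
Variables (P2 : 'M[Ct R]_(N * n, (N + N) * n)).
Variables (P1 : 'M[Ct R]_((N + N) * n, N * n)).

Definition acyclic : Prop :=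
  \rank P1 = (N * n)%N /\ \rank P2 = (N * n)%N.

Definition stack_det (b : 'M[Ct R]_(N * n, (N + N) * n)) : Ct R :=
  \det (castmx (esym (mulnDl N N n), erefl) (col_mx P2 b)).

Definition is_torsion (D : Ct R) : Prop :=
  exists b : 'M[Ct R]_(N * n, (N + N) * n),
    [/\ forall i j, is_laurent (b i j), \det (b *m P1) != 0
      & doteq D (stack_det b / \det (b *m P1))].

End Torsion.

(* Main.v *)
(** Each lift of a face has two sides.  Recording on which of the pairs of faces
    {0, 1} and {2, 3} of its tetrahedra they lie gives a square matrix [U] over
    Z[pi], with two blocks of columns [U01] and [U23], such that
    [P1 = - (U01 + U23)], [P2 U01 = B] and [P2 U23 = - B].  Multiplying [P2],
    completed by [b], by [U] yields [det B = +- Delta * det U].  Every tetrahedron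
    has one face of either orientation in each pair, so that up to units [U] is
    [1 - K] for a twisted permutation [K], and [det U] is the product of the
    [det (1 - hol c)] over the cycles [c] of [K].

    These cycles are disjoint simple closed curves, which cross the boundary
    triangles at the middle vertices 1 and 2.  The complement of the curves in
    the torus has Euler characteristic 0.  Either one of its components is a disk
    bounded by a curve, whose holonomy is then trivial and [det U = 0]; or all of
    them are annuli, and all the holonomies are conjugate up to inversion. *)

(* The surface argument is purely combinatorial. The torus cut along the curves is a ribbon graph
   given by permutations [s] and [f] of a finite set of flags, the holonomy of a curve is the
   product of labels along a cycle, and attaching an edge is multiplication by a transposition. A
   transposition that merges two cycles multiplies their holonomies. Once the connecting
   transpositions are done, each further merge is a handle; on a component without handles, a core
   cycle has trivial holonomy as soon as all the boundary cycles do. A boundary curve that is left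
   open is treated by changing one label so that its holonomy becomes trivial, which stands for
   capping it off.

   Every component has a boundary curve, hence Euler characteristic at most 1, with equality only
   for a disk. Without disks all the characteristics are at most 0, and their sum 0 forces annuli.

   The relations between [U] and B rest on a local fact: the two faces adjacent to an edge with
   parameter z lie in the same pair {0, 1} or {2, 3}, whereas turning around any other edge passes
   from one pair to the other, in a direction that distinguishes z'' from z'. *)
Require Import Defs.
From mathcomp Require Import fintype finset fingroup perm zify ring.

Set Implicit Arguments.
Unset Strict Implicit.
Unset Printing Implicit Defensive.

Import GRing.Theory.
Local Open Scope ring_scope.

(** * Products of labels along the cycles of a permutation *)

Section Holonomy.
Variables (D : finType) (T : Type) (idx : T) (op : Monoid.law idx).
Implicit Types (s : {perm D}) (c : D -> T) (x y z : D).

Definition hol s c x : T := \big[op/idx]_(y <- orbit s x) c y.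

Lemma orbit_cons s w x : fcycle s (x :: w) -> uniq (x :: w) ->
  orbit s x = x :: w.
Proof.
by move=> cw uw; rewrite (orbitE cw uw) ?mem_head //= eqxx rot0.
Qed.

Lemma orbit_consE s x : {w | [/\ orbit s x = x :: w, fcycle s (x :: w)
  & uniq (x :: w)]}.
Proof.
have cx := cycle_orbit (@perm_inj _ s) x.
have ux := orbit_uniq s x.
exists (behead (orbit s x)).
have e : orbit s x = x :: behead (orbit s x).
  by rewrite /orbit -orderSpred.
by rewrite -e.
Qed.

Lemma mem_orbitP s x y : (y \in orbit s x) = (y \in porbit s x).
Proof.
rewrite -fconnect_orbit; apply/idP/porbitP.
  by move=> h; exists (findex s x y); rewrite permX iter_findex.
by case=> i ->; rewrite permX fconnect_iter.
Qed.

(** The orbit listed from [s x] is the one listed from [x] with its head moved to the end. *)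
Lemma hol_split s c x :
  exists p, hol s c x = op (c x) p /\ hol s c (s x) = op p (c x).
Proof.
have [w [e cw uw]] := orbit_consE s x; exists (\big[op/idx]_(y <- w) c y).
rewrite /hol e big_cons; split=> //; case: w => [|y w] in e cw uw *.
  have sx : s x = x by move: cw => /=; rewrite andbT => /eqP.
  by rewrite sx e big_seq1 big_nil Monoid.mul1m.
have /= /andP[/eqP sx cw'] := cw.
have ey : orbit s y = y :: rcons w x.
  apply: orbit_cons; last by rewrite -rcons_cons -(rot1_cons x) rot_uniq.
  by rewrite -rcons_cons -(rot1_cons x) rot_cycle.
by rewrite sx ey -rcons_cons -cats1 big_cat big_seq1.
Qed.

Lemma hol_shift s c x : op (hol s c x) (c x) = op (c x) (hol s c (s x)).
Proof. by have [p [-> ->]] := hol_split s c x; rewrite Monoid.mulmA. Qed.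

Lemma path_tperm s x y z w : uniq (z :: w) -> fpath s z w ->
  (x \notin w) -> (y \notin w) -> fpath (s * tperm x y)%g z w.
Proof.
elim: w z => //= u w IH z /andP[_ uw] /andP[/eqP su pw].
rewrite !inE !negb_or => /andP[xu xw] /andP[yu yw].
by rewrite permM su tpermD // eqxx IH.
Qed.

Lemma orbit_tperm_out s x y z : z \notin porbit s x -> z \notin porbit s y ->
  orbit (s * tperm x y)%g z = orbit s z.
Proof.
move=> zx zy; have [w [e cw uw]] := orbit_consE s z.
rewrite e; apply: orbit_cons => //.
have xw : x \notin z :: w by rewrite -e mem_orbitP porbit_sym.
have yw : y \notin z :: w by rewrite -e mem_orbitP porbit_sym.
have := cw; rewrite (cycle_path z) (cycle_path z).
rewrite [last _ _]/=; set l := last z w.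
rewrite /= => /andP[/eqP sl pw]; apply/andP; split.
  move: xw yw; rewrite !inE !negb_or => /andP[xz _] /andP[yz _].
  by rewrite permM sl tpermD.
move: xw yw; rewrite !inE !negb_or => /andP[_ xw] /andP[_ yw].
exact: path_tperm.
Qed.

(** The product applies [s] first, so the transposition redirects the last step of each cycle to the
    head of the other one, and the two cycles are run one after the other. *)
Lemma orbit_tperm_merge s x y : y \notin porbit s x ->
  orbit (s * tperm x y)%g x = orbit s x ++ orbit s y.
Proof.
move=> yx; have [u [ex cu uu]] := orbit_consE s x.
have [v [ey cv uv]] := orbit_consE s y.
have dis z : z \in x :: u -> z \notin y :: v.
  rewrite -ex -ey !mem_orbitP => zx; apply: contra yx => zy.
  by rewrite -(eqP (_ : porbit s z == porbit s x)) ?eq_porbit_mem // porbit_sym.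
have xv : x \notin y :: v by apply: dis; rewrite mem_head.
have yu : y \notin x :: u by rewrite -ex mem_orbitP.
rewrite ex ey cat_cons; apply: orbit_cons.
  move: cu cv; rewrite (cycle_path x) (cycle_path y) (cycle_path x) /=.
  move=> /andP[/eqP sx pu] /andP[/eqP sy pv].
  rewrite last_cat /= permM sy tpermR eqxx /= cat_path /= permM sx tpermL eqxx /=.
  move: xv yu; rewrite !inE !negb_or => /andP[_ xv] /andP[_ yu].
  move: (uu) (uv) => /= /andP[xu _] /andP[yv _].
  by rewrite !path_tperm.
rewrite -cat_cons cat_uniq uu uv andbT; apply/hasPn => z zv.
by apply: contraL zv => zu; exact: dis.
Qed.

Lemma hol_tperm_out s c x y z : z \notin porbit s x -> z \notin porbit s y ->
  hol (s * tperm x y)%g c z = hol s c z.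
Proof. by move=> *; rewrite /hol orbit_tperm_out. Qed.

Lemma hol_tperm_merge s c x y : y \notin porbit s x ->
  hol (s * tperm x y)%g c x = op (hol s c x) (hol s c y).
Proof. by move=> *; rewrite /hol orbit_tperm_merge // big_cat. Qed.

Lemma porbit_tperm_out s x y z : z \notin porbit s x -> z \notin porbit s y ->
  porbit (s * tperm x y)%g z = porbit s z.
Proof.
by move=> *; apply/setP=> t; rewrite -!mem_orbitP orbit_tperm_out.
Qed.

Lemma porbit_tperm_merge s x y : y \notin porbit s x ->
  porbit (s * tperm x y)%g x = porbit s x :|: porbit s y.
Proof.
by move=> *; apply/setP=> t; rewrite inE -!mem_orbitP orbit_tperm_merge // mem_cat.
Qed.

Lemma mem_porbit_step s x : s x \in porbit s x.
Proof. by have := mem_porbit s 1 x; rewrite expg1. Qed.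

Lemma porbit_eqP s x y : reflect (porbit s x = porbit s y) (x \in porbit s y).
Proof. by rewrite -eq_porbit_mem; apply: eqP. Qed.

Lemma card_porbits_tperm s x y : x != y ->
  (#|porbits (s * tperm x y)%g| + (x \notin porbit s y).*2 = #|porbits s|.+1)%N.
Proof.
(* The known count has the transposition on the left; taking inverses moves it to the right and
   keeps the orbits. *)
move=> xy; have := porbits_mul_tperm s^-1%g x y.
by rewrite /= xy addn1 porbitV porbitsV -[porbits (_ * _)]porbitsV invMg invgK tpermV.
Qed.
End Holonomy.

(** * Holonomies under multiplication by a sequence of transpositions *)

Section GroupHolonomy.
Variables (D : finType).
Implicit Types (s r : {perm D}) (x y z : D) (ps : seq (D * D)).

Definition prod_tperm ps : {perm D} := (\prod_(p <- ps) tperm p.1 p.2)%g.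

Lemma hol_conj (G : groupType) s (c : D -> G) x y : y \in porbit s x ->
  exists g, hol *%g s c y = (g^-1 * hol *%g s c x * g)%g.
Proof.
case/porbitP=> i ->; elim: i => [|i [g eg]].
  by exists 1%g; rewrite expg0 perm1 invg1 mul1g mulg1.
exists (g * c ((s ^+ i)%g x))%g; rewrite expgSr permM.
have := hol_shift *%g s c ((s ^+ i)%g x).
rewrite invMg eg -!mulgA => /(congr1 (fun h => (c ((s ^+ i)%g x))^-1 * h)%g) /=.
by rewrite mulKg => <-; rewrite !mulgA.
Qed.

Lemma hol1_porbit (G : groupType) s (c : D -> G) x y : y \in porbit s x ->
  hol *%g s c x = 1%g -> hol *%g s c y = 1%g.
Proof. by case/(@hol_conj G s c) => g -> ->; rewrite mulg1 mulVg. Qed.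

Lemma porbit_sub s r x y z : (forall t, porbit s t \subset porbit r t) ->
  z \in porbit s y -> y \in porbit r x -> z \in porbit r x.
Proof. by move=> sr /(subsetP (sr y)) zy /porbit_eqP <-. Qed.

Lemma merge_porbit_sub s x y : y \notin porbit s x ->
  forall z, porbit s z \subset porbit (s * tperm x y)%g z.
Proof.
move=> yx z; have ex := porbit_tperm_merge yx.
have [zx|zx] := boolP (z \in porbit s x).
  have e : porbit (s * tperm x y)%g z = porbit s x :|: porbit s y.
    by rewrite -ex; apply/porbit_eqP; rewrite ex inE zx.
  by rewrite e (porbit_eqP _ _ _ zx) subsetUl.
have [zy|zy] := boolP (z \in porbit s y).
  have e : porbit (s * tperm x y)%g z = porbit s x :|: porbit s y.
    by rewrite -ex; apply/porbit_eqP; rewrite ex inE zy orbT.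
  by rewrite e (porbit_eqP _ _ _ zy) subsetUr.
by rewrite porbit_tperm_out.
Qed.

(** Greedy choice: as long as some pair joins two different cycles, its transposition is performed.
    Each one removes a cycle, and the holonomy of the merged cycle is a product of two trivial ones.
    At the end every pair lies inside one cycle of [s']. *)
Lemma merge_phase ps s : exists ps1 ps2,
  let s' := (s * prod_tperm ps1)%g in
  [/\ perm_eq ps (ps1 ++ ps2),
      forall p, p \in ps -> p.2 \in porbit s' p.1,
      (#|porbits s'| + size ps1 = #|porbits s|)%N,
      forall x, porbit s x \subset porbit s' x
    & forall (G : groupType) (c : D -> G),
        (forall x, hol *%g s c x = 1%g) -> forall x, hol *%g s' c x = 1%g].
Proof.
have [n] := ubnP (size ps); elim: n ps s => // n IH ps s.
rewrite ltnS => lepn.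
have [/hasP[[x y] xy_ps /= yx]|/hasPn/= H] :=
    boolP (has (fun p => p.2 \notin porbit s p.1) ps); last first.
  exists [::], ps; rewrite /= /prod_tperm big_nil mulg1 addn0; split=> //.
  by move=> p /H; rewrite negbK.
have pe := perm_to_rem xy_ps.
have szps : size ps = (size (rem (x, y) ps)).+1 by rewrite (perm_size pe).
have [|ps1 [ps2 [pp Hp Hn Hs Hh]]] := IH (rem (x, y) ps) (s * tperm x y)%g.
  by rewrite -szps.
exists ((x, y) :: ps1), ps2.
rewrite /prod_tperm big_cons mulgA /= -/(prod_tperm ps1).
have xy : x != y by apply: contraNneq yx => <-; exact: porbit_id.
have ms := merge_porbit_sub yx.
have xys : y \in porbit (s * tperm x y)%g x.
  by rewrite porbit_tperm_merge // inE porbit_id orbT.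
split.
- by rewrite (perm_trans pe) //= perm_cons.
- move=> p; rewrite (perm_mem pe) inE => /orP[/eqP->|]; last exact: Hp.
  exact: (subsetP (Hs _)).
- have := card_porbits_tperm s xy; rewrite porbit_sym yx /= -muln2 mul1n addn2.
  by case=> <-; rewrite -Hn addnS.
- by move=> z; apply: subset_trans (ms z) (Hs z).
move=> G c h1; apply: Hh => z.
have hx : hol *%g (s * tperm x y)%g c x = 1%g.
  by rewrite hol_tperm_merge //= !h1 mulg1.
have [zx|zx] := boolP (z \in porbit (s * tperm x y)%g x).
  exact: hol1_porbit zx hx.
move: zx; rewrite porbit_tperm_merge // inE negb_or => /andP[zx zy].
by rewrite hol_tperm_out.
Qed.

(** A transposition that splits a cycle is undone by a merge, so trivial holonomies after it imply
    trivial ones before it. One that merges two cycles gives no such information: it is a handle,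
    recorded in [bad], and it shifts the count of cycles by 2 relative to a split. *)
Lemma split_phase ps s r : (forall x, porbit s x \subset porbit r x) ->
  (forall p, p \in ps -> p.1 != p.2 /\ p.2 \in porbit r p.1) ->
  exists bad : seq D,
  let s' := (s * prod_tperm ps)%g in
  [/\ (#|porbits s'| + (size bad).*2 = #|porbits s| + size ps)%N,
      forall x, porbit s' x \subset porbit r x
    & forall (G : groupType) (c : D -> G) x,
        (forall z, z \in bad -> z \notin porbit r x) ->
        (forall y, y \in porbit r x -> hol *%g s' c y = 1%g) ->
        forall y, y \in porbit r x -> hol *%g s c y = 1%g].
Proof.
elim: ps s => [|[x y] ps IH] s sr Hps.
  by exists [::]; rewrite /= /prod_tperm big_nil mulg1 !addn0; split.
have [/= xy yrx] := Hps (x, y) (mem_head _ _).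
have Hps' p : p \in ps -> p.1 != p.2 /\ p.2 \in porbit r p.1.
  by move=> pps; apply: Hps; rewrite inE pps orbT.
set t := (s * tperm x y)%g.
have st : (t * tperm x y)%g = s by rewrite /t -mulgA tperm2 mulg1.
have cnt := card_porbits_tperm s xy.
have [yx|yx] := boolP (y \in porbit s x).
  have cntt := card_porbits_tperm t xy.
  rewrite st in cntt; rewrite porbit_sym yx /= addn0 in cnt.
  have yxt : y \notin porbit t x.
    rewrite porbit_sym; move: cntt; rewrite -/t in cnt; rewrite cnt.
    by case: (_ \in _) => //= /eqP; rewrite addn0 -[X in X == _]addn0 -addn2 eqn_add2l.
  have tr z : porbit t z \subset porbit r z.
    by apply: subset_trans (sr z); have := merge_porbit_sub yxt z; rewrite st.
  have [bad [H1 H2 H3]] := IH t tr Hps'.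
  exists bad; rewrite /= /prod_tperm big_cons mulgA -/(prod_tperm ps) /= -/t.
  split=> //; first by rewrite H1 cnt addSnnS.
  move=> G c z zb zh u uz; have {}H3 := H3 G c z zb zh.
  rewrite -st; have [ux|ux] := boolP (u \in porbit s x).
    have xz : x \in porbit r z by apply: porbit_sub uz => //; rewrite porbit_sym.
    rewrite -st in ux; apply: hol1_porbit ux _.
    rewrite hol_tperm_merge //= !H3 ?mulg1 //.
    by rewrite -(porbit_eqP _ _ _ xz).
  move: ux; rewrite -{1}st porbit_tperm_merge // inE negb_or => /andP[ux uy].
  by rewrite hol_tperm_out // H3.
have ms := merge_porbit_sub yx.
have tr z : porbit t z \subset porbit r z.
  have [zx|zx] := boolP (z \in porbit t x).
    rewrite (porbit_eqP _ _ _ zx).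
    have -> : porbit r z = porbit r x.
      apply/porbit_eqP; move: zx; rewrite porbit_tperm_merge // inE => /orP[] zx.
        exact: (subsetP (sr x)).
      exact: porbit_sub zx yrx.
    rewrite porbit_tperm_merge // subUset sr /= -(porbit_eqP _ _ _ yrx).
    exact: sr.
  move: zx; rewrite porbit_tperm_merge // inE negb_or => /andP[zx zy].
  by rewrite porbit_tperm_out.
have [bad [H1 H2 H3]] := IH t tr Hps'.
exists (x :: bad); rewrite /= /prod_tperm big_cons mulgA -/(prod_tperm ps) /= -/t.
split=> //.
  move: cnt; rewrite porbit_sym yx /= -/t -muln2 mul1n addn2 => -[<-].
  by rewrite doubleS !addnS H1 addSn.
move=> G c z zb zh u uz.
have xz : x \notin porbit r z by apply: zb; rewrite mem_head.
have {}H3 : hol *%g t c u = 1%g.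
  by apply: H3 zh _ uz => v vb; apply: zb; rewrite inE vb orbT.
apply: etrans H3; rewrite /t hol_tperm_out //.
  apply: contra xz => ux; apply: porbit_sub uz => //.
  by rewrite porbit_sym.
apply: contra xz => uy.
have yz : y \in porbit r z by apply: porbit_sub uz => //; rewrite porbit_sym.
by rewrite -(porbit_eqP _ _ _ yz) porbit_sym.
Qed.

End GroupHolonomy.

(** * Ribbon graphs, and families of curves on a torus *)

Section Surface.
Variables (D : finType).
Implicit Types (s r : {perm D}) (x y z : D).

Lemma prod_tpermE (f : D -> D) (A : seq D) z : involutive f -> uniq A ->
  (forall x, x \in A -> f x \notin A) ->
  prod_tperm [seq (x, f x) | x <- A] z
    = if (z \in A) || (f z \in A) then f z else z.
Proof.
move=> fK; elim: A z => [|x A IH] z /=.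
  by rewrite /prod_tperm big_nil perm1.
case/andP=> xA uA fA; rewrite /prod_tperm big_cons permM -/(prod_tperm _) /=.
have fA' y : y \in A -> f y \notin A.
  by move=> yA; have := fA y; rewrite !inE yA orbT negb_or => /(_ isT)/andP[].
have := fA x (mem_head _ _); rewrite inE negb_or => /andP[fxx fxA].
have xfx : x != f x by rewrite eq_sym.
rewrite IH //; case: tpermP => [->|->|/eqP zx /eqP zfx].
- by rewrite fK (negPf fxA) (negPf xA) mem_head.
- by rewrite fK (negPf fxA) (negPf xA) mem_head orbT.
rewrite !inE (negPf zx) /=; have -> // : (f z == x) = false.
by apply: contra_neqF zfx => /eqP <-; rewrite fK.
Qed.

(* The merging transpositions are performed first: the orbits of [r] are then
   the connected components of the ribbon graph with vertices the cycles of [s],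
   edges the 2-cycles of [f] and boundary curves the cycles of [s * f]; the
   components that avoid [bad] are planar. *)
Lemma ribbon_graph s (f : {perm D}) : involutive f ->
  exists (r : {perm D}) (bad : seq D),
  [/\ (#|porbits s| + #|porbits (s * f)%g| + (size bad).*2
        = #|[set x | f x != x]|./2 + #|porbits r|.*2)%N,
      forall x, porbit s x \subset porbit r x,
      forall x, porbit (s * f)%g x \subset porbit r x,
      forall (G : groupType) (c : D -> G),
        (forall x, hol *%g s c x = 1%g) -> forall x, hol *%g r c x = 1%g
    & forall (G : groupType) (c : D -> G) x,
        (forall z, z \in bad -> z \notin porbit r x) ->
        (forall y, y \in porbit r x -> hol *%g (s * f)%g c y = 1%g) ->
        hol *%g r c x = 1%g].
Proof.
move=> fK.
(* One element of each 2-cycle of [f]. The resulting transpositions are disjoint, so their product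
   is [f] in whatever order the merging phase puts them. *)
pose A := [seq x <- enum D | enum_rank x < enum_rank (f x)]%N.
have inA x : (x \in A) = (enum_rank x < enum_rank (f x))%N.
  by rewrite mem_filter (mem_enum D) andbT.
have fA x : x \in A -> f x \notin A.
  by rewrite !inA fK => h; rewrite -leqNgt ltnW.
have uA : uniq A by rewrite filter_uniq // enum_uniq.
have AE x : (x \in A) || (f x \in A) = (f x != x).
  rewrite !inA fK -neq_ltn.
  by rewrite (inj_eq val_inj) (inj_eq enum_rank_inj) eq_sym.
pose ps := [seq (x, f x) | x <- A].
have fE ps' : perm_eq ps ps' -> prod_tperm ps' = f.
  move=> pp; have e : ps' = [seq (x, f x) | x <- map fst ps'].
    rewrite -map_comp -[LHS]map_id; apply/eq_in_map => p.
    by rewrite -(perm_mem pp) => /mapP[x _ ->].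
  have pA : perm_eq A (map fst ps').
    by have := perm_map fst pp; rewrite -map_comp map_id.
  apply/permP => x; rewrite e prod_tpermE //.
  - by rewrite -!(perm_mem pA) AE; case: eqP.
  - by rewrite -(perm_uniq pA).
  - by move=> z; rewrite -!(perm_mem pA); exact: fA.
have szA : size A = #|[set x | f x != x]|./2.
  have -> : [set x | f x != x] = [set x in A] :|: f @: [set x in A].
    apply/setP=> x; rewrite !inE -AE; congr (_ || _).
    apply/idP/imsetP => [h|[y yA ->]]; last by rewrite fK; rewrite inE in yA.
    by exists (f x); rewrite ?inE // fK.
  rewrite cardsU (_ : _ :&: _ = set0) ?cards0 ?subn0; last first.
    apply/setP=> x; rewrite !inE; apply/andP => -[xA /imsetP[y yA e]].
    by move: yA xA; rewrite inE e => /fA /negP.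
  by rewrite card_imset ?addnn ?doubleK ?cardsE ?(card_uniqP uA) //; exact: perm_inj.
have [ps1 [ps2 [pp Hp Hn Hs Hh]]] := merge_phase ps s.
set r := (s * prod_tperm ps1)%g in Hp Hn Hs Hh.
have rE : (r * prod_tperm ps2)%g = (s * f)%g.
  by rewrite -(fE _ pp) /prod_tperm big_cat /= mulgA.
have [|p pps2|bad [H1 H2 H3]] := @split_phase _ ps2 r r.
- by move=> x; exact: subxx.
- have pps : p \in ps by rewrite (perm_mem pp) mem_cat pps2 orbT.
  split; last exact: Hp.
  case/mapP: pps => x xA -> /=; apply: contraNneq (fA x xA) => <-; exact: xA.
rewrite rE in H1 H2 H3; exists r, bad; split=> //; last first.
  by move=> G c x zb zh; apply: (H3 G c x zb zh); exact: porbit_id.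
rewrite -szA -Hn -addnA H1 -(size_map (fun x => (x, f x))) -/ps (perm_size pp).
by rewrite size_cat -[in RHS]addnn addnACA addnC.
Qed.

Lemma sum_porbits r z : (\sum_(O in porbits r) (z \in O) = 1)%N.
Proof.
rewrite (bigD1 (porbit r z)) /=; last exact: imset_f.
rewrite porbit_id big1 // => O /andP[/imsetP[y _ ->] ne].
by apply/eqP; rewrite eqb0; apply: contra ne => /porbit_eqP ->.
Qed.

Section Update.
Variables (G : groupType).
Implicit Types (c : D -> G) (g h : G).

(** Changing a single label allows the holonomy of one boundary cycle to be made trivial, as if a
    disk were glued to it. *)
Definition upd c x g : D -> G := fun z => if z == x then (g * c z)%g else c z.

Lemma hol_upd s c x g : hol *%g s (upd c x g) x = (g * hol *%g s c x)%g.
Proof.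
rewrite /hol; have [w [-> _ /= /andP[xw _]]] := orbit_consE s x.
rewrite !big_cons {1}/upd eqxx mulgA; congr (_ * _)%g.
apply: eq_big_seq => y yw; rewrite /upd; case: eqP => // e.
by rewrite -e yw in xw.
Qed.

Lemma hol_upd_out s c x g z : x \notin porbit s z ->
  hol *%g s (upd c x g) z = hol *%g s c z.
Proof.
move=> xz; apply: eq_big_seq => y; rewrite mem_orbitP => yw.
by rewrite /upd; case: eqP => // e; rewrite -e yw in xz.
Qed.

Lemma hol_upd2 s c x y g h : x != y -> y \in porbit s x ->
  exists a b, hol *%g s c x = (a * b)%g /\
    hol *%g s (upd (upd c x g) y h) x = (g * a * h * b)%g.
Proof.
move=> xy; rewrite -mem_orbitP /hol; have [w [-> _ /= /andP[xw uw]]] := orbit_consE s x.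
rewrite inE eq_sym (negPf xy) /= => yw; case/splitPr: yw uw xw => u v.
rewrite mem_cat inE !negb_or cat_uniq /= => /and3P[_ /norP[yu _] /andP[yv _]].
move=> /and3P[xu _ xv].
have out (t : seq D) : x \notin t -> y \notin t ->
    (\big[*%g/1%g]_(z <- t) upd (upd c x g) y h z = \big[*%g/1%g]_(z <- t) c z)%g.
  move=> xt yt; apply: eq_big_seq => z zt; rewrite /upd.
  by case: eqP => [e|_]; [rewrite -e zt in yt | case: eqP => // e; rewrite -e zt in xt].
exists (c x * \big[*%g/1%g]_(z <- u) c z)%g, (c y * \big[*%g/1%g]_(z <- v) c z)%g.
rewrite !big_cons !big_cat !big_cons /= !out // {1 2}/upd (negPf xy) eqxx.
by rewrite /upd eq_sym (negPf xy) eqxx !mulgA.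
Qed.

End Update.

(** The cycles of [s * f] through [free] elements are the boundary curves left open. A component [O]
    with [b O] open curves and [k O] handles has Euler characteristic [2 - b O - 2 k O], and these
    sum to 0 by the first numerical hypothesis. Since [b O] is positive, either some component is a
    disk, or [b O + k O] is at least 2 everywhere, which forces [k O = 0] and [b O = 2]. *)
Lemma torus_curves (G : groupType) (c : D -> G) s (f : {perm D}) (free : pred D) :
  involutive f ->
  (#|porbits s| + #|porbits (s * f)%g|
    = #|[set x | f x != x]|./2 + #|[set porbit (s * f)%g x | x in free]|)%N ->
  (forall (A : {set D}) x, x \in A -> (forall y, y \in A -> s y \in A) ->
    (forall y, y \in A -> (s * f)%g y \in A) -> exists2 y, y \in A & free y) ->
  (forall x, hol *%g s c x = 1%g) ->
  (forall x, {in porbit (s * f)%g x, forall y, ~~ free y} ->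
    hol *%g (s * f)%g c x = 1%g) ->
  (exists2 x, free x & hol *%g (s * f)%g c x = 1%g) \/
  exists r : {perm D},
  [/\ forall x, s x \in porbit r x, forall x, (s * f)%g x \in porbit r x
    & forall x y, free x -> free y -> y \in porbit r x -> exists g : G,
       let h := hol *%g (s * f)%g c in
       (h y = g^-1 * h x * g \/ h y = g^-1 * (h x)^-1 * g)%g].
Proof.
set psi := (s * f)%g => fK euler hfree hs hpsi.
have [r [bad [Hn Hs Hp Hrs Hrp]]] := ribbon_graph s fK.
rewrite -/psi in Hn Hp Hrp.
set Bd := [set porbit psi x | x in free] in euler.
pose b (O : {set D}) := #|[set P in Bd | P \subset O]|.
have bE O : b O = (\sum_(P in Bd) (P \subset O))%N.
  by rewrite /b -sum1dep_card big_mkcondr.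
have sumb : (\sum_(O in porbits r) b O = #|Bd|)%N.
  under eq_bigr do rewrite bE.
  rewrite exchange_big /= -sum1_card; apply: eq_bigr => P /imsetP[x _ ->].
  rewrite -(sum_porbits r x); apply: eq_bigr => O /imsetP[y _ ->]; congr nat_of_bool.
  apply/idP/idP => [/subsetP->//|xy]; first exact: porbit_id.
  by rewrite -(porbit_eqP _ _ _ xy).
pose k (O : {set D}) := count (mem O) bad.
have sumk : (\sum_(O in porbits r) k O = size bad)%N.
  rewrite /k; elim: (bad) => [|z B IH] /=; first by rewrite big1.
  by rewrite big_split /= IH sum_porbits.
have inBd O x : O \in porbits r -> x \in O -> free x ->
    porbit psi x \in [set P in Bd | P \subset O].
  move=> /imsetP[y _ ->] xy fx; rewrite inE imset_f //=.
  by rewrite -(porbit_eqP _ _ _ xy).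
have clos x : exists2 y, y \in porbit r x & free y.
  apply: (hfree (porbit r x) x); first exact: porbit_id.
    by move=> y; apply: porbit_sub; [exact: Hs | exact: mem_porbit_step].
  by move=> y; apply: porbit_sub; [exact: Hp | exact: mem_porbit_step].
have b_gt0 O : O \in porbits r -> (0 < b O)%N.
  move=> Or; have /imsetP[x _ e] := Or; have [y yx fy] := clos x.
  by rewrite /b card_gt0; apply/set0Pn; exists (porbit psi y); apply: inBd; rewrite // e.
have nobad O x : O \in porbits r -> k O = 0%N -> x \in O ->
    forall z, z \in bad -> z \notin porbit r x.
  move=> /imsetP[y _ ->] /eqP; rewrite -leqn0 leqNgt -has_count -all_predC.
  by move=> /allP h xy z /h /=; rewrite -(porbit_eqP _ _ _ xy).
have [O /andP[/andP[Or /eqP bO] /eqP kO]|no1] :=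
    pickP (fun O => (O \in porbits r) && (b O == 1)%N && (k O == 0)%N).
  left; have /imsetP[o _ eO] := Or; have [x xo fx] := clos o.
  have xO : x \in O by rewrite eO.
  (* The disk: once the label of [x] is divided by [h], all boundary cycles of the component are
     trivial, hence so is its [r]-cycle. That cycle was already trivial and has been multiplied by
     the inverse of [h], so [h = 1]. *)
  exists x => //; set h := hol _ _ _ _.
  have := Hrp G (upd c x h^-1%g) x (nobad _ _ Or kO xO).
  rewrite hol_upd Hrs // mulg1 => H; apply/invg_inj; rewrite invg1.
  apply: H => y yx; have [yp|yp] := boolP (y \in porbit psi x).
    by apply: hol1_porbit yp _; rewrite hol_upd mulVg.
  rewrite hol_upd_out; last by rewrite porbit_sym.
  apply: hpsi => t ty; apply/negP => ft.
  have tO : t \in O.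
    by rewrite eO -(porbit_eqP _ _ _ xo); apply: porbit_sub Hp ty yx.
  have [P eP] := cards1P (introT eqP bO).
  have := inBd O x Or xO fx; have := inBd O t Or tO ft.
  rewrite eP !inE => /eqP et /eqP ex.
  by move: yp; rewrite -eq_porbit_mem eq_sym ex -et eq_porbit_mem ty.
right; have b2 O : O \in porbits r -> (2 <= b O + k O)%N.
  move=> Or; have := b_gt0 O Or; have := no1 O; rewrite Or /=.
  by case: (b O) => [|[|m]] //=; case: (k O).
have cnt : (#|Bd| + (size bad).*2 = #|porbits r|.*2)%N.
  by move: Hn; rewrite euler -addnA => /eqP; rewrite eqn_add2l => /eqP.
have le2 : (#|porbits r|.*2 <= #|Bd| + size bad)%N.
  rewrite -sumb -sumk -big_split /= -mul2n mulnC -sum_nat_const.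
  by apply: leq_sum => O /b2.
have bad0 : size bad = 0%N by move: cnt le2; rewrite -!addnn; lia.
have k0 O : k O = 0%N by rewrite /k; case: (bad) bad0.
have beq2 O : O \in porbits r -> b O = 2%N.
  have b2' P : P \in porbits r -> (2 <= b P)%N by move=> /b2; rewrite k0 addn0.
  have [_] := leqif_sum (fun P Pr => leqif_eq (b2' P Pr)).
  rewrite sum_nat_const muln2 sumb -cnt bad0 addn0 eqxx => /esym/forall_inP h Or.
  by rewrite -(eqP (h O Or)).
exists r; split=> [x|x|x y fx fy yx].
- by apply: (subsetP (Hs x)); exact: mem_porbit_step.
- by apply: (subsetP (Hp x)); exact: mem_porbit_step.
have [yp|yp] := boolP (y \in porbit psi x).
  by have [g eg] := hol_conj c yp; exists g; left.
pose O := porbit r x; have Or : O \in porbits r by exact: imset_f.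
have xO : x \in O by exact: porbit_id.
pose hx := hol *%g psi c x; pose hy := hol *%g psi c y.
have xy : x != y by apply: contraNneq yp => <-; exact: porbit_id.
(* The annulus: both boundary holonomies are killed at once. The [r]-cycle is trivial before and
   after the change, and comparing the two equations gives the conjugacy by [a]. *)
have [a [d [e1 e2]]] := hol_upd2 c hx^-1%g hy^-1%g xy yx.
have : (hx^-1 * a * hy^-1 * d)%g = 1%g.
  rewrite -e2; apply: Hrp (nobad _ _ Or (k0 O) xO) _ => t tx.
  have [ty|ty] := boolP (t \in porbit psi y).
    apply: hol1_porbit ty _; rewrite hol_upd hol_upd_out ?mulVg //.
    by rewrite porbit_sym.
  rewrite [LHS]hol_upd_out; last by rewrite porbit_sym.
  have [tpx|tpx] := boolP (t \in porbit psi x).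
    by apply: hol1_porbit tpx _; rewrite hol_upd mulVg.
  rewrite hol_upd_out; last by rewrite porbit_sym.
  apply: hpsi => u ut; apply/negP => fu.
  have uO : u \in O by apply: porbit_sub Hp ut tx.
  have : (2 < b O)%N.
    apply/card_gt2P; exists (porbit psi x), (porbit psi y), (porbit psi u).
    have pu : porbit psi u = porbit psi t by apply/porbit_eqP.
    split; first by split; apply: inBd.
    by rewrite pu !eq_porbit_mem porbit_sym yp porbit_sym ty.
  by rewrite beq2.
rewrite Hrs // in e1; have -> : d = a^-1%g by rewrite -(mulKg a d) -e1 mulg1.
move=> e; exists a; right; rewrite /= -/hx -/hy.
have : (hy^-1 = a^-1 * hx * a)%g.
  move/(congr1 (fun u : G => a^-1 * hx * u * a)%g): e.
  by rewrite !mulgA mulgK mulVg mul1g mulgVK mulg1.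
by move/(congr1 (fun u : G => u^-1)%g); rewrite invgK => ->; rewrite !invMg invgK mulgA.
Qed.
End Surface.

(** * Block matrices and the determinant of a twisted permutation *)

Section Blocks.
Variables (F : fieldType) (n : nat).

(** Sylvester's identity: both products of [W] and [Z] are block triangular, and they have the same
    determinant. *)
Lemma det_add1_mulC (p q : nat) (X : 'M[F]_(p, q)) (Y : 'M[F]_(q, p)) :
  \det (1%:M + X *m Y) = \det (1%:M + Y *m X).
Proof.
pose Z := block_mx 1%:M (- X) Y 1%:M : 'M[F]_(p + q).
pose W := block_mx 1%:M X 0 1%:M : 'M[F]_(p + q).
have dW : \det W = 1 by rewrite det_ublock !det1 mulr1.
have -> : \det (1%:M + X *m Y) = \det (W *m Z).
  rewrite mulmx_block !mul1mx !mulmx1 !mul0mx !add0r addNr.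
  by rewrite det_lblock det1 mulr1.
rewrite det_mulmx mulrC -det_mulmx mulmx_block !mul1mx !mulmx1 !mulmx0 !addr0 addrN.
by rewrite det_lblock det1 mul1r addrC.
Qed.

Lemma det_sub1_mulC (p q : nat) (X : 'M[F]_(p, q)) (Y : 'M[F]_(q, p)) :
  \det (1%:M - X *m Y) = \det (1%:M - Y *m X).
Proof. by rewrite -mulNmx det_add1_mulC mulmxN. Qed.

(* The inclusion of the [i]-th block and the projection onto it, for the
   indexing of blocks used by the Kronecker product. *)
Definition colb p (i : 'I_p) : 'M[F]_(p * n, n) :=
  \matrix_(k, y) (k == mxtens_index (i, y))%:R.
Definition rowb p (i : 'I_p) : 'M[F]_(n, p * n) := (colb i)^T.

Lemma mul_rowb p (i : 'I_p) q (X : 'M[F]_(p * n, q)) x y :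
  (rowb i *m X) x y = X (mxtens_index (i, x)) y.
Proof.
rewrite mxE (bigD1 (mxtens_index (i, x))) //= !mxE eqxx mul1r big1 ?addr0 // => k.
by move=> /negPf ne; rewrite !mxE ne mul0r.
Qed.

Lemma mul_colb p (i : 'I_p) q (X : 'M[F]_(q, p * n)) x y :
  (X *m colb i) x y = X x (mxtens_index (i, y)).
Proof.
rewrite mxE (bigD1 (mxtens_index (i, y))) //= !mxE eqxx mulr1 big1 ?addr0 // => k.
by move=> /negPf ne; rewrite !mxE ne mulr0.
Qed.

Lemma mxtens_index_eq p (i j : 'I_p) (x y : 'I_n) :
  (mxtens_index (i, x) == mxtens_index (j, y)) = (i == j) && (x == y).
Proof. by rewrite (can_eq (@mxtens_indexK _ _)). Qed.

Lemma rowb_colb p (i j : 'I_p) : rowb i *m colb j = (i == j)%:R%:M.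
Proof.
apply/matrixP=> x y; rewrite mul_rowb !mxE mxtens_index_eq.
by case: (i == j); case: (x == y); rewrite /= ?mulr1n ?mulr0n.
Qed.

Lemma rowb_colb0 p (i j : 'I_p) : i != j -> rowb i *m colb j = 0.
Proof. by move=> /negPf ij; rewrite rowb_colb ij -scalemx1 scale0r. Qed.

Lemma colb_mul p (i j : 'I_p) q (X : 'M[F]_(n, q)) x y :
  (colb i *m X) (mxtens_index (j, x)) y = (j == i)%:R * X x y.
Proof.
rewrite mxE (bigD1 x) //= mxE mxtens_index_eq eqxx andbT big1 ?addr0 // => k kx.
by rewrite mxE mxtens_index_eq [x == k]eq_sym (negPf kx) andbF mul0r.
Qed.

Lemma sum_colb_rowb p : \sum_(i < p) colb i *m rowb i = 1%:M.
Proof.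
apply/matrixP=> k l; case: (mxtens_indexP k) => i x.
rewrite summxE (bigD1 i) //= big1 ?addr0 => [|h /negPf hi].
  by rewrite colb_mul eqxx mul1r !mxE eq_sym.
by rewrite colb_mul eq_sym hi mul0r.
Qed.

Lemma blockP p q (X Y : 'M[F]_(p * n, q * n)) :
  (forall i j, rowb i *m X *m colb j = rowb i *m Y *m colb j) -> X = Y.
Proof.
move=> h; apply/matrixP=> k l.
case: (mxtens_indexP k) => i x; case: (mxtens_indexP l) => j y.
by have /matrixP/(_ x y) := h i j; rewrite !mul_colb !mul_rowb.
Qed.

Lemma det_block_unit p (i : 'I_p) (A : 'M[F]_n) :
  \det (1%:M + colb i *m A *m rowb i) = \det (1%:M + A).
Proof. by rewrite det_add1_mulC mulmxA rowb_colb eqxx mul1mx. Qed.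

Lemma det_block_transvection p (i j : 'I_p) (A : 'M[F]_n) : i != j ->
  \det (1%:M + colb i *m A *m rowb j) = 1.
Proof.
move=> ij; rewrite det_add1_mulC mulmxA rowb_colb0 1?eq_sym //.
by rewrite mul0mx addr0 det1.
Qed.

Lemma det_block_diag p (A : 'I_p -> 'M[F]_n) :
  \det (\sum_i colb i *m A i *m rowb i) = \prod_i \det (A i).
Proof.
pose X s := 1%:M + \sum_(i <- s) colb i *m (A i - 1%:M) *m rowb i.
have detX s : uniq s -> \det (X s) = \prod_(i <- s) \det (A i).
  elim: s => [_|i s IH /=/andP[is_ us]]; first by rewrite /X !big_nil addr0 det1.
  rewrite big_cons -IH // -[A i in RHS](subrKC 1%:M) -(det_block_unit i) -det_mulmx.
  congr (\det _); rewrite /X big_cons.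
  set M := colb i *m _ *m rowb i; rewrite mulmxDl mul1mx mulmxDr mulmx1.
  rewrite [M *m _](_ : _ = 0) ?addr0 ?[M + _]addrC ?addrA //.
  rewrite mulmx_sumr big_seq big1 // => j js; rewrite -!mulmxA (mulmxA (rowb i)).
  rewrite rowb_colb0 ?mul0mx ?mulmx0 //.
  by apply: contraNneq is_ => ->.
rewrite -(detX (index_enum _) (index_enum_uniq _)); congr (\det _).
rewrite /X -[X in X + _]sum_colb_rowb -big_split; apply: eq_bigr => i _ /=.
by rewrite mulmxBr mulmx1 mulmxBl subrKC.
Qed.

Definition twperm p (s : {perm 'I_p}) (c : 'I_p -> 'M[F]_n) : 'M[F]_(p * n) :=
  \sum_i colb i *m c i *m rowb (s i).

Lemma rowb_twperm p (s : {perm 'I_p}) c i :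
  rowb i *m twperm s c = c i *m rowb (s i).
Proof.
rewrite mulmx_sumr (bigD1 i) //= big1 ?addr0 => [|j ji].
  by rewrite !mulmxA rowb_colb eqxx mul1mx.
by rewrite !mulmxA rowb_colb0 ?mul0mx // eq_sym.
Qed.

Lemma det_hol_porbit p (s : {perm 'I_p}) (c : 'I_p -> 'M[F]_n) x y :
  y \in porbit s x ->
  \det (1%:M - hol *%R s c y) = \det (1%:M - hol *%R s c x).
Proof.
case/porbitP=> i ->; elim: i => [|i <-]; first by rewrite expg0 perm1.
rewrite expgSr permM; move: ((s ^+ i)%g x) => z.
have [q [-> ->]] := hol_split *%R s c z; exact: det_sub1_mulC.
Qed.

(* Row and column operations that make the cycle through [x] bypass [x]. *)
Lemma det_twperm_bypass p (s : {perm 'I_p}) (c : 'I_p -> 'M[F]_n) x :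
  s x != x ->
  \det (1%:M - twperm s c)
    = \det (1%:M - twperm (s * tperm x (s x))%g
        (fun i => if i == x then 0
                  else if s i == x then c i *m c x else c i)).
Proof.
move=> sx; set s' := (s * _)%g; set c' := fun i => _.
have [y sy] : exists y, s y = x by exists ((s^-1)%g x); rewrite permKV.
have yx : y != x by apply: contraNneq sx => e; rewrite -{1}e sy.
(* Multiplying on the left by [1 + E] replaces the step from [y] to [x] by the composite step from
   [y] to [s x]. Multiplying on the right by [1 + H] then erases the step out of [x]. *)
pose E := colb y *m c y *m rowb x; pose H := colb x *m c x *m rowb (s x).
suff <- : (1%:M + E) *m (1%:M - twperm s c) *m (1%:M + H) = 1%:M - twperm s' c'.
  rewrite !det_mulmx !det_block_transvection ?mul1r ?mulr1 // eq_sym //.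
have sEK : twperm s c = E + H + \sum_(i | (i != x) && (i != y)) colb i *m c i *m rowb (s i).
  rewrite /twperm (bigD1 y) //= sy -addrA (bigD1 x) //=; last by rewrite eq_sym.
  by congr (_ + (_ + _)); apply: eq_bigl => i; rewrite andbC.
have sEK' : twperm s' c' = colb y *m (c y *m c x) *m rowb (s x) +
    \sum_(i | (i != x) && (i != y)) colb i *m c i *m rowb (s i).
  rewrite /twperm (bigD1 y) //= (bigD1 x) //=; last by rewrite eq_sym.
  rewrite {1 2}/c' eqxx (negPf yx) sy eqxx mulmx0 mul0mx add0r /s' permM sy tpermL.
  congr (_ + _); apply: eq_big => [i|i]; first by rewrite andbC.
  rewrite andbC => /andP[ix iy]; rewrite /c' (negPf ix).
  have /negPf six : s i != x by rewrite -sy (inj_eq perm_inj).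
  rewrite six permM tpermD // eq_sym ?six // (inj_eq perm_inj) //.
have EK : E *m twperm s c = colb y *m (c y *m c x) *m rowb (s x).
  by rewrite /E -mulmxA rowb_twperm !mulmxA.
have -> : (1%:M + E) *m (1%:M - twperm s c) = 1%:M - twperm s' c' - H.
  rewrite mulmxDl mul1mx mulmxBr mulmx1 EK sEK sEK' !opprD !addrA.
  rewrite 2!(addrAC _ _ E) subrK (addrAC _ (- \sum_(_ | _) _)).
  by rewrite (addrAC _ (- H)) (addrAC _ (- H)).
rewrite mulmxDr mulmx1 mulmxBl mulmxBl mul1mx.
have -> : H *m H = 0 by rewrite /H -!mulmxA (mulmxA (rowb _)) rowb_colb0 // mul0mx !mulmx0.
have -> : twperm s' c' *m H = 0.
  rewrite sEK' mulmxDl /H !mulmxA -(mulmxA _ (rowb (s x))) rowb_colb0 // mulmx0 !mul0mx add0r.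
  rewrite !mulmx_suml big1 // => i /andP[ix iy].
  rewrite -(mulmxA _ (rowb (s i))) rowb_colb0 ?mulmx0 ?mul0mx //.
  by rewrite -sy (inj_eq perm_inj).
by rewrite !subr0 subrK.
Qed.

End Blocks.

Section DetTwistedPermutation.
Variables (F : fieldType) (n : nat).

Lemma orbit_rcons (D : finType) (s : {perm D}) x y : s y = x ->
  exists w, orbit s x = rcons w y.
Proof.
move=> sy; have [w [e cw uw]] := orbit_consE s x.
move: e cw; case: (lastP w) => [|v z] ->; rewrite (cycle_path x) /=.
  by rewrite andbT => /eqP sx; exists [::]; congr [:: _]; apply: (@perm_inj _ s); rewrite sx.
rewrite last_rcons => /andP[/eqP sz _]; exists (x :: v).
by rewrite rcons_cons; congr (_ :: rcons _ _); apply: (@perm_inj _ s); rewrite sz.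
Qed.

Lemma hol_perm1 (D : finType) (T : Type) (idx : T) (op : Monoid.law idx)
  (s : {perm D}) (c : D -> T) x : s x = x -> hol op s c x = c x.
Proof. by move=> sx; rewrite /hol (@orbit_cons _ _ [::]) ?big_seq1 //= sx eqxx. Qed.

(** In the cycle of [x] the bypass absorbs [c x] into the label of the predecessor, which moves this
    factor from the front of the product to its end. The determinant does not see such a
    rotation. *)
Lemma det_hol_bypass p (s : {perm 'I_p}) (c : 'I_p -> 'M[F]_n) x :
  let s' := (s * tperm x (s x))%g in
  let c' := fun i => if i == x then 0
                     else if s i == x then c i *m c x else c i in
  s x != x -> forall r, r != x ->
  \det (1%:M - hol *%R s' c' r) = \det (1%:M - hol *%R s c r).
Proof.
move=> s' c' sx r rx.
have ss' : (s' * tperm x (s x))%g = s by rewrite /s' -mulgA tperm2 mulg1.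
have s'x : s' x = x by rewrite permM tpermR.
have px : porbit s' x = [set x].
  apply/setP=> z; rewrite -mem_orbitP (@orbit_cons _ _ [::]) ?inE //=.
  by rewrite s'x eqxx.
have sxx : s x \notin porbit s' x by rewrite px inE.
have [rs|rs] := boolP (r \in porbit s' (s x)); last first.
  have rx' : r \notin porbit s' x by rewrite px inE.
  rewrite -[in RHS]ss' hol_tperm_out //; congr (\det (1%:M - _)).
  apply: eq_big_seq => i; rewrite mem_orbitP => ir; rewrite /c'.
  case: eqP => [ix|_]; first by move: rx'; rewrite porbit_sym -ix ir.
  case: eqP => // six; move: rs; rewrite porbit_sym.
  have -> : s x = s' i by rewrite permM six tpermL.
  by rewrite (porbit_sub (fun=> subxx _) (mem_porbit_step _ _) ir).
rewrite (det_hol_porbit _ rs).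
have rs2 : r \in porbit s x.
  by have := porbit_tperm_merge sxx; rewrite ss' => ->; rewrite inE rs orbT.
have hm : hol *%R s c x = c x * hol *%R s' c (s x).
  by have := hol_tperm_merge *%R c sxx; rewrite ss' (hol_perm1 *%R c s'x).
rewrite (det_hol_porbit _ rs2) hm.
have [y sy] : exists y, s y = x by exists ((s^-1)%g x); rewrite permKV.
have s'y : s' y = s x by rewrite permM sy tpermL.
have yx : y != x by apply: contraNneq sx => e; rewrite -{1}e sy.
have [w e] := orbit_rcons s'y.
have uw := orbit_uniq s' (s x).
have xw : x \notin orbit s' (s x) by rewrite mem_orbitP porbit_sym.
rewrite /hol e !big_rcons /= [c' y]/c' (negPf yx) sy eqxx.
rewrite -[c x * _]/(c x *m _) det_sub1_mulC; congr (\det (1%:M - _)).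
rewrite -[RHS]/(_ * c y * c x) -[c y *m c x]/(c y * c x) -mulrA; congr (_ * _).
rewrite e rcons_uniq mem_rcons inE negb_or in uw xw.
have /andP[_ {}xw] := xw; have /andP[yw _] := uw.
apply: eq_big_seq => i iw; rewrite /c'.
case: eqP => [ix|_]; first by rewrite -ix iw in xw.
by case: eqP => // six; move: iw; rewrite (perm_inj (etrans six (esym sy))) (negPf yw).
Qed.

(** Induction on the number of moved points. A bypassed point becomes a fixed point with label 0,
    whose factor is 1, and it is removed from the set of representatives. *)
Lemma det_twperm p (s : {perm 'I_p}) (c : 'I_p -> 'M[F]_n) :
  exists R : {set 'I_p}, (forall x, exists2 r, r \in R & r \in porbit s x) /\
    \det (1%:M - twperm s c) = \prod_(r in R) \det (1%:M - hol *%R s c r).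
Proof.
have [m] := ubnP #|[set x | s x != x]|; elim: m s c => // m IH s c.
rewrite ltnS => lem; have [x sx|s1] := pickP (fun x => s x != x); last first.
  have sE x : s x = x by have /negbFE/eqP := s1 x.
  exists [set: 'I_p]; split=> [x|]; first by exists x; rewrite ?inE ?porbit_id.
  under eq_bigr do rewrite hol_perm1 //.
  rewrite (eq_bigl predT) => [|x]; last by rewrite inE.
  rewrite -det_block_diag; congr (\det _).
  rewrite -[1%:M]sum_colb_rowb /twperm -sumrB; apply: eq_bigr => i _.
  by rewrite sE mulmxBr mulmx1 mulmxBl.
have [|R [HR dR]] := IH (s * tperm x (s x))%g
  (fun i => if i == x then 0 else if s i == x then c i *m c x else c i).
  apply: leq_trans lem; apply/proper_card/properP; split.
    apply/subsetP=> z; rewrite !inE; apply: contraNneq => sz.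
    rewrite permM sz; case: tpermP => // [zx|zs]; first by rewrite -zx sz eqxx in sx.
    by rewrite {1}zs; move: sz; rewrite zs => /perm_inj e; rewrite e in sx *; rewrite eqxx in sx.
  by exists x; rewrite !inE ?sx // permM tpermR eqxx.
move: HR dR; set s' := (s * _)%g.
set c' := (fun i : 'I_p => if i == x then _ else _) => HR dR.
have ss' : (s' * tperm x (s x))%g = s by rewrite /s' -mulgA tperm2 mulg1.
have s'x : s' x = x by rewrite permM tpermR.
have px : porbit s' x = [set x].
  apply/setP=> z; rewrite -mem_orbitP (@orbit_cons _ _ [::]) ?inE //=.
  by rewrite s'x eqxx.
have sxx : s x \notin porbit s' x by rewrite px inE.
have sub := merge_porbit_sub sxx; rewrite ss' in sub.
exists (R :\ x); split=> [y|].
  have key z : z != x -> exists2 r, r \in R :\ x & r \in porbit s z.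
    move=> zx; have [r rR rz] := HR z; exists r.
      rewrite !inE rR andbT; apply: contraNneq zx => e; move: rz.
      by rewrite e porbit_sym px inE.
    exact: (subsetP (sub z)).
  have [->|/key//] := eqVneq y x; have [r rR rs] := key _ sx; exists r => //.
  by rewrite -(porbit_eqP _ _ _ (mem_porbit_step s x)).
rewrite (det_twperm_bypass c sx) dR.
have -> : \prod_(r in R) \det (1%:M - hol *%R s' c' r) =
          \prod_(r in R :\ x) \det (1%:M - hol *%R s' c' r).
  rewrite [RHS]big_mkcond [LHS]big_mkcond /= (bigD1 x) //= [RHS](bigD1 x) //=.
  rewrite !inE eqxx /= hol_perm1 // /c' eqxx subr0 det1 if_same !mul1r.
  by apply: eq_bigr => i ix; rewrite !inE ix.
by apply: eq_bigr => r; rewrite !inE => /andP[rx _]; exact: det_hol_bypass.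
Qed.

End DetTwistedPermutation.

(** * Deck transformations and turning around edges in the universal cover *)

Section Cover.
Variables (N : nat) (T : ordered_triangulation N) (base : 'I_N).
Notation utet := (utet T base).
Notation pi1 := (pi1 T base).
Local Notation repr := generic_quotient.repr.
Local Notation order := fingraph.order.
Implicit Types (X Y : utet) (g h : pi1).

Lemma uclass_repr X : uclass T base (repr X) = X.
Proof. by rewrite /uclass reprK. Qed.

Lemma uwalk_class s t : uwalk (uclass T base s) t = uclass T base (s ++ t).
Proof. by apply/eqP/uclassP/homotopic_catr/repr_uclass. Qed.

Lemma uproj_uwalk X s : uproj (uwalk X s) = path_end T (uproj X) s.
Proof. by rewrite /uwalk uproj_class path_end_cat. Qed.

Lemma uwalk_cat X s t : uwalk (uwalk X s) t = uwalk X (s ++ t).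
Proof. by rewrite {2}/uwalk uwalk_class -catA. Qed.

Lemma uwalk_homotopic X s t : homotopic T (uproj X) s t -> uwalk X s = uwalk X t.
Proof. by move=> h; apply/eqP/uclassP; apply: homotopic_catl. Qed.

Lemma uwalk_nil X : uwalk X [::] = X.
Proof. by rewrite /uwalk cats0 uclass_repr. Qed.

Lemma deck_class g s : deck g (uclass T base s) = uclass T base (pi1_path g ++ s).
Proof. by apply/eqP/uclassP/pi1_catr/repr_uclass. Qed.

Lemma deck_uwalk g X s : deck g (uwalk X s) = uwalk (deck g X) s.
Proof. by rewrite deck_class uwalk_class catA. Qed.

Lemma uproj_deck g X : uproj (deck g X) = uproj X.
Proof. by rewrite uproj_class path_end_cat pi1_end. Qed.

Lemma deckM g h X : deck (g * h)%g X = deck g (deck h X).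
Proof.
rewrite /deck -/(deck g _) deck_class; apply/eqP/uclassP; rewrite catA.
exact/homotopic_catr/pi1_path_class.
Qed.

Lemma deck1 X : deck 1%g X = X.
Proof.
rewrite -[RHS]uclass_repr; apply/eqP/uclassP.
exact: (homotopic_catr _ (pi1_path_class _)).
Qed.

Lemma deckK g : cancel (deck g) (deck g^-1%g).
Proof. by move=> X; rewrite -deckM mulVg deck1. Qed.

Lemma deck_free g h X : deck g X = deck h X -> g = h.
Proof.
move=> /eqP/uclassP hgh; apply/val_inj; rewrite -[LHS]uclass_repr -[RHS]uclass_repr.
have uX : path_end T base (repr X) = uproj X by [].
have key (k : pi1) : homotopic T base ((pi1_path k ++ repr X) ++ Defs.rev_path T base (repr X))
    (pi1_path k).
  rewrite -catA -[X in homotopic _ _ _ X]cats0; apply: homotopic_catl.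
  by rewrite pi1_end; exact: rev_pathr.
apply/eqP/uclassP; apply: rst_trans (key h); apply: rst_trans (homotopic_catr _ hgh).
exact/rst_sym/key.
Qed.

Lemma deck_trans X Y : uproj X = uproj Y -> exists g, X = deck g Y.
Proof.
move=> e; have c : path_end T base (repr X ++ Defs.rev_path T base (repr Y)) = base.
  by rewrite path_end_cat -/(uproj X) e rev_path_end.
exists (pi1_class c); rewrite -[LHS]uclass_repr; apply/eqP/uclassP/rst_sym.
apply: rst_trans (homotopic_catr _ (pi1_path_class _)) _.
have := @homotopic_catl _ T base (Defs.rev_path T base (repr Y) ++ repr Y) [::] (repr X).
rewrite cats0 catA; apply; rewrite -/(uproj X) e; exact: rev_pathl.
Qed.

(** The default value 1 is taken only when [X] and [Y] lie over different tetrahedra. *)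
Definition udiff X Y : pi1 := xget 1%g [set g | X = deck g Y]%classic.

Lemma udiffP X Y : uproj X = uproj Y -> X = deck (udiff X Y) Y.
Proof. by case/deck_trans => g h; rewrite /udiff; case: xgetP => [k -> //|/(_ g)]. Qed.

Lemma udiff_eq g X Y : X = deck g Y -> udiff X Y = g.
Proof.
move=> e; apply: (@deck_free _ _ Y); rewrite -e -udiffP //.
by rewrite e uproj_deck.
Qed.

Lemma udiff_refl X : udiff X X = 1%g.
Proof. by apply: udiff_eq; rewrite deck1. Qed.

Lemma udiff_mul X Y Z : uproj X = uproj Y -> uproj Y = uproj Z ->
  (udiff X Y * udiff Y Z)%g = udiff X Z.
Proof. by move=> xy yz; apply/esym/udiff_eq; rewrite deckM -!udiffP. Qed.

Lemma uproj_uglue (F : utet * 'I_4) :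
  (uproj (uglue F).1, (uglue F).2) = glue T (uproj F.1, F.2).
Proof. by rewrite /= uproj_uwalk /path_end /= /cross -surjective_pairing. Qed.

Lemma uglueK : involutive (@uglue N T base).
Proof.
move=> [X a]; rewrite /uglue /= uwalk_cat uproj_uwalk /= /cross.
rewrite -surjective_pairing glueK /=; congr (_, _).
rewrite -[RHS]uwalk_nil; apply: uwalk_homotopic.
by apply: rst_step; exact: (@BacktrackStep _ _ _ [::] [::]).
Qed.

Definition udeck g (F : utet * 'I_4) : utet * 'I_4 := (deck g F.1, F.2).

Lemma uglue_deck g F : uglue (udeck g F) = udeck g (uglue F).
Proof. by rewrite /uglue /udeck /= deck_uwalk uproj_deck. Qed.

Definition eproj (x : utet * edge4) : 'I_N * edge4 := (uproj x.1, x.2).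

Definition urotate (x : utet * edge4) : utet * edge4 :=
  (uwalk x.1 [:: exit_face (positive T (uproj x.1)) x.2], (rotate T (eproj x)).2).

Lemma eproj_urotate x : eproj (urotate x) = rotate T (eproj x).
Proof. by rewrite /eproj /= uproj_uwalk. Qed.

Lemma eproj_iter k x : eproj (iter k urotate x) = iter k (rotate T) (eproj x).
Proof. by elim: k => //= k IH; rewrite eproj_urotate IH. Qed.

Lemma iter_urotate k x : (iter k urotate x).1 =
  uwalk x.1 [seq exit_face (positive T y.1) y.2 | y <- traject (rotate T) (eproj x) k].
Proof.
elim: k x => [|k IH] x; first by rewrite uwalk_nil.
by rewrite iterSr IH eproj_urotate /= uwalk_cat.
Qed.

(** The boundary of the dual 2-cell is null-homotopic, so a full turn around an edge closes up in
    the cover. *)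
Lemma iter_order_urotate x : is_edge x.2 ->
  iter (order (rotate T) (eproj x)) urotate x = x.
Proof.
move=> ex; set k := order _ _.
have e1 : (iter k urotate x).1 = x.1.
  rewrite iter_urotate -[RHS]uwalk_nil; apply: uwalk_homotopic; apply: rst_step.
  have := @EdgeLoopStep _ T (uproj x.1) [::] [::] x.2 ex; rewrite /= cats0.
  exact.
have := eproj_iter k x; rewrite (@iter_order_rotate _ T (eproj x) ex).
by move: e1; case: (iter k urotate x) => X e /= -> [->]; rewrite -surjective_pairing.
Qed.

Lemma is_edge_urotate x : is_edge x.2 -> is_edge (urotate x).2.
Proof. by move=> ex; have [] := @rotate_turn _ T (eproj x) ex. Qed.

Lemma is_edge_iter k x : is_edge x.2 -> is_edge (iter k urotate x).2.
Proof. by move=> ex; elim: k => //= k /is_edge_urotate. Qed.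

Lemma iter_mul_order k x : is_edge x.2 ->
  iter (k * order (rotate T) (eproj x)) urotate x = x.
Proof.
by move=> ex; elim: k => // k IH; rewrite mulSn iterD IH iter_order_urotate.
Qed.

Lemma urotate_back x : is_edge x.2 ->
  exists z, [/\ is_edge z.2, urotate z = x &
   z = ((uglue (x.1, exit_face (~~ positive T (uproj x.1)) x.2)).1,
        edge_map (exit_face (~~ positive T (uproj x.1)) x.2)
          (glue T (uproj x.1, exit_face (~~ positive T (uproj x.1)) x.2)).2 x.2)].
Proof.
move=> ex; pose z := iter (order (rotate T) (eproj x)).-1 urotate x.
have zx : urotate z = x.
  by rewrite /z -iterS orderSpred iter_order_urotate.
have ez : is_edge z.2 by exact: is_edge_iter.
exists z; split=> //.
have := @rotate_turn _ T (eproj z) ez; rewrite -eproj_urotate zx.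
case=> _ h1 h2; move: h1 h2; rewrite /=.
set a := exit_face _ z.2; set b := exit_face _ x.2 => h1 h2.
have hg : uglue (z.1, a) = (x.1, b).
  by rewrite /uglue /= -h1 -zx.
have hg' : glue T (uproj x.1, b) = (uproj z.1, a).
  by have := uproj_uglue (uglue (z.1, a)); rewrite uglueK hg => /= <-.
have hw : uwalk x.1 [:: b] = z.1.
  by have := congr1 fst (uglueK (z.1, a)); rewrite hg.
rewrite hw hg' /=; move: h2; rewrite -h1 => ->.
by case: (z).
Qed.

End Cover.

Arguments urotate {N T base} x.

(** [exitn] and [mapn] are versions of [exit_face] and [face_map] on natural numbers. They compute,
    so that statements about a single tetrahedron reduce to the enumeration done by [case_ord]. *)
Definition exitn (o : bool) (u v : nat) : nat :=
  nth 0%N [seq a <- iota 0 4 | (a != u) && (a != v)] (o != odd (u + v)).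

Definition mapn (a b u : nat) : nat := if u == a then b else bump b (unbump a u).

Lemma val_exit_face o (e : edge4) : val (exit_face o e) = exitn o e.1 e.2.
Proof.
have nthE s i : val (nth (ord0 : 'I_4) s i) = nth 0%N (map val s) i.
  by elim: s i => [|y s IH] [|i] //=; rewrite IH.
by rewrite /exit_face nthE /exitn -val_enum_ord [in RHS]filter_map.
Qed.

Lemma val_face_map (a b u : 'I_4) : val (face_map a b u) = mapn a b u.
Proof.
rewrite /face_map /mapn val_eqE; case: unliftP => [i|] -> /=.
  by rewrite eq_sym (negPf (neq_lift _ _)) bumpK.
by rewrite eqxx.
Qed.

Ltac case_ord v :=
  move: (ltn_ord v); move: (nat_of_ord v) => {}v;
  do 4?[case: v => [|v]] => // _.

Lemma exit_face_notin o (e : edge4) : is_edge e ->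
  (exit_face o e != e.1) && (exit_face o e != e.2).
Proof.
case: e => u v; rewrite /is_edge /= -!val_eqE val_exit_face /=.
apply/implyP; case_ord v; case_ord u; by case: o.
Qed.

Lemma exit_faceE o (e : edge4) (a : 'I_4) : is_edge e -> a != e.1 -> a != e.2 ->
  a = exit_face o e \/ a = exit_face (~~ o) e.
Proof.
move=> he h1 h2; suff /orP[/eqP|/eqP] : (a == exit_face o e) || (a == exit_face (~~ o) e).
- by left.
- by right.
move: he h1 h2; case: e => u v; rewrite /is_edge -!val_eqE !val_exit_face /=.
move=> he h1 h2; move: he; apply/implyP; move: h2; apply/implyP; move: h1; apply/implyP.
case_ord v; case_ord u; case_ord a; by case: o.
Qed.

Lemma is_edge_map (a b : 'I_4) (e : edge4) : a != e.1 -> a != e.2 ->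
  is_edge (edge_map a b e) = is_edge e.
Proof.
case: e => u v; rewrite /is_edge /= !val_face_map -!val_eqE => h1 h2.
suff: (a != u :> nat) && (a != v :> nat) ==> ((mapn a b u < mapn a b v) == (u < v))%N.
  by move=> /implyP h; apply: (eqP (h _)); rewrite h1.
by clear h1 h2; case_ord v; case_ord u; case_ord a; case_ord b.
Qed.

Lemma face_mapK (a b v : 'I_4) : v != a -> face_map b a (face_map a b v) = v.
Proof.
rewrite -!val_eqE => va; apply/val_inj; rewrite !val_face_map; apply/eqP; move: va.
by apply/implyP; rewrite /=; case_ord v; case_ord a; case_ord b.
Qed.

Lemma face_map_neq (a b v : 'I_4) : v != a -> face_map a b v != b.
Proof.
rewrite -!val_eqE val_face_map; apply/implyP.
by rewrite /=; case_ord v; case_ord a; case_ord b.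
Qed.

(** * Identified edges in the universal cover *)

Section SameEdge.
Variables (N : nat) (T : ordered_triangulation N) (base : 'I_N).
Notation utet := (utet T base).
Notation pi1 := (pi1 T base).
Local Notation order := fingraph.order.
Implicit Types (X Y : utet) (g h : pi1) (x y : utet * edge4).

Lemma edge_glued_urotate x y : edge_glued (@uglue N T base) x y -> is_edge x.2 ->
  is_edge y.2 /\ (y = urotate x \/ x = urotate y).
Proof.
case=> a [h1 h2 ->] ex; split; first by rewrite is_edge_map.
have [->|ea] := exit_faceE (positive T (uproj x.1)) ex h1 h2; first by left.
by right; have [z [_ zx zE]] := urotate_back ex; rewrite -[LHS]zx zE -ea.
Qed.

Lemma edge_glued_edge x y : edge_glued (@uglue N T base) x y ->
  is_edge x.2 = is_edge y.2.
Proof. by case=> a [h1 h2 ->]; rewrite is_edge_map. Qed.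

Lemma iter_urotate_inv k x y : is_edge x.2 -> y = iter k urotate x ->
  exists l, x = iter l urotate y.
Proof.
move=> ex ->; set m := order (rotate T) (eproj x).
exists (k * m - k)%N; rewrite -iterD subnK ?iter_mul_order //.
by rewrite leq_pmulr // fingraph.order_gt0.
Qed.

(** A single gluing is one turn forward or backward, and a backward turn is an iterate of the
    forward one because a full turn closes up. *)
Lemma same_edge_iter x y : same_edge (@uglue N T base) x y ->
  is_edge x.2 = is_edge y.2 /\ (is_edge x.2 -> exists k, y = iter k urotate x).
Proof.
elim=> {x y} [x y xy|x|x y _ [e IH]|x y z _ [e1 IH1] _ [e2 IH2]].
- split=> [|ex]; first exact: edge_glued_edge xy.
  have [ey [->|h]] := edge_glued_urotate xy ex; first by exists 1%N.
  exact: (@iter_urotate_inv 1 y x).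
- by split=> // _; exists 0%N.
- split=> // ey; have ex : is_edge x.2 by rewrite e.
  by have [k /(iter_urotate_inv ex)] := IH ex.
split=> [|ex]; first by rewrite e1.
have [k yk] := IH1 ex; have ey : is_edge y.2 by rewrite -e1.
by have [l zl] := IH2 ey; exists (l + k)%N; rewrite iterD -yk.
Qed.

(** The turns leading from one edge to the other project to a closed rotation below, so their number
    is a multiple of the order there, and full turns are trivial in the cover. This is what makes
    the group element attached to an edge of a tetrahedron unique. *)
Lemma same_edge_uniq X Y e : is_edge e -> uproj X = uproj Y ->
  same_edge (@uglue N T base) (X, e) (Y, e) -> X = Y.
Proof.
move=> ee pXY /same_edge_iter[_ /(_ ee)[k hk]].
set m := order (rotate T) (eproj (X, e)).
have m0 : (0 < m)%N by exact: fingraph.order_gt0.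
have hr : iter (k %% m) (rotate T) (eproj (X, e)) = eproj (X, e).
  have : eproj (Y, e) = eproj (X, e) by rewrite /eproj /= pXY.
  rewrite hk eproj_iter {1}(divn_eq k m) addnC iterD -eproj_iter -/m.
  by rewrite iter_mul_order.
have k0 : (k %% m = 0)%N.
  have km : (k %% m < m)%N by rewrite ltn_mod.
  have := findex_iter km; rewrite hr => <-.
  by rewrite findex0.
have : (Y, e) = (X, e).
  by rewrite hk (divn_eq k m) k0 addn0 iter_mul_order.
by case.
Qed.

Lemma same_edge_deck g x y : same_edge (@uglue N T base) x y ->
  same_edge (@uglue N T base) (deck g x.1, x.2) (deck g y.1, y.2).
Proof.
elim=> {x y} [x y [a [h1 h2 ->]]|x|x y _ IH|x y z _ IH1 _ IH2].
- apply: rst_step; exists a; split=> //=.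
  by rewrite deck_uwalk uproj_deck.
- exact: rst_refl.
- exact: rst_sym.
- exact: rst_trans IH2.
Qed.

Lemma same_edge_proj x y : same_edge (@uglue N T base) x y ->
  same_edge (glue T) (eproj x) (eproj y).
Proof.
elim=> {x y} [x y [a [h1 h2 ->]]|x|x y _ IH|x y z _ IH1 _ IH2].
- by apply: rst_step; exists a; split=> //; rewrite /eproj /= uproj_uwalk.
- exact: rst_refl.
- exact: rst_sym.
- exact: rst_trans IH2.
Qed.

(** Lifting from both ends is stated together so that the induction passes through symmetry. *)
Lemma same_edge_lift (a b : 'I_N * edge4) : same_edge (glue T) a b ->
  (forall X, uproj X = a.1 ->
    exists2 Y, uproj Y = b.1 & same_edge (@uglue N T base) (X, a.2) (Y, b.2)) /\
  (forall Y, uproj Y = b.1 ->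
    exists2 X, uproj X = a.1 & same_edge (@uglue N T base) (X, a.2) (Y, b.2)).
Proof.
elim=> {a b} [a b [f [h1 h2 ->]]|a|a b _ [IH1 IH2]|a b d _ [IH1 IH2] _ [IH3 IH4]].
- split=> [X hX|Y /= hY].
    exists (uglue (X, f)).1; first by rewrite -hX /= uproj_uwalk.
    by apply: rst_step; exists f; split=> //=; rewrite hX.
  pose F := uglue (Y, (glue T (a.1, f)).2).
  have hF : (uproj F.1, F.2) = (a.1, f).
    by rewrite uproj_uglue /= hY -surjective_pairing glueK.
  exists F.1; first by case: hF.
  apply: rst_step; exists f; split=> //.
  have -> : ((F.1, a.2).1, f) = F by case: hF => _ <-; rewrite -surjective_pairing.
  by rewrite uglueK.
- by split=> X hX; exists X => //; exact: rst_refl.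
- by split=> X /[dup] hX; [case/IH2|case/IH1] => Y hY h; exists Y => //; exact: rst_sym.
split=> X; [case/IH1|case/IH4] => Y; [case/IH3|case/IH2] => Z hZ h h'; exists Z => //.
  exact: rst_trans h.
exact: rst_trans h'.
Qed.

End SameEdge.

(** * The boundary triangulation as permutations of flags *)

Lemma mapn_id (a b u : nat) : u != a -> mapn a b u = bump b (unbump a u).
Proof. by rewrite /mapn => /negPf ->. Qed.

(** The positive direction runs through the three sides of the triangle at [v] in decreasing or
    increasing cyclic order, according to the orientation and the parity of [v]. *)
Definition turnn (o : bool) (v k : nat) : nat :=
  if o (+) odd v then ((k + 2) %% 3)%N else (k.+1 %% 3)%N.

Definition sort_edge (v u : 'I_4) : edge4 := if (v < u)%N then (v, u) else (u, v).

Lemma exit_sort o v u : exit_face o (sort_edge v u) = exitn o v u :> nat.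
Proof.
rewrite val_exit_face /sort_edge; case: ifP => // _.
by rewrite /exitn addnC; under eq_filter do rewrite andbC.
Qed.

Lemma sort_edge_map (a b v u : 'I_4) : a != v -> a != u ->
  edge_map a b (sort_edge v u) = sort_edge (face_map a b v) (face_map a b u).
Proof.
move=> av au; rewrite /sort_edge.
have -> : (face_map a b v < face_map a b u)%N = (v < u)%N.
  exact: (@is_edge_map a b (v, u)).
by case: ifP.
Qed.

(** Two adjacent triangles induce opposite directions on their common side: a turn in one
    corresponds to a backward turn, that is two turns, in the other. *)
Lemma turnn_cross o o' (v v' : 'I_4) (k k' : 'I_3) :
  let a := bump v k in let b := bump v' k' in
  o (+) odd a != o' (+) odd b -> v' == mapn a b v :> nat ->
  bump v' (turnn o' v' (turnn o' v' k')) = mapn a b (bump v (turnn o v k)).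
Proof.
move=> a b h1 h2; apply/eqP; move: h2; apply/implyP; move: h1; apply/implyP.
rewrite /a /b; clear a b.
by case: o; case: o'; case_ord v; case_ord k; case_ord v'; case_ord k'.
Qed.

Lemma card_porbits_class (D K : finType) (s : {perm D}) (c : D -> K) :
  (forall k, exists x : D, c x = k) ->
  (forall x y, c x = c y <-> y \in porbit s x) -> #|porbits s| = #|K|.
Proof.
move=> surj cE; pose h k := [set x | c x == k].
have hE x : porbit s x = h (c x).
  apply/setP=> y; rewrite inE; apply/idP/eqP => [/cE //|e].
  exact/cE.
have -> : porbits s = h @: [set: K].
  apply/setP=> O; apply/imsetP/imsetP => [[x _ ->]|[k _ ->]].
    by exists (c x).
  by have [x <-] := surj k; exists x.
rewrite card_imset ?cardsT // => k l; have [x <-] := surj k; move=> e.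
by have := in_set (fun z => c z == c x) x; rewrite -/(h (c x)) e inE eqxx => /eqP.
Qed.

Section Flags.
Variables (N : nat) (T : ordered_triangulation N).

(* The flag [(j, v, k)] is the side, on the face [lift v k] of the tetrahedron
   [j], of the boundary triangle [(j, v)].  Going around a corner of this
   triangle in the positive direction, one enters it through a side and leaves
   it through the next side, given by [turn]; the flag [x] also stands for the
   corner that is left through [x]. *)
Notation flag := ('I_N * 'I_4 * 'I_3)%type.
Implicit Types x y : flag.

Definition side x : 'I_4 := lift x.1.2 x.2.

Definition cross_fun x : flag :=
  let f := glue T (x.1.1, side x) in
  let v := face_map (side x) f.2 x.1.2 in
  (* The default is never reached, since the image of the ideal vertex differs from the face by
     [face_map_neq]. *)
  (f.1, v, odflt ord0 (unlift v f.2)).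

Lemma side_neq x : x.1.2 != side x.
Proof. exact: neq_lift. Qed.

Lemma side_cross_fun x : side (cross_fun x) = (glue T (x.1.1, side x)).2.
Proof.
have := face_map_neq (glue T (x.1.1, side x)).2 (side_neq x).
rewrite [side (cross_fun x)]/side /=; set b := (glue _ _).2; set v := face_map _ _ _.
by case: unliftP => [k -> _|->]; rewrite ?eqxx.
Qed.

Lemma cross_funK : involutive cross_fun.
Proof.
move=> x; have e := side_cross_fun x; set y := cross_fun x in e *.
have gy : glue T (y.1.1, side y) = (x.1.1, side x).
  by rewrite e /y /= -surjective_pairing glueK.
rewrite /cross_fun gy /= e face_mapK ?side_neq //.
by rewrite /side liftK /= -!surjective_pairing.
Qed.

Definition cross_perm : {perm flag} := perm (can_inj cross_funK).

Definition turn_fun x : flag :=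
  (x.1, if positive T x.1.1 (+) odd x.1.2 then ord_pred x.2 else ordS x.2).

Lemma val_turn_fun x :
  val (turn_fun x).2 = turnn (positive T x.1.1) x.1.2 x.2.
Proof.
rewrite /turn_fun /turnn /=; case: (_ (+) _) => //=.
by rewrite addnS.
Qed.

Lemma turn_fun3 x : turn_fun (turn_fun (turn_fun x)) = x.
Proof.
case: x => jv k; congr (_, _); apply/val_inj; rewrite /=.
by case: (_ (+) _) => /=; case_ord k.
Qed.

Lemma turn_fun_inj : injective turn_fun.
Proof. exact: (@can_inj _ _ _ (fun x => turn_fun (turn_fun x)) turn_fun3). Qed.

Definition turn : {perm flag} := perm turn_fun_inj.

Lemma turn3 x : turn (turn (turn x)) = x.
Proof. by rewrite !permE turn_fun3. Qed.

Lemma turn1 x : (turn x).1 = x.1.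
Proof. by rewrite permE. Qed.

(* The flags crossed by the normal curves: those of the faces of which the ideal
   vertex is the middle vertex. *)
Definition free x : bool := unbump (side x) x.1.2 == 1%N.

Lemma crossK x : cross_perm (cross_perm x) = x.
Proof. by rewrite !permE cross_funK. Qed.

Lemma cross_glue x : glue T (x.1.1, side x) =
  ((cross_perm x).1.1, side (cross_perm x)).
Proof. by rewrite permE side_cross_fun /= -surjective_pairing. Qed.

Lemma cross_vertex x :
  (cross_perm x).1.2 = face_map (side x) (side (cross_perm x)) x.1.2.
Proof. by rewrite permE side_cross_fun. Qed.

Lemma free_cross x : free (cross_perm x) = free x.
Proof.
rewrite /free cross_vertex val_face_map mapn_id; last exact: side_neq.
by rewrite bumpK.
Qed.

Lemma cross_neq x : cross_perm x != x.
Proof.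
apply/eqP=> e; have := glue_oriented T (x.1.1, side x).
by rewrite cross_glue e eqxx.
Qed.

Lemma pure_perm_subproof : injective (fun x => if free x then x else cross_perm x).
Proof.
move=> x y; case: ifP => fx; case: ifP => fy // e; last exact: perm_inj e.
  by rewrite e free_cross fy in fx.
by rewrite -e free_cross fx in fy.
Qed.

Definition pure_perm : {perm flag} := perm pure_perm_subproof.

(** The cycles of [vertex_perm] go around the vertices of the boundary triangulation. Those of
    [curve_perm] cross the free sides only (see [curve_permE]): they bound the ribbon graph formed
    by these vertices and the sides that the curves do not meet. Conjugating [pure_perm] by [turn]
    gives the form [s * f] used for ribbon graphs. *)
Definition vertex_perm : {perm flag} := (cross_perm * turn)%g.
Definition curve_perm : {perm flag} := (vertex_perm * (pure_perm ^ turn))%g.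

Lemma pure_permE x : pure_perm x = if free x then x else cross_perm x.
Proof. by rewrite permE. Qed.

Lemma pure_permK x : pure_perm (pure_perm x) = x.
Proof.
rewrite (pure_permE x); case: ifP => fx; rewrite pure_permE ?free_cross fx //.
exact: crossK.
Qed.

Lemma curve_permE x : curve_perm x = turn (if free x then cross_perm x else x).
Proof.
rewrite /curve_perm /vertex_perm conjgE !permM permK; congr (turn _).
by rewrite pure_permE free_cross; case: ifP; rewrite ?crossK.
Qed.

(** The corner left through [x] is opposite to the side [turn x], so it is the end of the edge that
    joins the ideal vertex to the vertex [side (turn x)]. *)
Definition corner_edge x : edge4 := sort_edge x.1.2 (side (turn x)).

Definition edge_dir x : bool := (x.1.2 < side (turn x))%N.

Definition wedge x : 'I_N * edge4 := (x.1.1, corner_edge x).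

Lemma nat_side x : side x = bump x.1.2 x.2 :> nat.
Proof. by []. Qed.

Lemma nat_side_turn x :
  side (turn x) = bump x.1.2 (turnn (positive T x.1.1) x.1.2 x.2) :> nat.
Proof. by rewrite nat_side turn1 permE -val_turn_fun. Qed.

Lemma is_edge_corner x : is_edge (corner_edge x).
Proof.
rewrite /corner_edge /sort_edge; case: ltnP => // h.
change (side (turn x) < x.1.2)%N; rewrite ltn_neqAle h andbT.
by have := side_neq (turn x); rewrite turn1 eq_sym -val_eqE.
Qed.

Lemma edge_dirE x : edge_dir x = (x.1.2 < side (turn x))%N.
Proof. by []. Qed.

(** Seen from the larger end of an edge, the positive direction around it is reversed, whence the
    correction of the orientation by [edge_dir]. *)
Lemma exit_corner x :
  exit_face (positive T x.1.1 (+) ~~ edge_dir x) (corner_edge x) = side x.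
Proof.
apply/ord_inj; rewrite exit_sort edge_dirE nat_side_turn nat_side.
case: x => [[j v] k] /=; move: (positive T j) => o.
by case_ord v; case_ord k; case: o.
Qed.

Lemma enter_corner x :
  exit_face (positive T x.1.1 (+) edge_dir x) (corner_edge x)
    = side (turn (turn x)).
Proof.
apply/ord_inj; rewrite exit_sort edge_dirE nat_side_turn (nat_side (turn _)) !turn1.
rewrite ![turn _]permE val_turn_fun -/(turn_fun x) val_turn_fun.
case: x => [[j v] k] /=; move: (positive T j) => o.
by case_ord v; case_ord k; case: o.
Qed.

Lemma turn_neq x : side (turn x) != side x.
Proof.
rewrite -(inj_eq (@ord_inj _)) nat_side_turn nat_side.
case: x => [[j v] k] /=; move: (positive T j) => o.
by case_ord v; case_ord k; case: o.
Qed.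

Lemma corner_vertex_perm x :
  side (turn (vertex_perm x))
    = face_map (side x) (side (cross_perm x)) (side (turn x)).
Proof.
have := glue_oriented T (x.1.1, side x); rewrite cross_glue => h.
apply/ord_inj; rewrite val_face_map permM nat_side_turn turn1.
rewrite [turn (cross_perm x)]permE val_turn_fun (nat_side x) nat_side_turn.
rewrite (nat_side (cross_perm x)).
apply: turnn_cross; first exact: h.
by rewrite -!nat_side cross_vertex val_face_map.
Qed.

Lemma vertex_perm1 x : (vertex_perm x).1 = (cross_perm x).1.
Proof. by rewrite permM turn1. Qed.

Lemma corner_edge_vertex_perm x : corner_edge (vertex_perm x)
  = edge_map (side x) (side (cross_perm x)) (corner_edge x).
Proof.
rewrite /corner_edge sort_edge_map; last 2 first.
- by rewrite eq_sym; exact: side_neq.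
- by rewrite eq_sym; exact: turn_neq.
by rewrite corner_vertex_perm vertex_perm1 cross_vertex.
Qed.

Lemma edge_dir_vertex_perm x : edge_dir (vertex_perm x) = edge_dir x.
Proof.
rewrite !edge_dirE corner_vertex_perm vertex_perm1 cross_vertex.
apply: (@is_edge_map _ _ (x.1.2, side (turn x))); rewrite eq_sym.
  exact: side_neq.
exact: turn_neq.
Qed.

Lemma edge_mapK (a b : 'I_4) (e : edge4) : a != e.1 -> a != e.2 ->
  edge_map b a (edge_map a b e) = e.
Proof.
by case: e => u v au av; rewrite /edge_map /= !face_mapK // eq_sym.
Qed.

Lemma wedge_vertex_perm x : edge_dir x -> wedge (vertex_perm x) = rotate T (wedge x).
Proof.
move=> dx; have := exit_corner x; rewrite dx addbF => ex.
by rewrite /rotate /= ex cross_glue /wedge corner_edge_vertex_perm vertex_perm1.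
Qed.

Lemma wedge_vertex_permV x : ~~ edge_dir x ->
  rotate T (wedge (vertex_perm x)) = wedge x.
Proof.
move=> dx; have := enter_corner (vertex_perm x).
rewrite edge_dir_vertex_perm (negPf dx) addbF permM turn3 -permM => ex.
rewrite /rotate /= ex vertex_perm1 corner_edge_vertex_perm.
have -> : glue T ((cross_perm x).1.1, side (cross_perm x)) = (x.1.1, side x).
  by rewrite cross_glue crossK.
have := exit_face_notin (positive T x.1.1 (+) ~~ edge_dir x) (is_edge_corner x).
by rewrite exit_corner => /andP[h1 h2]; rewrite /= edge_mapK.
Qed.

Lemma wedge_inj x y : wedge x = wedge y -> edge_dir x = edge_dir y -> x = y.
Proof.
case=> e1 e2 ed.
have es : side x = side y by rewrite -!exit_corner e1 e2 ed.
have ev : x.1.2 = y.1.2.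
  move: e2 ed; rewrite /corner_edge /sort_edge !edge_dirE.
  by do 2!case: ifP => _ //; case.
move: e1 ev es; case: (x) => [[j v] k]; case: (y) => [[j' v'] k'] /= -> ->.
by rewrite /side /= => /lift_inj ->.
Qed.

Lemma wedge_surj j e d : is_edge e -> exists x, wedge x = (j, e) /\ edge_dir x = d.
Proof.
case: e => u w; rewrite /is_edge /= => uw.
pose v := if d then u else w; pose v' := if d then w else u.
have vv : v != v' by rewrite /v /v' -(inj_eq (@ord_inj _)); case: (d); rewrite /= ?(ltn_eqF uw) // eq_sym (ltn_eqF uw).
have [k ek _] := unlift_some vv.
exists (turn (turn (j, v, k))); rewrite /wedge /corner_edge edge_dirE /sort_edge !turn1 turn3.
have -> : side (j, v, k) = v' by rewrite ek.
rewrite /v /v' /=.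
have wu : (w < u)%N = false by apply/negbTE; rewrite -leqNgt ltnW.
by case: (d); rewrite /= ?uw ?wu.
Qed.

Lemma cross_oriented x :
  positive T x.1.1 (+) odd (side x)
    != positive T (cross_perm x).1.1 (+) odd (side (cross_perm x)).
Proof. by have := glue_oriented T (x.1.1, side x); rewrite cross_glue. Qed.

(** A tetrahedron has 12 flags, and each of its four faces has exactly one middle vertex. *)
Lemma card_pure : #|[set x : flag | ~~ free x]| = (8 * N)%N.
Proof.
pose P (p : 'I_4 * 'I_3) := unbump (bump p.1 p.2) p.1 != 1%N.
have -> : [set x : flag | ~~ free x] = [set x : flag | P (x.1.2, x.2)] by [].
have -> : [set x : flag | P (x.1.2, x.2)] =
    (fun y : 'I_N * ('I_4 * 'I_3) => (y.1, y.2.1, y.2.2))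
      @: setX [set: 'I_N] [set p | P p].
  apply/setP=> -[[j v] k]; apply/idP/imsetP => [|[[i [u l]] + [-> -> ->]]].
    by rewrite inE => h; exists (j, (v, k)); rewrite ?inE.
  by rewrite !inE.
rewrite card_imset; last by move=> [i [u l]] [i' [u' l']] /= [-> -> ->].
rewrite cardsX cardsT card_ord mulnC; congr (_ * _)%N.
rewrite -sum1dep_card big_mkcond /=.
rewrite -(pair_big xpredT xpredT (fun v k => if P (v, k) then 1%N else 0%N)) /=.
by rewrite !big_ord_recl !big_ord0.
Qed.

Lemma rotate_inj (x y : 'I_N * edge4) : is_edge x.2 -> is_edge y.2 ->
  rotate T x = rotate T y -> x = y.
Proof.
pose back (z : 'I_N * edge4) := let b := exit_face (~~ positive T z.1) z.2 in
  ((glue T (z.1, b)).1, edge_map b (glue T (z.1, b)).2 z.2).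
have backK z : is_edge z.2 -> back (rotate T z) = z.
  move=> ez; have [_ h1 h2] := rotate_turn T ez.
  rewrite /back h1; move: h2; rewrite /rotate /=; set a := exit_face _ _ => h2.
  by rewrite -surjective_pairing glueK /= h2; case: (z).
by move=> ex ey e; rewrite -(backK x ex) e backK.
Qed.

Lemma rotate_same_edge (x : 'I_N * edge4) : is_edge x.2 -> same_edge (glue T) x (rotate T x).
Proof.
move=> ex; apply: rst_step; exists (exit_face (positive T x.1) x.2).
by have /andP[h1 h2] := exit_face_notin (positive T x.1) ex; split.
Qed.

Lemma is_edge_rotate (x : 'I_N * edge4) : is_edge x.2 -> is_edge (rotate T x).2.
Proof. by case/(rotate_turn T). Qed.

Lemma edge_of_rotate (x : 'I_N * edge4) : is_edge x.2 -> edge_of T (rotate T x) = edge_of T x.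
Proof.
move=> ex; apply/edge_ofP => //; first exact: is_edge_rotate.
exact/rst_sym/rotate_same_edge.
Qed.

Lemma iter_rotate_inj k (x y : 'I_N * edge4) : is_edge x.2 -> is_edge y.2 ->
  iter k (rotate T) x = iter k (rotate T) y -> x = y.
Proof.
move=> ex ey; have ei z : is_edge z.2 -> is_edge (iter k (rotate T) z).2.
  by move=> ez; elim: k => //= k /is_edge_rotate.
elim: k {ei} => //= k IH e; apply: IH; apply: rotate_inj e.
  by elim: k => //= k /is_edge_rotate.
by elim: k => //= k /is_edge_rotate.
Qed.

(** The identification is lifted to the universal cover, where [same_edge_iter] describes it by
    rotations, and projected back. *)
Lemma edge_of_iter base (hX : forall j, exists X : utet T base, uproj X = j)
    (x y : 'I_N * edge4) : is_edge x.2 -> is_edge y.2 ->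
  edge_of T x = edge_of T y -> exists k, y = iter k (rotate T) x.
Proof.
move=> ex ey /(edge_ofP T ex ey) h; have [X hx] := hX x.1.
have [/(_ X hx)[Y hY /same_edge_iter[_ /(_ ex)[k hk]]] _] := same_edge_lift base h.
exists k; have -> : x = eproj (X, x.2) by rewrite /eproj /= hx -surjective_pairing.
by rewrite -eproj_iter -hk /eproj /= hY -surjective_pairing.
Qed.

(** Each edge gives two boundary vertices, one at each end. Turning around them is [rotate] at the
    end where [edge_dir] holds and its inverse at the other one. *)
Lemma card_vertex_porbits base (hX : forall j, exists X : utet T base, uproj X = j) :
  #|porbits vertex_perm| = (N * 2)%N.
Proof.
rewrite (@card_porbits_class _ ('I_N * bool)%type _
  (fun x => (edge_of T (wedge x), edge_dir x))).
- by rewrite card_prod card_ord card_bool.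
- case=> i d; have [[j e] ee <-] := edge_of_surj T i.
  by have [x [e1 e2]] := wedge_surj j d ee; exists x; rewrite e1 e2.
have ew x : is_edge (wedge x).2 by exact: is_edge_corner.
have cs x : edge_of T (wedge (vertex_perm x)) = edge_of T (wedge x).
  have [dx|dx] := boolP (edge_dir x); first by rewrite wedge_vertex_perm ?edge_of_rotate.
  by rewrite -(wedge_vertex_permV dx) edge_of_rotate.
move=> x y; split; last first.
  case/porbitP=> k ->; elim: k => [|k IH]; first by rewrite perm1.
  by rewrite expgSr permM cs edge_dir_vertex_perm.
have dk k : edge_dir ((vertex_perm ^+ k)%g x) = edge_dir x.
  by elim: k => [|k IH]; rewrite ?perm1 // expgSr permM edge_dir_vertex_perm.
case=> e d; apply/porbitP; have [dx|dx] := boolP (edge_dir x).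
  have [k hk] := edge_of_iter hX (ew x) (ew y) e.
  exists k; apply: wedge_inj; last by rewrite dk -d.
  rewrite hk; elim: k {hk} => [|k IH]; first by rewrite perm1.
  by rewrite expgSr permM wedge_vertex_perm ?dk // -IH.
have [k hk] := edge_of_iter hX (ew y) (ew x) (esym e).
exists k; apply: wedge_inj; last by rewrite dk -d.
apply: (@iter_rotate_inj k) => //; rewrite -hk.
elim: k {hk} => [|k IH]; first by rewrite perm1.
by rewrite {1}IH iterSr expgSr permM wedge_vertex_permV // dk.
Qed.

Lemma card_moved : #|[set x | (pure_perm ^ turn)%g x != x]| = (8 * N)%N.
Proof.
have -> : [set x | (pure_perm ^ turn)%g x != x] = turn @: [set x | ~~ free x].
  apply/setP=> x; apply/idP/imsetP => [|[y + ->]].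
    rewrite inE => h; exists ((turn^-1)%g x); last by rewrite permKV.
    by rewrite inE; apply: contraNN h => f; rewrite conjgE !permM pure_permE f permKV.
  rewrite !inE => /negPf fy; rewrite permJ pure_permE fy (inj_eq perm_inj).
  exact: cross_neq.
by rewrite card_imset ?card_pure //; exact: perm_inj.
Qed.

End Flags.

(** * The complement of the curves in the boundary torus *)

Section FlagSurface.
Variables (N : nat) (T : ordered_triangulation N).
Notation sigma := (vertex_perm T).
Notation psi := (curve_perm T).
Notation turn := (turn T).
Notation cross := (cross_perm T).
Notation flag := ('I_N * 'I_4 * 'I_3)%type.
Implicit Types x y : flag.

Lemma turn_cases x (k : 'I_3) :
  [\/ (x.1, k) = x, (x.1, k) = turn x | (x.1, k) = turn (turn x)].
Proof.
rewrite !permE /turn_fun /=; case: x => t l /=.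
suff /or3P[/eqP->|/eqP->|/eqP->] : [|| k == l, k == ordS l | k == ord_pred l].
- by constructor 1.
- by case: (_ (+) _); [constructor 3 | constructor 2]; congr (_, _); apply/val_inj;
     rewrite /=; case_ord l.
- by case: (_ (+) _); [constructor 2 | constructor 3]; congr (_, _); apply/val_inj;
     rewrite /=; case_ord l.
by rewrite -!val_eqE /=; case_ord k; case_ord l.
Qed.

Lemma turn_closed (P : pred flag) x y : (forall z, P z -> P (turn z)) ->
  P x -> x.1 = y.1 -> P y.
Proof.
move=> Pt Px e; rewrite [y]surjective_pairing -e.
have [->|->|->] := turn_cases x y.2; [exact: Px | exact: (Pt _ Px) | exact: (Pt _ (Pt _ Px))].
Qed.

Lemma free_tri x : (x.1.2 == 0%N :> nat) || (x.1.2 == 3%N :> nat) -> ~~ free x.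
Proof.
rewrite /free nat_side; case: x => [[j v] k] /=; apply/implyP.
by case_ord v; case_ord k.
Qed.

Lemma free_turn x : ~~ ((x.1.2 == 0%N :> nat) || (x.1.2 == 3%N :> nat)) ->
  free x || free (turn x).
Proof.
rewrite /free !nat_side turn1 permE val_turn_fun; case: x => [[j v] k] /=.
move: (positive T j) => o.
by apply/implyP; case: o; case_ord v; case_ord k.
Qed.

Lemma curve_pure x : ~~ free x -> psi x = turn x.
Proof. by rewrite curve_permE => /negPf ->. Qed.

Lemma curve_free x : free x -> psi x = turn (cross x).
Proof. by rewrite curve_permE => ->. Qed.

Lemma porbit_tri x : (x.1.2 == 0%N :> nat) || (x.1.2 == 3%N :> nat) ->
  porbit psi x = [set y | y.1 == x.1].
Proof.
move=> h; apply/setP=> y; rewrite inE; apply/idP/eqP => [/porbitP[i ->]|e].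
  elim: i => [|i IH]; first by rewrite perm1.
  by rewrite expgSr permM curve_pure ?turn1 // free_tri // IH.
have tr z : z.1 = x.1 -> turn z \in porbit psi z.
  by move=> zx; rewrite -curve_pure ?mem_porbit_step // free_tri // zx.
pose P z := (z.1 == x.1) && (z \in porbit psi x).
suff /andP[] : P y by [].
apply: (@turn_closed P x) => // [z /andP[/eqP zx zP]|]; last first.
  by rewrite /P eqxx porbit_id.
by rewrite /P turn1 zx eqxx /= -(porbit_eqP _ _ _ zP) tr.
Qed.

Lemma porbit_no_free x : {in porbit psi x, forall y, ~~ free y} ->
  (x.1.2 == 0%N :> nat) || (x.1.2 == 3%N :> nat).
Proof.
move=> h; apply/negPn/negP => hx; have := free_turn hx.
have fx : ~~ free x by apply: h; exact: porbit_id.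
by rewrite (negPf fx) -curve_pure // (negPf (h _ (mem_porbit_step _ _))).
Qed.

(** A cycle without free flags is a whole triangle at an ideal vertex 0 or 3, and each tetrahedron
    has two of these. *)
Lemma card_curve_porbits :
  #|porbits psi| = (N * 2 + #|[set porbit psi x | x in @free N]|)%N.
Proof.
pose tris := setX [set: 'I_N] [set (ord0 : 'I_4); ord_max].
have trisP t : (t \in tris) = (t.2 == 0%N :> nat) || (t.2 == 3%N :> nat).
  by rewrite !inE.
pose NF : {set {set flag}} := [set [set y | y.1 == t] | t in tris].
have -> : (N * 2)%N = #|NF|.
  rewrite card_in_imset ?cardsX ?cardsT ?card_ord ?cards2 // => t u _ _ e.
  by have := in_set (fun y => y.1 == u) (t, ord0); rewrite -e inE eqxx => /esym/eqP.
rewrite -cardsUI (_ : NF :&: _ = set0) ?cards0 ?addn0; last first.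
  apply/setP=> O; rewrite !inE; apply/negP => /andP[/imsetP[t tt eO] /imsetP[x fx]].
  rewrite eO => e; have : x \in [set y | y.1 == t] by rewrite e porbit_id.
  rewrite inE => /eqP xt; move: tt; rewrite trisP -xt => /free_tri/negP; exact.
apply: eq_card => O; rewrite inE; apply/imsetP/orP => [[x _ ->]|].
  have [[y yx fy]|nf] := pselect (exists2 y, y \in porbit psi x & free y).
    by right; apply/imsetP; exists y => //; apply/esym/porbit_eqP.
  left; have hx : (x.1.2 == 0%N :> nat) || (x.1.2 == 3%N :> nat).
    by apply: porbit_no_free => y yx; apply/negP => fy; apply: nf; exists y.
  by apply/imsetP; exists x.1; rewrite ?trisP // porbit_tri.
case=> /imsetP[t]; last by move=> _ ->; exists t.
rewrite trisP => ht ->; exists (t, ord0) => //.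
by rewrite porbit_tri.
Qed.

Lemma flag_connected (P : pred flag) x : (forall z, P z -> P (turn z)) ->
  (forall z, P z -> P (cross z)) -> P x -> forall y, P y.
Proof.
move=> Pt Pc Px y; pose Q t := P (t, ord0).
have QP z : P z = Q z.1.
  by apply/idP/idP => h; apply: (turn_closed Pt h).
suff h a b : same_vertex (glue T) a b -> Q a = Q b.
  by rewrite QP -(h _ _ (one_cusp T x.1 y.1)) -QP.
elim=> {a b} [a b [f [fa ->]]|//|a b _ -> //|a b c _ -> _ -> //].
have [k fk _] : {k | f = lift a.2 k & unlift a.2 f = Some k}.
  by apply: unlift_some; rewrite eq_sym.
pose z : flag := (a, k).
have sz : side z = f by rewrite fk.
have -> : glue T (a.1, f) = ((cross z).1.1, side (cross z)).
  by rewrite -cross_glue sz.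
have e : face_map f (side (cross z)) a.2 = (cross z).1.2.
  by rewrite cross_vertex sz.
rewrite /= e -surjective_pairing -QP -[Q a](QP z).
by apply/idP/idP => [/Pc //|/Pc]; rewrite crossK.
Qed.

Lemma exists_free (j : 'I_N) : exists x : flag, free x /\ x.1.1 = j.
Proof. by exists (j, Ordinal (isT : 1 < 4)%N, Ordinal (isT : 1 < 3)%N). Qed.

(** Without free flags, closure under [psi] is closure under [turn], and then closure under [sigma]
    gives closure under [cross]. By connectedness the set would contain every flag, including free
    ones. *)
Lemma closed_free (A : {set flag}) x : x \in A ->
  (forall y, y \in A -> sigma y \in A) ->
  (forall y, y \in A -> psi y \in A) -> exists2 y, y \in A & free y.
Proof.
move=> xA As Ap; have [//|nf] := pselect (exists2 y, y \in A & free y).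
have nA y : y \in A -> ~~ free y by move=> yA; apply/negP=> fy; case: nf; exists y.
have At y : y \in A -> turn y \in A by move=> yA; rewrite -curve_pure ?Ap // nA.
have Ac y : y \in A -> cross y \in A.
  by move/As/At/At; rewrite permM turn3.
have [y [fy _]] := exists_free x.1.1.
have /negP[] := nA y (@flag_connected (mem A) x At Ac xA y).
exact: fy.
Qed.

(** The uncut part has 2N vertices, 4N sides and 2N triangles, hence Euler characteristic 0. *)
Lemma curve_euler base (hX : forall j, exists X : utet T base, uproj X = j) :
  (#|porbits sigma| + #|porbits psi| =
    #|[set x | (pure_perm T ^ turn)%g x != x]|./2
      + #|[set porbit psi x | x in @free N]|)%N.
Proof.
rewrite (card_vertex_porbits hX) card_curve_porbits card_moved addnA; congr (_ + _)%N.
by rewrite (_ : 8 * N = (4 * N).*2)%N ?doubleK; lia.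
Qed.

End FlagSurface.

(** * Refined and reversed cycles, and their lifts to the universal cover *)

Section Subdivision.
Variables (D I K : finType) (G : groupType) (s : {perm D}) (g : {perm I}).
Variables (hd : I -> D) (tl : I -> seq D) (tag : D -> K) (tagI : I -> K).
Hypotheses (tagI_inj : injective tagI)
  (tag_seg : forall i y, y \in hd i :: tl i -> tag y = tagI i)
  (uniq_seg : forall i, uniq (hd i :: tl i))
  (path_seg : forall i, fpath s (hd i) (tl i))
  (last_seg : forall i, s (last (hd i) (tl i)) = hd (g i)).

(** The cycle of [s] is the concatenation of the segments along the cycle of [g]; the injective tags
    keep distinct segments disjoint. *)
Lemma hol_subdivide (c : D -> G) i :
  hol *%g s c (hd i) = hol *%g g (fun i => \big[*%g/1%g]_(y <- hd i :: tl i) c y)%g i.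
Proof.
pose seg i := hd i :: tl i.
have pathW w j : fpath g j w -> fpath s (hd j) (tl j ++ flatten (map seg w)) /\
    last (hd j) (tl j ++ flatten (map seg w)) = last (hd (last j w)) (tl (last j w)).
  elim: w j => [|k w IH] j /=; first by rewrite cats0.
  case/andP=> /eqP <- /IH[p1 p2]; rewrite cat_path path_seg last_cat /= last_seg eqxx.
  by split.
have [w [eo cw uw]] := orbit_consE g i.
have /= e : orbit s (hd i) = flatten (map seg (orbit g i)).
  rewrite eo /=; apply: orbit_cons.
    move: cw; rewrite (cycle_path i) (cycle_path (hd i)) /= => /andP[/eqP gl pw].
    have [p1 p2] := pathW w i pw.
    by rewrite p2 last_seg gl eqxx p1.
  rewrite -cat_cons -/(seg i) -[seg i ++ _]/(flatten (map seg (i :: w))).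
  elim: (i :: w) uw => [//|j v IH /andP[jv uv]].
  change (uniq (seg j ++ flatten (map seg v))).
  rewrite cat_uniq IH // andbT; apply/andP; split; first exact: uniq_seg.
  apply/hasPn => y /flattenP[_ /mapP[k kv ->] yk]; apply: contraNN jv => yj.
  by rewrite (tagI_inj (etrans (esym (tag_seg yj)) (tag_seg yk))).
by rewrite /hol e big_flatten big_map.
Qed.

End Subdivision.

(** The base point shifts because the forward orbit that ends at [x] starts at [s x]. *)
Lemma hol_inv (D : finType) (G : groupType) (s : {perm D}) (c : D -> G) x :
  hol *%g (s^-1)%g (fun y => (c y)^-1)%g x = ((hol *%g s c (s x))^-1)%g.
Proof.
have [w [eo cw uw]] := orbit_consE s (s x).
have [u eu] := orbit_rcons (erefl (s x)).
have e : orbit (s^-1)%g x = rev (orbit s (s x)).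
  rewrite eu rev_rcons; apply: orbit_cons; rewrite -rev_rcons -eu ?rev_uniq ?orbit_uniq //.
  rewrite rev_cycle; have := cycle_orbit (@perm_inj _ s) (s x).
  by apply: sub_cycle => a b /eqP <-; rewrite /= permK.
rewrite /hol e; elim: (orbit s (s x)) => [|y v IH]; first by rewrite !big_nil invg1.
by rewrite rev_cons -cats1 big_cat /= big_seq1 big_cons invMg IH.
Qed.

Section DeckHolonomy.
Variables (N : nat) (T : ordered_triangulation N) (base : 'I_N).
Variables (D : finType) (s : {perm D}) (c : D -> pi1 T base).
Variables (S : D -> utet T base) (w : D -> seq 'I_4).
Hypothesis uwalk_S : forall x, uwalk (S x) (w x) = deck (c x) (S (s x)).

(** Deck transformations commute with lifting paths, so the one produced by each step can be pulled
    out to the left of the rest of the path. *)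
Lemma uwalk_hol x :
  uwalk (S x) (flatten (map w (orbit s x))) = deck (hol *%g s c x) (S x).
Proof.
have h k y : uwalk (S y) (flatten (map w (traject s y k))) =
    deck (\big[*%g/1%g]_(z <- traject s y k) c z) (S (iter k s y)).
  elim: k y => [|k IH] y; first by rewrite uwalk_nil big_nil deck1.
  by rewrite /= -uwalk_cat uwalk_S -deck_uwalk IH big_cons deckM -iterS iterSr.
by rewrite /hol /orbit h (iter_order (@perm_inj _ s)).
Qed.

End DeckHolonomy.

(** * The normal curves of the cusp and their holonomies *)

Section CuspCurves.
Variables (N : nat) (T : ordered_triangulation N) (base : 'I_N).
(* A choice, invariant under the face pairings, of lifts of the faces. *)
Variable Fl : 'I_N * 'I_4 -> utet T base.
Hypothesis uproj_Fl : forall f, uproj (Fl f) = f.1.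
Hypothesis uglue_Fl : forall f, uglue (Fl f, f.2) = (Fl (glue T f), (glue T f).2).

Notation sigma := (vertex_perm T).
Notation psi := (curve_perm T).
Notation turn := (turn T).
Notation cross := (cross_perm T).
Notation flag := ('I_N * 'I_4 * 'I_3)%type.
Notation pi1 := (pi1 T base).
Notation node := 'I_(N + N).
Implicit Types (x y : flag) (n : node) (b : bool).

Definition flag_lift x : utet T base := Fl (x.1.1, side x).

Lemma uproj_flag_lift x : uproj (flag_lift x) = x.1.1.
Proof. exact: uproj_Fl. Qed.

Lemma uwalk_flag_lift x : uwalk (flag_lift x) [:: side x] = flag_lift (cross x).
Proof. by have [-> _] := uglue_Fl (x.1.1, side x); rewrite cross_glue. Qed.

Lemma deck_udiff x y : x.1.1 = y.1.1 ->
  deck (udiff (flag_lift x) (flag_lift y)) (flag_lift y) = flag_lift x.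
Proof. by move=> e; rewrite -udiffP // !uproj_flag_lift. Qed.

(** Compares the lifts attached to the sides through which the corner [x] is entered and left.
    Crossing a side costs nothing, as the lifts of faces are invariant under gluing. *)
Definition flag_label x : pi1 := udiff (flag_lift (turn (turn x))) (flag_lift x).

Lemma uwalk_flag_label x :
  uwalk (flag_lift (turn (turn x))) [:: side x]
    = deck (flag_label x) (flag_lift (cross x)).
Proof.
rewrite -{1}(deck_udiff (x := turn (turn x)) (y := x)) ?turn1 //.
by rewrite -deck_uwalk uwalk_flag_lift.
Qed.

Lemma map_wedge_orbit (s : {perm flag}) x :
  (forall y, y \in porbit s x -> wedge T (s y) = rotate T (wedge T y)) ->
  (forall y, y \in porbit s x -> edge_dir T y = edge_dir T x) ->
  map (wedge T) (orbit s x) = orbit (rotate T) (wedge T x).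
Proof.
move=> sw sd; have [w [eo cw uw]] := orbit_consE s x.
have wi : {in orbit s x &, injective (wedge T)}.
  by move=> y z; rewrite !mem_orbitP => /sd ey /sd ez /wedge_inj; apply; rewrite ey.
have cm : fcycle (rotate T) (map (wedge T) (orbit s x)).
  have := cycle_orbit (@perm_inj _ s) x; rewrite eo (cycle_path x) (cycle_path (wedge T x)) /=.
  have sub y : y \in x :: w -> y \in porbit s x by rewrite -eo mem_orbitP.
  have lw : last x w \in x :: w by exact: mem_last.
  rewrite last_map => /andP[/eqP sl pw]; rewrite -sw ?sub // sl eqxx /=.
  move: (mem_head x w) (fun y yw => sub y (mem_behead (s := x :: w) yw)) pw => /sub.
  (* The orbit is frozen as a fixed set because the induction on the path moves its starting
     point. *)
  have [O OE] : exists O, O = porbit s x by exists (porbit s x).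
  rewrite -OE {OE} in sw *; elim: (w) (x) => [//|z v IH] y yo vs /andP[/eqP sy pv]; apply/andP; split.
    by change (rotate T (wedge T y) == wedge T z); rewrite -(sw _ yo) sy.
  apply: IH => //; first by apply: vs; rewrite mem_head.
  by move=> t tv; apply: vs; rewrite inE tv orbT.
have um : uniq (map (wedge T) (orbit s x)) by rewrite map_inj_in_uniq ?orbit_uniq.
have xm : wedge T x \in map (wedge T) (orbit s x) by rewrite map_f // in_orbit.
by rewrite (orbitE cm um xm) eo /= eqxx rot0.
Qed.

(** The holonomy around a boundary vertex is that of the loop around an edge, which is
    null-homotopic. At the end where [edge_dir] fails, the cycle is read backwards to become this
    loop. *)
Lemma hol_vertex x : hol *%g sigma flag_label x = 1%g.
Proof.
have dk k y : edge_dir T ((sigma ^+ k)%g y) = edge_dir T y.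
  by elim: k => [|k IH]; rewrite ?perm1 // expgSr permM edge_dir_vertex_perm.
have trivial_loop (y : flag) (X : utet T base) (h : pi1) : uproj X = y.1.1 ->
    uwalk X (edge_loop T (wedge T y)) = deck h X -> h = 1%g.
  move=> pX; have -> : wedge T y = (uproj X, corner_edge T y) by rewrite pX.
  rewrite (_ : uwalk _ _ = X); last first.
    rewrite -[RHS]uwalk_nil; apply: uwalk_homotopic; apply: rst_step.
    have := @EdgeLoopStep _ T (uproj X) [::] [::] _ (is_edge_corner T y).
    by rewrite cats0; apply.
  by move=> e; apply: (@deck_free _ _ _ _ _ X); rewrite deck1.
have [dx|dx] := boolP (edge_dir T x).
  have dy y : y \in porbit sigma x -> edge_dir T y = edge_dir T x.
    by case/porbitP=> k ->; exact: dk.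
  apply: (trivial_loop x (flag_lift (turn (turn x)))); first by rewrite uproj_flag_lift !turn1.
  rewrite /edge_loop -(map_wedge_orbit (s := sigma)) //; last first.
    by move=> y /dy ey; rewrite wedge_vertex_perm // ey.
  have := uwalk_hol (s := sigma) (c := flag_label)
    (S := fun y => flag_lift (turn (turn y))) (w := fun y => [:: side y]).
  move=> /(_ _ x) <-; last first.
    by move=> y; rewrite uwalk_flag_label permM turn3.
  rewrite flatten_map1 -map_comp; congr uwalk; apply/eq_in_map => y.
  rewrite mem_orbitP => /dy ey /=; rewrite -[RHS](exit_corner T) ey dx addbF.
  by [].
pose z := (sigma^-1)%g x; have zx : sigma z = x by rewrite permKV.
rewrite -zx; apply: invg_inj; rewrite invg1 -hol_inv.
have dy y : y \in porbit (sigma^-1)%g z -> edge_dir T y = edge_dir T z.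
  by rewrite porbitV => /porbitP[k ->]; exact: dk.
have dz : ~~ edge_dir T z by rewrite -(edge_dir_vertex_perm T) zx.
apply: (trivial_loop z (flag_lift z)); first by rewrite uproj_flag_lift.
rewrite /edge_loop -(map_wedge_orbit (s := (sigma^-1)%g)) //; last first.
  move=> y /dy ey; rewrite -[in RHS](permKV sigma y) wedge_vertex_permV //.
  by rewrite -(edge_dir_vertex_perm T) permKV ey.
have := uwalk_hol (s := (sigma^-1)%g) (c := fun y => (flag_label y)^-1%g)
    (S := flag_lift) (w := fun y => [:: side (turn (turn y))]).
move=> /(_ _ z) <-; last first.
  move=> y; have sy : cross ((sigma^-1)%g y) = turn (turn y).
    by rewrite -[in RHS](permKV sigma y) permM turn3.
  apply: (canRL (deckK _)).
  rewrite deck_uwalk deck_udiff ?turn1 // uwalk_flag_lift; congr flag_lift.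
  by rewrite -sy crossK.
rewrite flatten_map1 -map_comp; congr uwalk; apply/eq_in_map => y.
rewrite mem_orbitP => /dy ey /=; rewrite -(enter_corner T) ey (negPf dz) addbF.
by [].
Qed.

(** The cycle stays in one triangle, where the three labels telescope. *)
Lemma hol_tri x : {in porbit psi x, forall y, ~~ free y} ->
  hol *%g psi flag_label x = 1%g.
Proof.
move/porbit_no_free=> h.
have fx y : y.1 = x.1 -> psi y = turn y.
  by move=> e; rewrite curve_pure // free_tri // e.
have nt y : turn y != y.
  by apply: contraNneq (turn_neq T y) => ->; rewrite eqxx.
have o3 : orbit psi x = [:: x; turn x; turn (turn x)].
  apply: orbit_cons; first by rewrite /= !fx ?turn1 // turn3 !eqxx.
  have h1 : x != turn x by rewrite eq_sym nt.
  have h2 : turn x != turn (turn x) by rewrite eq_sym nt.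
  have h3 : x != turn (turn x) by rewrite -{1}(turn3 T x) nt.
  by rewrite /= !inE negb_or h1 h2 h3.
rewrite /hol o3 !big_cons big_nil /= mulg1 /flag_label !turn3.
have e y z : y.1 = z.1 -> uproj (flag_lift y) = uproj (flag_lift z).
  by move=> yz; rewrite !uproj_flag_lift yz.
by rewrite !udiff_mul ?udiff_refl //; apply: e; rewrite !turn1.
Qed.

(* The node [lshift j] (resp. [rshift j]) stands for the boundary triangle at the
   ideal vertex 2 (resp. 1) of the tetrahedron [j], which the curve crosses
   between the faces 0 and 1 (resp. 2 and 3). *)
Definition tetra n : 'I_N := match split n with inl j => j | inr j => j end.

Definition node_tri n : 'I_N * 'I_4 :=
  match split n with
  | inl j => (j, Ordinal (isT : 2 < 4)%N)
  | inr j => (j, Ordinal (isT : 1 < 4)%N)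
  end.

(** The two free sides of the triangle of a node have different parities, and [b] is the parity of
    the side selected. *)
Definition node_flag n b : flag :=
  (node_tri n, match split n with
               | inl _ => Ordinal (leq_trans (leq_b1 b) (isT : 1 <= 2)%N : b < 3)%N
               | inr _ => Ordinal (leq_ltn_trans (leq_b1 b) (isT : 1 < 2)%N : b.+1 < 3)%N
               end).

Definition flag_node x : node :=
  if x.1.2 == 2%N :> nat then lshift N x.1.1 else rshift N x.1.1.

Lemma split_lshift (j : 'I_N) : split (lshift N j) = inl j.
Proof. exact: (unsplitK (inl j)). Qed.

Lemma split_rshift (j : 'I_N) : split (rshift N j) = inr j.
Proof. exact: (unsplitK (inr j)). Qed.

Lemma node_flagK n b : flag_node (node_flag n b) = n.
Proof.
by rewrite /flag_node /node_flag /node_tri; case: (splitP n) => j e /=; apply/ord_inj.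
Qed.

Lemma odd_node_flag n b : odd (side (node_flag n b)) = b.
Proof.
by rewrite nat_side /node_flag /node_tri; case: (splitP n) => j e /=; case: b.
Qed.

Lemma free_node_flag n b : free (node_flag n b).
Proof.
by rewrite /free nat_side /node_flag /node_tri; case: (splitP n) => j e /=; case: b.
Qed.

Lemma flag_nodeK x : free x -> node_flag (flag_node x) (odd (side x)) = x.
Proof.
move=> fx; have : (x.1.2 == 1%N :> nat) || (x.1.2 == 2%N :> nat).
  move: fx; rewrite /free nat_side; case: x => [[j v] k] /=; apply/implyP.
  by case_ord v; case_ord k.
move: fx; rewrite /free nat_side /flag_node /node_flag /node_tri.
case: x => [[j v] k] /=; case: ifP => [/eqP v2 + _|_ /[swap]].
  have {v2} -> : v = Ordinal (isT : 2 < 4)%N by exact/ord_inj.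
  rewrite split_lshift => fk; congr (_, _, _); apply/ord_inj => //=.
  by apply/eqP; move: fk; apply/implyP; rewrite /=; case_ord k.
rewrite orbF => /eqP v1.
have {v1} -> : v = Ordinal (isT : 1 < 4)%N by exact/ord_inj.
rewrite split_rshift => fk; congr (_, _, _); apply/ord_inj => //=.
by apply/eqP; move: fk; apply/implyP; rewrite /=; case_ord k.
Qed.

Lemma node_flag1 n b : (node_flag n b).1 = node_tri n.
Proof. by []. Qed.

Lemma node_tri1 n : (node_tri n).1 = tetra n.
Proof. by rewrite /node_tri /tetra; case: split. Qed.

Lemma node_tri_inj : injective node_tri.
Proof.
move=> n m; rewrite /node_tri; case: (splitP n) => i ei; case: (splitP m) => j ej //.
  by case=> e; apply/ord_inj; rewrite ei ej e.
by case=> e; apply/ord_inj; rewrite ei ej e.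
Qed.

Lemma free_node_tri x n : free x -> x.1 = node_tri n -> exists b, x = node_flag n b.
Proof.
move=> fx xn; exists (odd (side x)); rewrite -{1}(flag_nodeK fx); congr node_flag.
by rewrite -[RHS](node_flagK n true) /flag_node xn.
Qed.

Lemma node_flag_neq n b : node_flag n b != node_flag n (~~ b).
Proof.
by apply/eqP=> e; have := odd_node_flag n b; rewrite e odd_node_flag; case: b {e}.
Qed.

Lemma turn_nfix x : turn x != x.
Proof. by apply: contraNneq (turn_neq T x) => ->; rewrite eqxx. Qed.

Lemma turn_node_flag n b : turn (node_flag n b) != node_flag n (~~ b) ->
  ~~ free (turn (node_flag n b)) /\ turn (turn (node_flag n b)) = node_flag n (~~ b).
Proof.
move=> ne; split.
  apply/negP=> /free_node_tri/(_ (turn1 _ _))[b' e].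
  have := turn_nfix (node_flag n b); move: ne; rewrite e.
  have [->|->] : b' = b \/ b' = ~~ b by case: (b); case: (b'); auto.
    by rewrite eqxx.
  by rewrite eqxx.
have [e|e|e] := turn_cases T (node_flag n b) (node_flag n (~~ b)).2.
- by case/eqP: (node_flag_neq n b); exact: esym e.
- by case/eqP: ne; exact: esym e.
exact: esym e.
Qed.

Definition node_label n b : pi1 :=
  udiff (flag_lift (node_flag n b)) (flag_lift (node_flag n (~~ b))).

(* Following the boundary of a component of the complement of the curves amounts
   to following a curve, on one of its sides. *)
Lemma hol_curve (e : node -> bool) (g : {perm node}) n :
  (forall n, cross (node_flag n (~~ e n)) = node_flag (g n) (e (g n))) ->
  hol *%g psi flag_label (turn (node_flag n (e n)))
    = hol *%g g (fun n => node_label n (e n)) n.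
Proof.
move=> eg; pose m n := node_flag n (e n); pose p n := node_flag n (~~ e n).
(* After the free side [m n], turning meets the other free side [p n] either at once or after the
   third side of the triangle. *)
pose tl n := if turn (m n) == p n then [::] else [:: p n].
have em i : flag_lift (turn (turn (turn (m i)))) = flag_lift (m i) by rewrite turn3.
rewrite (@hol_subdivide _ _ _ _ psi g (fun n => turn (m n)) tl fst node_tri
  node_tri_inj).
- apply: eq_bigr => i _; rewrite big_cons /tl /node_label /flag_label em.
  case: ifP => [/eqP ei|/negbT ei]; first by rewrite big_nil /= mulg1 ei.
  have [_ tp] := turn_node_flag ei; rewrite big_seq1 /=.
  have -> : turn (turn (p i)) = turn (m i) by rewrite -[p i]tp turn3.
  by rewrite udiff_mul // !uproj_flag_lift !turn1.
- move=> i y; rewrite inE => /orP[/eqP->|]; first by rewrite turn1.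
  by rewrite /tl; case: ifP => //; rewrite inE => _ /eqP->.
- by move=> i; rewrite /tl /=; case: ifP => //=; rewrite inE => ->.
- move=> i; rewrite /tl; case: ifP => //= /negbT ei.
  by have [fi tp] := turn_node_flag ei; rewrite curve_pure // -/(m i) tp eqxx.
move=> i; have -> : last (turn (m i)) (tl i) = p i.
  by rewrite /tl; case: ifP => //= /eqP.
by rewrite curve_free ?free_node_flag // eg.
Qed.

Lemma cross_node_flag n b : exists n', cross (node_flag n b) =
    node_flag n' (positive T (tetra n) (+) b (+) ~~ positive T (tetra n')).
Proof.
have fc : free (cross (node_flag n b)) by rewrite free_cross free_node_flag.
exists (flag_node (cross (node_flag n b))).
rewrite -[LHS](flag_nodeK fc); congr node_flag.
have := cross_oriented T (node_flag n b); rewrite odd_node_flag node_flag1 node_tri1.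
have -> : (cross (node_flag n b)).1.1 = tetra (flag_node (cross (node_flag n b))).
  by rewrite -{1}(flag_nodeK fc) node_flag1 node_tri1.
by case: (positive T _); case: (positive T _); case: (b); case: odd.
Qed.

(** The parity of the exit side is tied to the orientation of the tetrahedron. As gluings reverse
    the induced orientations, the next triangle is then entered through its side of the other type,
    so the curves are coherently oriented. *)
Definition next_fun n : node := flag_node (cross (node_flag n (~~ positive T (tetra n)))).

Lemma cross_next_fun n : cross (node_flag n (~~ positive T (tetra n)))
  = node_flag (next_fun n) (positive T (tetra (next_fun n))).
Proof.
rewrite /next_fun; have [n' ->] := cross_node_flag n (~~ positive T (tetra n)).
by rewrite node_flagK; case: positive; case: positive.
Qed.

Lemma next_fun_inj : injective next_fun.
Proof.
move=> n m e; have := cross_next_fun n; rewrite e -cross_next_fun => /perm_inj h.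
by rewrite -(node_flagK n (~~ positive T (tetra n))) h node_flagK.
Qed.

Definition next_node : {perm node} := perm next_fun_inj.

Lemma cross_next n : cross (node_flag n (~~ positive T (tetra n)))
  = node_flag (next_node n) (positive T (tetra (next_node n))).
Proof. by rewrite cross_next_fun permE. Qed.

Definition next_label n : pi1 := node_label n (positive T (tetra n)).

Lemma node_labelV n b : node_label n (~~ b) = (node_label n b)^-1%g.
Proof.
apply: (mulgI (node_label n b)); rewrite mulgV /node_label negbK.
rewrite udiff_mul ?udiff_refl //.
  by rewrite !uproj_flag_lift.
by rewrite !uproj_flag_lift.
Qed.

Lemma hol_next n : hol *%g psi flag_label (turn (node_flag n (positive T (tetra n))))
  = hol *%g next_node next_label n.
Proof. by rewrite (@hol_curve (fun n => positive T (tetra n)) next_node) // => i; exact: cross_next. Qed.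

(** The boundary of the complement on the other side of a curve follows that curve backwards. *)
Lemma hol_nextV n :
  hol *%g psi flag_label (turn (node_flag n (~~ positive T (tetra n))))
    = ((hol *%g next_node next_label (next_node n))^-1)%g.
Proof.
rewrite (@hol_curve (fun n => ~~ positive T (tetra n)) (next_node^-1)%g); last first.
  by move=> i; rewrite negbK; apply: (@perm_inj _ cross); rewrite crossK cross_next permKV.
rewrite -hol_inv; apply: eq_bigr => i _.
by rewrite node_labelV.
Qed.

Lemma peripheral_next n : peripheral (hol *%g next_node next_label n).
Proof.
pose m i := node_flag i (positive T (tetra i)).
pose p i := node_flag i (~~ positive T (tetra i)).
exists (flag_lift (m n)), (node_tri n).2,
  (flatten [seq [:: side (p i)] | i <- orbit next_node n]).
split; last first.
  rewrite -(uwalk_hol (S := fun i => flag_lift (m i)) (w := fun i => [:: side (p i)])) //.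
  move=> i; rewrite -(deck_udiff (x := m i) (y := p i)) // -deck_uwalk uwalk_flag_lift.
  by rewrite cross_next.
have -> : uproj (flag_lift (m n)) = (node_tri n).1 by rewrite uproj_flag_lift.
rewrite -surjective_pairing flatten_map1.
have link k i : link_end T (node_tri i) [seq side (p j) | j <- traject next_node i k]
    = Some (node_tri (iter k next_node i)).
  elim: k i => //= k IH i; have -> : (side (p i) == (node_tri i).2) = false.
    by apply: negbTE; rewrite eq_sym; exact: (side_neq (p i)).
  rewrite -iterS iterSr -IH; congr link_end.
  have <- : (cross (p i)).1 = node_tri (next_node i) by rewrite cross_next.
  have /= -> := cross_glue T (p i).
  by rewrite [RHS]surjective_pairing cross_vertex.
by rewrite /orbit link (iter_order (@perm_inj _ next_node)).
Qed.

Lemma turn_in_porbit n b : node_flag n (~~ b) \in porbit psi (turn (node_flag n b)).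
Proof.
have [e|ne] := eqVneq (turn (node_flag n b)) (node_flag n (~~ b)).
  by rewrite e porbit_id.
have [f <-] := turn_node_flag ne.
by rewrite -curve_pure // mem_porbit_step.
Qed.

(** [torus_curves] compares the curves bordering one component of the complement. Each curve borders
    the components on its two sides, so connectedness of the cusp spreads the comparison to all the
    curves. *)
Lemma hol_next_dichotomy (n0 : node) :
  (exists n, hol *%g next_node next_label n = 1%g) \/
  forall n, exists h : pi1, let g0 := hol *%g next_node next_label n0 in
    (hol *%g next_node next_label n = h^-1 * g0 * h \/
     hol *%g next_node next_label n = h^-1 * g0^-1 * h)%g.
Proof.
pose H := hol *%g psi flag_label; pose K := hol *%g next_node next_label.
pose conj (g h : pi1) := exists u : pi1, (h = u^-1 * g * u \/ h = u^-1 * g^-1 * u)%g.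
have conj_sym g h : conj g h -> conj h g.
  case=> u [->|->]; exists (u^-1)%g; rewrite invgK.
    by left; rewrite !mulgA mulgV mul1g mulgK.
  by right; rewrite !invMg !invgK !mulgA mulgV mul1g mulgK.
have conj_trans g h k : conj g h -> conj h k -> conj g k.
  case=> u eh [v ek]; exists (u * v)%g.
  by case: eh ek => -> [] ->; rewrite ?invMg ?invgK ?mulgA; [left|right|right|left].
have conj_porbit x y : y \in porbit psi x -> conj (H x) (H y).
  by move=> yx; have [u eu] := hol_conj flag_label yx; exists u; left.
have conj_K n : conj (K n) (K (next_node n)).
  have [u eu] := hol_conj next_label (mem_porbit_step next_node n).
  by exists u; left.
have conj_flag n b : conj (K n) (H (node_flag n b)).
  have [eb|eb] := eqVneq b (~~ positive T (tetra n)).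
    have h1 : conj (K n) (H (turn (node_flag n (positive T (tetra n))))).
      by rewrite /H hol_next; exists 1%g; left; rewrite invg1 mul1g mulg1.
    by rewrite eb; exact: (conj_trans _ _ _ h1 (conj_porbit _ _ (turn_in_porbit _ _))).
  have {eb} -> : b = positive T (tetra n) by case: (b) (positive _ _) eb => -[].
  have h1 : conj (K (next_node n)) (H (turn (node_flag n (~~ positive T (tetra n))))).
    by rewrite /H hol_nextV; exists 1%g; right; rewrite invg1 mul1g mulg1.
  apply: (conj_trans _ _ _ (conj_K n)); apply: (conj_trans _ _ _ h1).
  rewrite -[X in node_flag n X]negbK; apply: (conj_porbit).
  by have := turn_in_porbit n (~~ positive T (tetra n)); rewrite negbK.
have := @torus_curves _ _ flag_label sigma (pure_perm T ^ turn)%g (@free N).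
case.
- move=> x; rewrite conjgE !permM permK; apply: (canLR (permKV _)).
  by rewrite pure_permK.
- apply: (@curve_euler _ T base) => j; exists (Fl (j, ord0)); exact: uproj_Fl.
- exact: closed_free.
- exact: hol_vertex.
- exact: hol_tri.
- case=> x fx Hx; left; exists (flag_node x).
  have := conj_flag (flag_node x) (odd (side x)); rewrite (flag_nodeK fx) => /conj_sym.
  by rewrite [H x]Hx => -[u []]; rewrite ?invg1 mulg1 mulVg.
move=> [r [rs rp rf]]; right => n.
have psi_r x y : y \in porbit psi x -> y \in porbit r x.
  case/porbitP=> k ->; elim: k => [|k IH]; first by rewrite perm1 porbit_id.
  by rewrite expgSr permM -(porbit_eqP _ _ _ IH); exact: rp.
have conj_r x y : free x -> free y -> y \in porbit r x -> conj (H x) (H y).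
  by move=> fx fy /(rf _ _ fx fy)[u hu]; exists u.
(* All the curves bordering the component of [z] agree with [K n0] up to conjugation and
   inversion. *)
pose Z z := `[< forall y, free y -> y \in porbit r z -> conj (K n0) (H y) >].
have Z_r z z' : z' \in porbit r z -> Z z -> Z z'.
  by move=> zz /asboolP h; apply/asboolP => y fy; rewrite (porbit_eqP _ _ _ zz); exact: h.
have Zt z : Z z -> Z (turn z).
  have [fz|fz] := boolP (free z); last first.
    by rewrite -curve_pure //; apply: Z_r; exact: rp.
  move=> /asboolP/(_ z fz (porbit_id _ _)) hz; set b := odd (side z).
  (* The other free side of the triangle belongs to the component of [turn z] and lies on the same
     curve as [z], possibly seen from its other side. *)
  pose z' := node_flag (flag_node z) (~~ b).
  have z'r : z' \in porbit r (turn z).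
    by apply: psi_r; rewrite -{1}(flag_nodeK fz); exact: turn_in_porbit.
  apply/asboolP => y fy; rewrite -(porbit_eqP _ _ _ z'r) => yz.
  apply: (conj_trans _ _ _ _ (conj_r z' y (free_node_flag _ _) fy yz)).
  apply: (conj_trans _ _ _ hz); apply: (conj_trans _ _ _ _ (conj_flag _ _)).
  by apply: (conj_sym); have := conj_flag (flag_node z) (odd (side z)); rewrite (flag_nodeK fz).
have Zc z : Z z -> Z (cross z).
  by move=> /(Z_r _ _ (rs z))/Zt/Zt; rewrite permM turn3.
pose x0 := node_flag n0 true.
have Z0 : Z x0.
  apply/asboolP => y fy yx; apply: (conj_trans _ _ _ (conj_flag n0 true)).
  exact: (conj_r _ _ (free_node_flag _ _) fy yx).
have := @flag_connected _ T Z x0 Zt Zc Z0 (node_flag n true).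
move=> /asboolP/(_ _ (free_node_flag _ _) (porbit_id _ _)) h.
have [u hu] := conj_trans _ _ _ h (conj_sym _ _ (conj_flag n true)).
by exists u.
Qed.

End CuspCurves.

(** * Blocks of twisted matrices, and determinants up to monomials *)

Section FiniteSum.
Variables (F : fieldType) (G : groupType) (n : nat) (tw : G -> 'M[F]_n).

(** Each entry of [A], seen in Z[G], is given as a finite list of terms. The elements in these lists
    contain the support of [A], so the sum over the group is a finite one. *)
Lemma fsum_tens_block (p q : nat) (A : G -> 'M[int]_(p, q))
    (S : 'I_p -> 'I_q -> seq (int * G)) :
  (forall g i j, A g i j = \sum_(t <- S i j) t.1 * (g == t.2)%:Z) ->
  forall i j, rowb F n i *m (\sum_(g \in [set: G]) map_mx intr (A g) *t tw g) *m colb F n j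
    = \sum_(t <- S i j) t.1%:~R *: tw t.2.
Proof.
move=> AS i j.
pose r := undup (flatten [seq flatten [seq map snd (S i j) | j <- enum 'I_q] | i <- enum 'I_p]).
have Ar g : g \notin r -> A g = 0.
  move=> gr; apply/matrixP=> k l; rewrite AS mxE big_seq big1 // => t tS.
  case: eqP => [e|]; last by rewrite mulr0.
  case/negP: gr; rewrite mem_undup; apply/flattenP.
  exists (flatten [seq map snd (S k j) | j <- enum 'I_q]).
    by apply/mapP; exists k; rewrite ?mem_enum.
  apply/flattenP; exists (map snd (S k l)); last by rewrite e map_f.
  by apply/mapP; exists l; rewrite ?mem_enum.
rewrite (fsbigE r) ?undup_uniq //; last first.
  by move=> g _ /Ar ->; rewrite map_mx0 tens0mx.
rewrite (eq_bigl xpredT) => [|g]; last exact: mem_set.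
rewrite mulmx_sumr mulmx_suml.
transitivity (\sum_(g <- r) (A g i j)%:~R *: tw g).
  apply: eq_bigr => g _; apply/matrixP=> x y.
  by rewrite mul_colb mul_rowb tensmxE !mxE.
under eq_bigr do rewrite AS rmorph_sum scaler_suml /=.
rewrite exchange_big /= big_seq [RHS]big_seq; apply: eq_bigr => t tS.
have tr : t.2 \in r.
  rewrite mem_undup; apply/flattenP.
  exists (flatten [seq map snd (S i j) | j <- enum 'I_q]).
    by apply/mapP; exists i; rewrite ?mem_enum.
  apply/flattenP; exists (map snd (S i j)); last by rewrite map_f.
  by apply/mapP; exists j; rewrite ?mem_enum.
rewrite (bigD1_seq t.2) ?undup_uniq //= eqxx mulr1 big1 ?addr0 // => g /negPf ->.
by rewrite mulr0 scale0r.
Qed.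

End FiniteSum.

Section Twist.
Variables (R : realType) (G : groupType) (n : nat).
Variables (alpha : G -> int) (rho : G -> 'M[R[i]]_n).
Hypothesis alphaM : forall g h, alpha (g * h)%g = alpha g + alpha h.
Hypothesis rhoP : is_SL_rep rho.
Notation F := (Ct R).
Notation tw := (twist1 alpha rho).

Lemma tvar_neq0 : tvar R != 0.
Proof. by rewrite /tvar tofrac_eq0 polyX_eq0. Qed.

Lemma alpha1 : alpha 1%g = 0.
Proof. by apply: (addrI (alpha 1%g)); rewrite -alphaM mulg1 addr0. Qed.

Lemma rho1 : rho 1%g = 1%:M.
Proof.
have u : rho 1%g \in unitmx by rewrite unitmxE rhoP.1 unitr1.
by rewrite -[LHS]mul1mx -(mulVmx u) -mulmxA -rhoP.2 mulg1.
Qed.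

Lemma twist1E g : tw g = tvar R ^ alpha g *: map_mx (@tofrac {poly R[i]} \o polyC) (rho g).
Proof. by []. Qed.

Lemma twM g h : tw (g * h)%g = tw g *m tw h.
Proof.
rewrite !twist1E alphaM rhoP.2 map_mxM -scalemxAl -scalemxAr scalerA.
by rewrite expfzDr // tvar_neq0.
Qed.

Lemma tw1 : tw 1%g = 1%:M.
Proof. by rewrite twist1E alpha1 expr0z scale1r rho1 map_mx1. Qed.

Lemma twV g : tw g^-1%g *m tw g = 1%:M.
Proof. by rewrite -twM mulVg tw1. Qed.

Lemma twVr g : tw g *m tw g^-1%g = 1%:M.
Proof. by rewrite -twM mulgV tw1. Qed.

Definition monomial (x : F) := doteq x 1.

Lemma monomial1 : monomial 1.
Proof. by exists false, 0; rewrite expr0 expr0z !mulr1. Qed.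

Lemma monomialM x y : monomial x -> monomial y -> monomial (x * y).
Proof.
case=> b [k ->] [c [l ->]]; exists (b (+) c), (k + l).
by rewrite !mulr1 signr_addb expfzDr ?tvar_neq0 // mulrACA.
Qed.

Lemma monomialN1 : monomial (-1).
Proof. by exists true, 0; rewrite expr1 expr0z !mulr1. Qed.

Lemma monomialX x k : monomial x -> monomial (x ^+ k).
Proof.
move=> mx; elim: k => [|k IH]; first exact: monomial1.
by rewrite exprS; apply: monomialM.
Qed.

Lemma monomial_neq0 x : monomial x -> x != 0.
Proof.
by case=> b [k ->]; rewrite mulr1 mulf_neq0 ?signr_eq0 // expfz_neq0 // tvar_neq0.
Qed.

Lemma doteqP x y u : monomial u -> x = u * y -> doteq x y.
Proof. by case=> b [k ->] ->; exists b, k; rewrite mulr1. Qed.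

Lemma det_tw g : monomial (\det (tw g)).
Proof.
rewrite twist1E detZ det_map_mx rhoP.1 rmorph1 mulr1; apply: monomialX.
by exists false, (alpha g); rewrite expr0 mul1r mulr1.
Qed.

Lemma tw_hol (D : finType) (s : {perm D}) (c : D -> G) x :
  hol *%R s (tw \o c) x = tw (hol *%g s c x).
Proof.
rewrite /hol; elim: (orbit s x) => [|y w IH]; first by rewrite !big_nil tw1.
by rewrite !big_cons /= IH twM.
Qed.

Lemma det_tw_conj g h : \det (1%:M - tw (h^-1 * g * h)%g) = \det (1%:M - tw g).
Proof.
by rewrite !twM det_sub1_mulC mulmxA twVr mul1mx.
Qed.

Lemma det_tw_sub g : exists2 u, monomial u & \det (1%:M - tw g) = u * \det (tw g - 1%:M).
Proof.
exists ((-1) ^+ n); first by apply: monomialX; exact: monomialN1.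
by rewrite -detZ scaleN1r opprB.
Qed.

(** Factor the twist of the inverse of [g] out of the difference; its determinant is a monomial. *)
Lemma det_tw_inv g : exists2 u, monomial u &
  \det (1%:M - tw g^-1%g) = u * \det (tw g - 1%:M).
Proof.
exists (\det (tw g^-1%g)); first exact: det_tw.
by rewrite -det_mulmx mulmxBr mulmx1 twV.
Qed.

Lemma twist_block (p q : nat) (A : G -> 'M[int]_(p, q))
    (S : 'I_p -> 'I_q -> seq (int * G)) :
  (forall g i j, A g i j = \sum_(t <- S i j) t.1 * (g == t.2)%:Z) ->
  forall i j, rowb F n i *m twist alpha rho A *m colb F n j
    = \sum_(t <- S i j) t.1%:~R *: tw t.2.
Proof. exact: fsum_tens_block. Qed.

End Twist.

(** * Group elements attached to the chosen lifts of faces and edges *)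

Section Lifts.
Variables (N : nat) (T : ordered_triangulation N) (base : 'I_N) (L : lifts T base).
Notation face := ('I_N * 'I_4)%type.
Implicit Types (f : face) (k : 'I_(N + N)) (g : pi1 T base) (Y : utet T base).

Lemma glue_neq f : glue T f != f.
Proof. by apply/eqP=> e; have := glue_oriented T f; rewrite e eqxx. Qed.

Definition lift_face k : face := (uproj (face_lift L k).1, (face_lift L k).2).

Lemma face_index_subproof f :
  exists k, f = lift_face k \/ f = glue T (lift_face k).
Proof. by have [k [h _]] := face_liftP L f; exists k. Qed.

Definition face_index f : 'I_(N + N) := projT1 (cid (face_index_subproof f)).

Lemma face_index_uniq f k :
  f = lift_face k \/ f = glue T (lift_face k) -> face_index f = k.
Proof.
rewrite /face_index; case: cid => l /= hl hk.
by have [m [_ u]] := face_liftP L f; rewrite -(u l hl) -(u k hk).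
Qed.

Lemma face_indexP f :
  f = lift_face (face_index f) \/ f = glue T (lift_face (face_index f)).
Proof. by rewrite /face_index; case: cid. Qed.

Lemma face_index_lift k : face_index (lift_face k) = k.
Proof. by apply: face_index_uniq; left. Qed.

Lemma face_index_glue f : face_index (glue T f) = face_index f.
Proof.
apply: face_index_uniq; have [e|e] := face_indexP f; [right|left].
  by rewrite {1}e.
by rewrite {1}e glueK.
Qed.

(** Both sides of a face get lifts that are adjacent along the chosen lift of this face, which makes
    the choice invariant under gluing. *)
Definition face_cover f : utet T base :=
  if f == lift_face (face_index f) then (face_lift L (face_index f)).1
  else (uglue (face_lift L (face_index f))).1.

Lemma face_cover_lift k : face_cover (lift_face k) = (face_lift L k).1.
Proof. by rewrite /face_cover face_index_lift eqxx. Qed.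

Lemma face_cover_glue k : face_cover (glue T (lift_face k)) = (uglue (face_lift L k)).1.
Proof. by rewrite /face_cover face_index_glue face_index_lift (negPf (glue_neq _)). Qed.

Lemma uproj_face_cover f : uproj (face_cover f) = f.1.
Proof.
have [->|->] := face_indexP f; rewrite ?face_cover_lift ?face_cover_glue //.
by have := uproj_uglue (face_lift L (face_index f)) => /(congr1 fst).
Qed.

Lemma uglue_face_cover f :
  uglue (face_cover f, f.2) = (face_cover (glue T f), (glue T f).2).
Proof.
have fl k : (face_cover (lift_face k), (lift_face k).2) = face_lift L k.
  by rewrite face_cover_lift -surjective_pairing.
have fg k : (face_cover (glue T (lift_face k)), (glue T (lift_face k)).2)
    = uglue (face_lift L k).
  by rewrite face_cover_glue.
have [->|->] := face_indexP f; first by rewrite fl fg.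
by rewrite glueK fl fg uglueK.
Qed.

Lemma sum_faces (V : nmodType) (h : face -> V) :
  \sum_k (h (lift_face k) + h (glue T (lift_face k))) = \sum_f h f.
Proof.
rewrite (partition_big face_index xpredT) //=; apply: eq_bigr => k _.
rewrite (bigD1 (lift_face k)) ?face_index_lift //=; congr (_ + _).
rewrite (bigD1 (glue T (lift_face k))) /=; last first.
  by rewrite face_index_glue face_index_lift eqxx glue_neq.
rewrite big1 ?addr0 // => f /andP[/andP[/eqP fk n1] n2].
by have := face_indexP f; rewrite fk => -[e|e]; rewrite e eqxx in n1 n2.
Qed.

(** The deck transformation bringing the edge [e] of [Y] to the chosen lift of the edge [i], unique
    by [same_edge_uniq]; it is the default 1 when [e] does not project to [i]. *)
Definition edge_coord Y e i : pi1 T base :=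
  xget 1%g [set g | same_edge (@uglue N T base) (deck g Y, e) (edge_lift L i)]%classic.

Lemma edge_coordP Y e i : is_edge e -> edge_of T (uproj Y, e) = i ->
  same_edge (@uglue N T base) (deck (edge_coord Y e i) Y, e) (edge_lift L i).
Proof.
move=> ee ei; have [el li] := edge_liftP L i.
have : edge_of T (uproj Y, e) = edge_of T (uproj (edge_lift L i).1, (edge_lift L i).2).
  by rewrite ei li.
move/edge_ofP => /(_ ee el)/(same_edge_lift base)[_ /(_ _ erefl)[X /= hX sX]].
have [g eg] := deck_trans hX.
rewrite /edge_coord; case: xgetP => [h -> //|/(_ g) []].
by rewrite /= -eg (surjective_pairing (edge_lift L i)).
Qed.

Lemma edge_coord_uniq Y e i g : is_edge e ->
  same_edge (@uglue N T base) (deck g Y, e) (edge_lift L i) ->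
  edge_of T (uproj Y, e) = i /\ g = edge_coord Y e i.
Proof.
move=> ee h; have [el li] := edge_liftP L i.
have ei : edge_of T (uproj Y, e) = i.
  rewrite -[RHS]li; apply/edge_ofP => //.
  by have := same_edge_proj h; rewrite /eproj /= uproj_deck.
split=> //; have h' := edge_coordP ee ei.
apply: (@deck_free _ _ _ _ _ Y); apply: (@same_edge_uniq _ _ _ _ _ e) => //.
  by rewrite !uproj_deck.
exact: rst_trans h (rst_sym _ _ _ _ h').
Qed.

Lemma same_edge_coord Y e i g : is_edge e ->
  `[< same_edge (@uglue N T base) (deck g Y, e) (edge_lift L i) >]
    = (edge_of T (uproj Y, e) == i) && (g == edge_coord Y e i).
Proof.
move=> ee; apply/asboolP/andP => [/(edge_coord_uniq ee)[-> ->]|[/eqP ei /eqP ->]].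
  by rewrite !eqxx.
exact: edge_coordP.
Qed.

Lemma edge_coord_deck Y e i g : is_edge e -> edge_of T (uproj Y, e) = i ->
  edge_coord (deck g Y) e i = (edge_coord Y e i * g^-1)%g.
Proof.
move=> ee ei; apply/esym; have h := edge_coordP ee ei.
apply: (proj2 (@edge_coord_uniq (deck g Y) e i _ ee _)).
by rewrite -deckM mulgVK.
Qed.

Lemma edge_coord_same Y (e : edge4) Z (f : edge4) i : is_edge e ->
  same_edge (@uglue N T base) (Y, e) (Z, f) -> edge_of T (uproj Y, e) = i ->
  edge_coord Z f i = edge_coord Y e i.
Proof.
move=> ee h ei; have [ef _] := same_edge_iter h; have h' := edge_coordP ee ei.
apply/esym; apply: (proj2 (@edge_coord_uniq Z f i _ _ _)); first by rewrite -ef.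
apply: rst_trans h'; apply: rst_sym.
exact: same_edge_deck (edge_coord Y e i) _ _ h.
Qed.

End Lifts.

Lemma exit_cross (o o' : bool) (a b : 'I_4) (e : edge4) : is_edge e ->
  o (+) odd a != o' (+) odd b -> a != e.1 -> a != e.2 ->
  (exit_face (~~ o) e == a) = (exit_face o' (edge_map a b e) == b).
Proof.
case: e => u v ee h h1 h2; move: h1 h2 ee h.
rewrite /is_edge -!(inj_eq (@ord_inj _)) !val_exit_face /= !val_face_map.
by case: o; case: o'; case_ord u; case_ord v; case_ord a; case_ord b.
Qed.

Definition primes_coef (o : bool) (e : edge4) : int :=
  (primes_of o e == 2%N)%:Z - (primes_of o e == 1%N)%:Z.

(** The local source of [P2 U01 = B]. For the edges 01 and 23 both adjacent faces are in the same
    pair and the difference vanishes; for the others exactly one face is in {0, 1}, and whether it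
    is the exit or the entrance distinguishes z'' from z'. *)
Lemma exit_primes o (e : edge4) : is_edge e ->
  (exit_face o e < 2)%N%:Z - (exit_face (~~ o) e < 2)%N%:Z = primes_coef o e.
Proof.
case: e => u v; rewrite /is_edge /primes_coef /primes_of !val_exit_face /=.
by case: o; case_ord u; case_ord v.
Qed.

(** * The matrix [U] and its products with the boundary maps *)

Section ChainComplex.
Variables (N : nat) (T : ordered_triangulation N) (base : 'I_N).
Variables (L : lifts T base).
Variables (F : fieldType) (n : nat) (tw : pi1 T base -> 'M[F]_n).
Hypothesis tw1 : tw 1%g = 1%:M.
Hypothesis twM : forall g h, tw (g * h)%g = tw g *m tw h.
Variable twist : forall p q, (pi1 T base -> 'M[int]_(p, q)) -> 'M[F]_(p * n, q * n).
Hypothesis twist_block : forall p q (A : pi1 T base -> 'M[int]_(p, q))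
    (S : 'I_p -> 'I_q -> seq (int * pi1 T base)),
  (forall g i j, A g i j = \sum_(t <- S i j) t.1 * (g == t.2)%:Z) ->
  forall i j, rowb F n i *m twist A *m colb F n j
    = \sum_(t <- S i j) t.1%:~R *: tw t.2.
Notation face := ('I_N * 'I_4)%type.
Notation colb := (colb F n).
Notation rowb := (rowb F n).
Notation X := (tet_lift L).
Implicit Types (f : face) (k : 'I_(N + N)) (i j : 'I_N) (e : edge4).

Definition face_coord f : pi1 T base := udiff (face_cover L f) (X f.1).

Lemma face_coordP f : face_cover L f = deck (face_coord f) (X f.1).
Proof. by apply: udiffP; rewrite uproj_face_cover tet_liftP. Qed.

(* The nodes [lshift j] and [rshift j] of the tetrahedron [j] correspond to its
   pairs of faces {0, 1} and {2, 3}. *)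
Definition face_node f : 'I_(N + N) :=
  if (f.2 < 2)%N then lshift N f.1 else rshift N f.1.

Notation f0 k := (lift_face L k).
Notation f1 k := (glue T (lift_face L k)).

(** This is [U]: the two sides of a lifted face enter with opposite signs, each in the column of the
    pair of faces that contains it. *)
Definition incidence : 'M[F]_((N + N) * n) :=
  \sum_k colb k *m (tw (face_coord (f0 k)) *m rowb (face_node (f0 k))
                    - tw (face_coord (f1 k)) *m rowb (face_node (f1 k))).

Lemma rowb_sum p q (A : 'I_p -> 'M[F]_(n, q)) (k : 'I_p) :
  rowb k *m (\sum_l colb l *m A l) = A k.
Proof.
rewrite mulmx_sumr (bigD1 k) //= big1 ?addr0 => [|l lk].
  by rewrite mulmxA rowb_colb eqxx mul1mx.
by rewrite mulmxA rowb_colb0 ?mul0mx // eq_sym.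
Qed.

Lemma rowb_incidence k : rowb k *m incidence
  = tw (face_coord (f0 k)) *m rowb (face_node (f0 k))
    - tw (face_coord (f1 k)) *m rowb (face_node (f1 k)).
Proof. exact: rowb_sum. Qed.

Lemma deck_tet_lift g j Y : (deck g (X j) == Y) =
  (uproj Y == j) && (g == udiff Y (X j)).
Proof.
apply/eqP/andP => [<-|[/eqP <- /eqP ->]].
  by rewrite uproj_deck tet_liftP (udiff_eq (erefl _)) !eqxx.
by rewrite -udiffP // tet_liftP.
Qed.

Lemma boundary1_block k j : rowb k *m twist (boundary1 L) *m colb j
  = ((f1 k).1 == j)%:R *: tw (face_coord (f1 k))
    - ((f0 k).1 == j)%:R *: tw (face_coord (f0 k)).
Proof.
pose S (k : 'I_(N + N)) j := [:: (((f1 k).1 == j)%:Z, udiff (face_cover L (f1 k)) (X j));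
   (- ((f0 k).1 == j)%:Z, udiff (face_cover L (f0 k)) (X j))].
rewrite (@twist_block _ _ _ S) => [|g l m].
  rewrite !big_cons big_nil addr0 /= rmorphN /= scaleNr /face_coord.
  by congr (_ - _); case: eqP => [<-|]; rewrite ?scale0r.
rewrite mxE !deck_tet_lift !big_cons big_nil addr0 face_cover_glue face_cover_lift.
have -> : uproj (uglue (face_lift L l)).1 = (f1 l).1.
  by have /(congr1 fst) := uproj_uglue (face_lift L l).
rewrite mulNr; congr (_ - _); first by case: eqP; rewrite ?mul1r ?mul0r.
by rewrite /lift_face /=; case: eqP; rewrite ?mul1r ?mul0r.
Qed.

Definition exit_sum i f : 'M[F]_n :=
  \sum_(e | [&& is_edge e, exit_face (positive T f.1) e == f.2
            & edge_of T (f.1, e) == i]) tw (edge_coord L (X f.1) e i).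

Definition enter_sum i f : 'M[F]_n :=
  \sum_(e | [&& is_edge e, exit_face (~~ positive T f.1) e == f.2
            & edge_of T (f.1, e) == i]) tw (edge_coord L (X f.1) e i).

Definition edge_sum i j (c : edge4 -> int) : 'M[F]_n :=
  \sum_(e | is_edge e && (edge_of T (j, e) == i))
     (c e)%:~R *: tw (edge_coord L (X j) e i).

Lemma edge_coord_face f e i : is_edge e -> edge_of T (f.1, e) = i ->
  edge_coord L (face_cover L f) e i
    = (edge_coord L (X f.1) e i * (face_coord f)^-1)%g.
Proof. by move=> ee ei; rewrite face_coordP edge_coord_deck // tet_liftP. Qed.

Lemma boundary2_block i k : rowb i *m twist (boundary2 L) *m colb k
  = exit_sum i (f0 k) *m tw (face_coord (f0 k))^-1%g
    - exit_sum i (f1 k) *m tw (face_coord (f1 k))^-1%g.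
Proof.
pose c i f e := [&& is_edge e, exit_face (positive T f.1) e == f.2
            & edge_of T (f.1, e) == i].
pose S i k := [seq ((c i (f0 k) e)%:Z, edge_coord L (face_cover L (f0 k)) e i)
                 | e <- index_enum _] ++
              [seq (- (c i (f1 k) e)%:Z, edge_coord L (face_cover L (f1 k)) e i)
                 | e <- index_enum _].
have ec f l : exit_sum l f *m tw (face_coord f)^-1%g = \sum_e
    (c l f e)%:~R *: tw (edge_coord L (face_cover L f) e l).
  rewrite mulmx_suml [LHS]big_mkcond; apply: eq_bigr => e _; rewrite /c.
  case: and3P => [[ee _ /eqP el]|]; last by rewrite scale0r.
  by rewrite scale1r edge_coord_face // twM.
rewrite (@twist_block _ _ _ S) => [|g l m].
  rewrite big_cat !big_map /= !ec -sumrN; congr (_ + _).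
  by apply: eq_bigr => e _; rewrite rmorphN scaleNr.
have ex f Y : Y = face_cover L f -> exits L l (deck g Y, f.2)
    = (\sum_e c l f e * (g == edge_coord L (face_cover L f) e l))%N.
  move=> ->; rewrite /exits -sum1dep_card big_mkcond; apply: eq_bigr => e _ /=.
  rewrite uproj_deck uproj_face_cover /c; case: (boolP (is_edge e)) => ee //=.
  rewrite same_edge_coord // uproj_face_cover.
  by case: (_ == f.2); case: (_ == l); case: (_ == edge_coord _ _ _ _).
rewrite mxE big_cat !big_map /=.
have -> : (deck g (face_lift L m).1, (face_lift L m).2)
    = (deck g (face_cover L (f0 m)), (f0 m).2) by rewrite face_cover_lift.
have -> : uglue (deck g (face_cover L (f0 m)), (f0 m).2)
    = (deck g (face_cover L (f1 m)), (f1 m).2).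
  rewrite -[LHS]/(uglue (udeck g (face_cover L (f0 m), (f0 m).2))).
  by rewrite uglue_deck uglue_face_cover.
rewrite !ex // -[X in X - _]natz -[X in _ - X]natz !natr_sum -sumrN.
by congr (_ + _); apply: eq_bigr => e _; rewrite natrM !natz ?mulNr.
Qed.

Lemma NZ_B_block i j : rowb i *m twist (NZ_B L) *m colb j
  = edge_sum i j (primes_coef (positive T j)).
Proof.
pose c i j e := is_edge e && (edge_of T (j, e) == i).
pose S i j := [seq ((c i j e)%:Z * primes_coef (positive T j) e,
                 edge_coord L (X j) e i) | e <- index_enum _].
rewrite (@twist_block _ _ _ S) => [|g l m].
  rewrite big_map /= /edge_sum [RHS]big_mkcond; apply: eq_bigr => e _.
  by rewrite -/(c i j e); case: (c i j e); rewrite ?mul1r ?mul0r ?scale0r.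
rewrite !mxE big_map /= -!sum1dep_card ![\big[addn/0%N]_(_ | _) _]big_mkcond.
rewrite -[X in X - _]natz -[X in _ - X]natz !natr_sum -sumrB; apply: eq_bigr => e _.
rewrite /c /primes_coef; case: (boolP (is_edge e)) => ee /=; last by rewrite mul0r subrr.
rewrite same_edge_coord // tet_liftP.
by case: (_ == 2%N); case: (_ == 1%N); case: (_ == l); case: (_ == edge_coord _ _ _ _);
   rewrite /= ?mul0r ?mulr0 ?mul1r ?mulr1 ?subrr ?subr0 ?sub0r.
Qed.

(** Leaving the neighbour through the common face is entering this tetrahedron. The gluing matches
    the edges concerned, and the lifts of the two sides share them in the cover, so their
    coordinates agree. *)
Lemma exit_sum_glue i f :
  exit_sum i (glue T f) *m (tw (face_coord (glue T f))^-1%g *m tw (face_coord f))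
    = enter_sum i f.
Proof.
set f' := glue T f; have go := glue_oriented T f; rewrite -/f' in go.
have gf' : glue T f' = f by rewrite /f' glueK.
pose h := edge_map f.2 f'.2; pose h' := edge_map f'.2 f.2.
have keep (e : edge4) : is_edge e -> exit_face (~~ positive T f.1) e = f.2 ->
    [/\ is_edge (h e), exit_face (positive T f'.1) (h e) = f'.2, h' (h e) = e
      & same_edge (@uglue N T base) (face_cover L f, e) (face_cover L f', h e)].
  move=> ee fe; have /andP[h1 h2] := exit_face_notin (~~ positive T f.1) ee.
  rewrite fe in h1 h2; split; first by rewrite is_edge_map.
  - by apply/eqP; rewrite -(exit_cross ee go h1 h2) fe.
  - by rewrite /h' /h edge_mapK.
  by apply: rst_step; exists f.2; split=> //; rewrite uglue_face_cover.
rewrite /exit_sum mulmx_suml /enter_sum (reindex_onto h h') /=; last first.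
  move=> e /and3P[ee /eqP fe _].
  have /andP[h1 h2] := exit_face_notin (positive T f'.1) ee.
  by rewrite /h' /h edge_mapK // -fe.
apply: eq_big => [e|e /andP[/and3P[eh /eqP fh /eqP ei] /eqP he]].
  apply/idP/idP => [/andP[/and3P[eh /eqP fh /eqP ei] /eqP he]|/and3P[ee /eqP fe /eqP ei]].
    have /andP[n1 n2] := exit_face_notin (positive T f'.1) eh; rewrite fh in n1 n2.
    have ee : is_edge e by rewrite -he is_edge_map.
    have : f.2 != e.1 /\ f.2 != e.2.
      by rewrite -he /h' /=; split; rewrite eq_sym; apply: face_map_neq; rewrite eq_sym.
    case=> m1 m2; have fe : exit_face (~~ positive T f.1) e == f.2.
      by rewrite (exit_cross ee go m1 m2) -/(h e) fh.
    rewrite ee fe /= -ei; have [_ _ _ se] := keep e ee (eqP fe).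
    have := same_edge_proj se; rewrite /eproj /= !uproj_face_cover => sd.
    by apply/eqP; apply/(edge_ofP T) => //.
  have [eh fh he se] := keep e ee fe; rewrite eh fh he !eqxx /= andbT -ei.
  have := same_edge_proj se; rewrite /eproj /= !uproj_face_cover => sd.
  by apply/eqP; apply/(edge_ofP T) => //; exact: rst_sym.
have /andP[n1 n2] := exit_face_notin (positive T f'.1) eh; rewrite fh in n1 n2.
have ee : is_edge e by rewrite -he is_edge_map.
have : f.2 != e.1 /\ f.2 != e.2.
  by rewrite -he /h' /=; split; rewrite eq_sym; apply: face_map_neq; rewrite eq_sym.
case=> m1 m2; have /eqP fe : exit_face (~~ positive T f.1) e == f.2.
  by rewrite (exit_cross ee go m1 m2) -/(h e) fh.
have [_ _ _ se] := keep e ee fe.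
have ei' : edge_of T (f.1, e) = i.
  rewrite -ei; have := same_edge_proj se; rewrite /eproj /= !uproj_face_cover => sd.
  by apply/(edge_ofP T).
rewrite mulmxA -!twM; congr tw; rewrite -edge_coord_face //.
have -> : edge_coord L (face_cover L f') (h e) i = edge_coord L (face_cover L f) e i.
  by apply: edge_coord_same se _ => //; rewrite uproj_face_cover.
by rewrite edge_coord_face // mulgVK.
Qed.

Lemma mulmx_blocks p q r (A : 'M[F]_(p, q * n)) (B : 'M[F]_(q * n, r)) :
  A *m B = \sum_k (A *m colb k) *m (rowb k *m B).
Proof.
rewrite -{1}[A]mulmx1 -sum_colb_rowb mulmx_sumr mulmx_suml.
by apply: eq_bigr => k _; rewrite !mulmxA.
Qed.

(** For each face the product has four terms: the two where the sides agree give the exits, the two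
    mixed ones give the entrances by [exit_sum_glue]. *)
Lemma boundary2_incidence i : rowb i *m twist (boundary2 L) *m incidence
  = \sum_f (exit_sum i f - enter_sum i f) *m rowb (face_node f).
Proof.
rewrite mulmx_blocks -(sum_faces L); apply: eq_bigr => k _.
rewrite boundary2_block rowb_incidence -!exit_sum_glue glueK.
move: (f0 k) (f1 k) => a b; rewrite !mulmxBl !mulmxBr !mulmxA.
have tV g : tw g^-1%g *m tw g = 1%:M by rewrite -twM mulVg tw1.
rewrite -(mulmxA (exit_sum i a) (tw _^-1%g) (tw (face_coord a))) tV mulmx1.
rewrite -(mulmxA (exit_sum i b) (tw _^-1%g) (tw (face_coord b))) tV mulmx1.
by rewrite opprB addrACA [RHS]addrACA; congr (_ + _); rewrite addrC.
Qed.

Lemma sum_indicator (Q : pred 'I_4) (x : 'I_4) :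
  \sum_(a | Q a) (x == a)%:Z = (Q x)%:Z.
Proof.
rewrite big_mkcond (bigD1 x) //= eqxx big1 ?addr0 => [|a ax].
  by case: (Q x).
by rewrite eq_sym (negPf ax) if_same.
Qed.

Lemma sum_exit_enter i j (Q : pred 'I_4) :
  \sum_(a | Q a) (exit_sum i (j, a) - enter_sum i (j, a))
    = edge_sum i j (fun e => (Q (exit_face (positive T j) e))%:Z
                             - (Q (exit_face (~~ positive T j) e))%:Z).
Proof.
have E o a : \sum_(e | [&& is_edge e, exit_face o e == a & edge_of T (j, e) == i])
      tw (edge_coord L (X j) e i) =
    \sum_(e | is_edge e && (edge_of T (j, e) == i))
      (exit_face o e == a)%:~R *: tw (edge_coord L (X j) e i).
  rewrite [LHS]big_mkcond [RHS]big_mkcond; apply: eq_bigr => e _.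
  case: (is_edge e); case: (_ == i); case: (_ == a) => //=;
    by rewrite ?scale1r ?scale0r.
rewrite /exit_sum /enter_sum /=; under eq_bigr do rewrite !E -sumrB.
rewrite exchange_big; apply: eq_bigr => e _ /=.
under eq_bigr do rewrite -scalerBl -rmorphB.
by rewrite -scaler_suml -rmorph_sum sumrB !sum_indicator.
Qed.

Lemma boundary2_incidence_colb i m : rowb i *m twist (boundary2 L) *m (incidence *m colb m)
  = \sum_(f | face_node f == m) (exit_sum i f - enter_sum i f).
Proof.
rewrite mulmxA boundary2_incidence mulmx_suml [RHS]big_mkcond.
apply: eq_bigr => f _; rewrite -mulmxA rowb_colb mul_mx_scalar.
by case: (_ == m); rewrite ?scale1r ?scale0r.
Qed.

Lemma sum_face_node (V : nmodType) (h : face -> V) j (Q : pred 'I_4) (P : pred face) :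
  (forall f, P f = (f.1 == j) && Q f.2) ->
  \sum_(f | P f) h f = \sum_(a | Q a) h (j, a).
Proof.
move=> PE; transitivity (\sum_(p | pred1 j p.1 && Q p.2) h (p.1, p.2)).
  by apply: eq_big => [f|f _]; rewrite ?PE // -surjective_pairing.
by rewrite -(pair_big (pred1 j) Q (fun j a => h (j, a))) /= big_pred1_eq.
Qed.

Lemma boundary2_incidence_l i j :
  rowb i *m twist (boundary2 L) *m (incidence *m colb (lshift N j))
    = rowb i *m twist (NZ_B L) *m colb j.
Proof.
rewrite boundary2_incidence_colb NZ_B_block.
rewrite (@sum_face_node _ _ j (fun a => a < 2)%N).
  rewrite sum_exit_enter; apply: eq_bigr => e /andP[ee _].
  by rewrite exit_primes.
move=> [k a]; rewrite /face_node /=; case: (ltnP a 2) => _.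
  by rewrite (inj_eq (@lshift_inj _ _)) andbT.
by rewrite andbF; apply/eqP=> /(congr1 val) /=; have := ltn_ord j; lia.
Qed.

Lemma boundary2_incidence_r i j :
  rowb i *m twist (boundary2 L) *m (incidence *m colb (rshift N j))
    = - (rowb i *m twist (NZ_B L) *m colb j).
Proof.
rewrite boundary2_incidence_colb NZ_B_block.
rewrite (@sum_face_node _ _ j (fun a => ~~ (a < 2))%N).
  rewrite sum_exit_enter -sumrN; apply: eq_bigr => e /andP[ee _].
  rewrite -scaleNr -rmorphN -exit_primes //; congr (_%:~R *: _).
  by case: (_ < 2)%N; case: (_ < 2)%N.
move=> [k a]; rewrite /face_node /=; case: (ltnP a 2) => _.
  by rewrite andbF; apply/eqP=> /(congr1 val) /=; have := ltn_ord k; lia.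
by rewrite (inj_eq (@rshift_inj _ _)) andbT.
Qed.

Lemma boundary1_incidence k j : rowb k *m twist (boundary1 L) *m colb j
  = - (rowb k *m incidence *m colb (lshift N j)
       + rowb k *m incidence *m colb (rshift N j)).
Proof.
rewrite boundary1_block rowb_incidence !mulmxBl -!mulmxA !rowb_colb !mul_mx_scalar.
have e f : (f.1 == j)%:R = (face_node f == lshift N j)%:R
    + (face_node f == rshift N j)%:R :> F.
  have d : (lshift N j == rshift N j) = false.
    by apply/eqP=> /(congr1 val) /=; have := ltn_ord j; lia.
  rewrite /face_node; case: ifP => _.
    rewrite (inj_eq (@lshift_inj _ _)) [X in _ + X](_ : _ = 0) ?addr0 //.
    case: eqP => // /(congr1 val) /=; have := ltn_ord f.1; lia.
  rewrite (inj_eq (@rshift_inj _ _)) [X in X + _](_ : _ = 0) ?add0r //.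
  case: eqP => // /(congr1 val) /=; have := ltn_ord j; lia.
by rewrite !e !scalerDl addrACA -opprD opprB.
Qed.

Lemma cast_lsub_colb p (e : ((N + N) * n = N * n + N * n)%N)
    (A : 'M[F]_(p, (N + N) * n)) j :
  lsubmx (castmx (erefl p, e) A) *m colb j = A *m colb (lshift N j).
Proof.
apply/matrixP=> x y; rewrite !mul_colb mxE castmxE /= cast_ord_id.
by congr (A _ _); apply/ord_inj.
Qed.

Lemma cast_rsub_colb p (e : ((N + N) * n = N * n + N * n)%N)
    (A : 'M[F]_(p, (N + N) * n)) j :
  rsubmx (castmx (erefl p, e) A) *m colb j = A *m colb (rshift N j).
Proof.
apply/matrixP=> x y; rewrite !mul_colb mxE castmxE /= cast_ord_id.
by congr (A _ _); apply/ord_inj; rewrite /= mulnDl addnA.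
Qed.

Lemma det_castmx m p (e : m = p) (A : 'M[F]_(p, m)) :
  \det (castmx (esym e, erefl m) A) = \det (castmx (erefl p, e) A).
Proof. by case: p / e A => A. Qed.

Lemma det_stack (b : 'M[F]_(N * n, (N + N) * n)) :
  \det (castmx (esym (mulnDl N N n), erefl) (col_mx (twist (boundary2 L)) b))
      * \det incidence
    = (-1) ^+ (N * n) * \det (twist (NZ_B L)) * \det (b *m twist (boundary1 L)).
Proof.
set C := col_mx _ b; set e := mulnDl N N n.
pose U1 := lsubmx (castmx (erefl _, e) incidence).
pose U2 := rsubmx (castmx (erefl _, e) incidence).
have hB1 : twist (boundary2 L) *m U1 = twist (NZ_B L).
  apply: blockP => i j; rewrite -mulmxA -(mulmxA _ U1) cast_lsub_colb.
  by rewrite mulmxA boundary2_incidence_l.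
have hB2 : twist (boundary2 L) *m U2 = - twist (NZ_B L).
  apply: blockP => i j; rewrite -mulmxA -(mulmxA _ U2) cast_rsub_colb.
  by rewrite mulmxA boundary2_incidence_r mulmxN mulNmx.
have hP1 : U1 + U2 = - twist (boundary1 L).
  apply: blockP => k j; rewrite mulmxN mulNmx boundary1_incidence opprK.
  by rewrite mulmxDr mulmxDl -!mulmxA cast_lsub_colb cast_rsub_colb.
rewrite -det_mulmx.
have -> : castmx (esym e, erefl) C *m incidence = castmx (esym e, erefl) (C *m incidence).
  by rewrite castmx_mul castmx_id.
rewrite det_castmx castmx_mul castmx_id.
rewrite -[castmx (erefl, e) incidence]hsubmxK -/U1 -/U2 /C mul_col_row hB1 hB2.
(* Adding the first block column to the second turns the top row into B and 0, and the lower right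
   block into minus the product of [b] with the first boundary map. *)
pose W : 'M[F]_(N * n + N * n) := block_mx 1%:M 1%:M 0 1%:M.
have dW : \det W = 1 by rewrite det_ublock !det1 mulr1.
rewrite -[LHS]mulr1 -[X in _ * X = _]dW -det_mulmx mulmx_block !mulmx1 !mulmx0 !addr0 addrN.
rewrite -mulmxDr hP1 det_lblock mulmxN -scaleN1r detZ.
by rewrite mulrCA mulrA.
Qed.

Variable mono : F -> Prop.
Hypothesis mono1 : mono 1.
Hypothesis monoM : forall x y, mono x -> mono y -> mono (x * y).
Hypothesis monoN1 : mono (-1).
Hypothesis mono_tw : forall g, mono (\det (tw g)).

Notation Fl := (face_cover L).
Notation next := (next_node T).

Definition node_face (m : 'I_(N + N)) (b : bool) : face :=
  (tetra m, side (node_flag m b)).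

(** The faces by which the curve leaves and enters the triangle of the node. *)
Definition plus_face (m : 'I_(N + N)) : face := node_face m (~~ positive T (tetra m)).
Definition minus_face (m : 'I_(N + N)) : face := node_face m (positive T (tetra m)).

Lemma glue_plus_face m : glue T (plus_face m) = minus_face (next m).
Proof.
have := cross_glue T (node_flag m (~~ positive T (tetra m))).
by rewrite cross_next !node_flag1 !node_tri1.
Qed.

Lemma face_node_node_face m b : face_node (node_face m b) = m.
Proof.
rewrite /face_node /node_face nat_side /node_flag /node_tri /tetra.
by case: (splitP m) => j e /=; case: b => /=; apply/ord_inj.
Qed.

Lemma plus_minus_neq m m' : plus_face m != minus_face m'.
Proof.
apply/eqP=> e; have := congr1 (fun f => positive T f.1 (+) odd f.2) e.
by rewrite /= !odd_node_flag addbb; case: positive.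
Qed.

Definition plus_index m : 'I_(N + N) := face_index L (plus_face m).

(** A plus face is glued to a minus face, so a glued pair never contains two plus faces. *)
Lemma plus_index_inj : injective plus_index.
Proof.
move=> m m' e; have := face_indexP L (plus_face m); have := face_indexP L (plus_face m').
rewrite -/(plus_index m) -/(plus_index m') e.
have inj : plus_face m = plus_face m' -> m = m'.
  by move=> h; rewrite -(face_node_node_face m (~~ positive T (tetra m))) -/(plus_face m) h face_node_node_face.
move=> [h|h] [h'|h'].
- by apply: inj; rewrite h h'.
- by have := plus_minus_neq m (next m'); rewrite -glue_plus_face h' -h eqxx.
- by have := plus_minus_neq m' (next m); rewrite -glue_plus_face h -h' eqxx.
by apply: inj; rewrite h h'.
Qed.

Definition plus_perm : {perm 'I_(N + N)} := perm plus_index_inj.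

Definition plus_sign m : bool := plus_face m != f0 (plus_index m).

Lemma rowb_plus_incidence m : rowb (plus_perm m) *m incidence
  = (-1) ^+ plus_sign m *: (tw (face_coord (plus_face m)) *m rowb m
      - tw (face_coord (minus_face (next m))) *m rowb (next m)).
Proof.
rewrite permE rowb_incidence /plus_sign -glue_plus_face.
have nm : face_node (plus_face m) = m by exact: face_node_node_face.
have nm' : face_node (glue T (plus_face m)) = next m.
  by rewrite glue_plus_face; exact: face_node_node_face.
have := face_indexP L (plus_face m); rewrite -/(plus_index m) => -[h|h].
  by rewrite -h eqxx scale1r nm nm'.
have -> : f0 (plus_index m) = glue T (plus_face m) by rewrite h glueK.
by rewrite eq_sym glue_neq glueK scaleN1r opprB nm nm'.
Qed.

Definition block_diag p (A : 'I_p -> 'M[F]_n) : 'M[F]_(p * n) :=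
  \sum_i colb i *m A i *m rowb i.

Lemma rowb_block_diag p (A : 'I_p -> 'M[F]_n) (i : 'I_p) :
  rowb i *m block_diag A = A i *m rowb i.
Proof.
rewrite -[RHS](rowb_sum (fun l : 'I_p => A l *m rowb l)); congr (_ *m _).
by apply: eq_bigr => l _; rewrite mulmxA.
Qed.

Lemma eq_rowb p q (A B : 'M[F]_(p * n, q)) :
  (forall l : 'I_p, rowb l *m A = rowb l *m B) -> A = B.
Proof.
move=> h; rewrite -[A]mul1mx -[B]mul1mx -sum_colb_rowb !mulmx_suml.
by apply: eq_bigr => l _; rewrite -!mulmxA h.
Qed.

Lemma next_label_coord m : next_label Fl m
  = (face_coord (minus_face m) * (face_coord (plus_face m))^-1)%g.
Proof.
apply: udiff_eq; rewrite /flag_lift !node_flag1 !node_tri1.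
rewrite -/(node_face _ _) -/(minus_face m) -/(node_face _ _) -/(plus_face m).
by rewrite !face_coordP deckM deckK.
Qed.

Lemma det_incidence : exists2 u, mono u & \det incidence
  = u * \det (1%:M - twperm next (fun m => tw (next_label Fl m))).
Proof.
have tV g : tw g^-1%g *m tw g = 1%:M by rewrite -twM mulVg tw1.
pose Q : 'M[F]_((N + N) * n) := twperm plus_perm (fun=> 1%:M).
pose E := block_diag (fun m => ((-1) ^+ plus_sign m)%:M : 'M[F]_n).
pose A := block_diag (fun m => tw (face_coord (plus_face m) * (face_coord (minus_face m))^-1)%g).
pose B := block_diag (fun m => tw (face_coord (minus_face m))).
set K := twperm next _.
(* [Q] indexes the rows by the node that the curve leaves, [E] corrects the side chosen for the
   lift, and [A] and [B] pass to the coordinates of the entrance faces. What remains between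
   consecutive nodes is [next_label]. *)
have QE : Q *m incidence = E *m (A *m ((1%:M - K) *m B)).
  apply: eq_rowb => m; rewrite !mulmxA rowb_twperm mul1mx rowb_plus_incidence.
  rewrite rowb_block_diag mul_scalar_mx -!scalemxAl; congr (_ *: _).
  rewrite rowb_block_diag -!mulmxA mulmxBl mul1mx mulmxBr rowb_block_diag.
  rewrite (mulmxA (rowb m)) rowb_twperm -(mulmxA _ (rowb (next m))) rowb_block_diag.
  rewrite mulmxBr !mulmxA -!twM next_label_coord; congr (_ - _).
    by rewrite mulgVK.
  by rewrite !mulgA mulgVK mulgV mul1g.
have dQ : \det Q = 1 \/ \det Q = -1.
  have QQ : Q *m Q^T = 1%:M.
    apply: eq_rowb => m; rewrite mulmxA rowb_twperm mul1mx mulmx1.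
    rewrite linear_sum mulmx_sumr (bigD1 m) //= big1 ?addr0 => [|l lm].
      by rewrite mulmx1 trmx_mul trmxK mulmxA rowb_colb eqxx mul1mx.
    rewrite mulmx1 trmx_mul trmxK mulmxA rowb_colb0 ?mul0mx //.
    by rewrite (inj_eq perm_inj) eq_sym.
  have := congr1 determinant QQ; rewrite det_mulmx det_tr det1 => /eqP.
  by rewrite -expr2 sqrf_eq1 => /orP[/eqP|/eqP]; [left|right].
have mQ : mono (\det Q) by case: dQ => ->.
have dQ2 : \det Q * \det Q = 1 by case: dQ => ->; rewrite ?mulr1 ?mulrNN ?mulr1.
have mono_prod p (f : 'I_p -> F) : (forall l, mono (f l)) -> mono (\prod_l f l).
  by move=> h; apply: big_ind.
have monoX x (d : nat) : mono x -> mono (x ^+ d).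
  by move=> mx; elim: d => [|d IH]; rewrite ?expr0 // exprS; apply: monoM.
have dd p (C : 'I_p -> 'M[F]_n) : \det (block_diag C) = \prod_m \det (C m).
  exact: det_block_diag.
have mE : mono (\det E).
  by rewrite dd; apply: (mono_prod) => m; rewrite det_scalar; do 2!apply: (monoX).
have mA : mono (\det A) by rewrite dd; exact: (mono_prod).
have mB : mono (\det B) by rewrite dd; exact: (mono_prod).
exists (\det Q * (\det E * (\det A * \det B))).
  exact: (monoM mQ (monoM mE (monoM mA mB))).
have := congr1 determinant QE; rewrite !det_mulmx => h.
transitivity (\det Q * (\det Q * \det incidence)); first by rewrite mulrA dQ2 mul1r.
by rewrite h [\det (1%:M - K) * _]mulrC !mulrA.
Qed.

End ChainComplex.

(** * Independence of the lifts, and the determinant of B *)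

Section ChangeOfLifts.
Variables (N : nat) (T : ordered_triangulation N) (base : 'I_N).
Variables (L L' : lifts T base).
Variables (F : fieldType) (n : nat) (tw : pi1 T base -> 'M[F]_n).
Hypothesis tw1 : tw 1%g = 1%:M.
Hypothesis twM : forall g h, tw (g * h)%g = tw g *m tw h.
Variable twist : forall p q, (pi1 T base -> 'M[int]_(p, q)) -> 'M[F]_(p * n, q * n).
Hypothesis twist_block : forall p q (A : pi1 T base -> 'M[int]_(p, q))
    (S : 'I_p -> 'I_q -> seq (int * pi1 T base)),
  (forall g i j, A g i j = \sum_(t <- S i j) t.1 * (g == t.2)%:Z) ->
  forall i j, rowb F n i *m twist A *m colb F n j
    = \sum_(t <- S i j) t.1%:~R *: tw t.2.
Variable mono : F -> Prop.
Hypothesis mono1 : mono 1.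
Hypothesis monoM : forall x y, mono x -> mono y -> mono (x * y).
Hypothesis monoN1 : mono (-1).
Hypothesis mono_tw : forall g, mono (\det (tw g)).

Lemma edge_coord_change (i : 'I_N) : exists g, forall Y (e : edge4), is_edge e ->
  edge_of T (uproj Y, e) = i -> edge_coord L Y e i = (g * edge_coord L' Y e i)%g.
Proof.
have [el li] := edge_liftP L' i; set E := edge_lift L' i in el li.
exists (edge_coord L E.1 E.2 i) => Y e ee ei; apply/esym.
apply: (proj2 (@edge_coord_uniq _ _ _ L Y e i _ ee _)); rewrite deckM.
apply: rst_trans (edge_coordP L el li).
exact: same_edge_deck _ _ _ (edge_coordP L' ee ei).
Qed.

(** Changing lifts multiplies B on either side by block diagonal matrices of group elements. *)
Lemma det_NZ_B_change : exists2 u, mono u &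
  \det (twist (NZ_B L)) = u * \det (twist (NZ_B L')).
Proof.
pose a i := projT1 (cid (edge_coord_change i)).
have aE i : forall Y (e : edge4), is_edge e ->
  edge_of T (uproj Y, e) = i -> edge_coord L Y e i = (a i * edge_coord L' Y e i)%g.
  by rewrite /a; case: cid.
pose d j := udiff (tet_lift L j) (tet_lift L' j).
have dE j : tet_lift L j = deck (d j) (tet_lift L' j).
  by apply: udiffP; rewrite !tet_liftP.
pose A := block_diag (fun i => tw (a i)); pose B := block_diag (fun j => tw (d j)^-1%g).
have e : twist (NZ_B L) = A *m twist (NZ_B L') *m B.
  apply: blockP => i j; rewrite -(mulmxA A) (mulmxA (rowb F n i)) rowb_block_diag.
  have -> : tw (a i) *m rowb F n i *m (twist (NZ_B L') *m B) *m colb F n j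
      = tw (a i) *m (rowb F n i *m twist (NZ_B L') *m colb F n j) *m tw (d j)^-1%g.
    rewrite -!mulmxA; do 3 congr (_ *m _); rewrite mulmx_suml (bigD1 j) //=.
    rewrite -!mulmxA rowb_colb eqxx mulmx1 big1 ?addr0 // => k kj.
    by rewrite -!mulmxA rowb_colb0 // !mulmx0.
  rewrite !(NZ_B_block _ twist_block) mulmx_sumr mulmx_suml; apply: eq_bigr => f.
  case/andP=> ef /eqP fi; rewrite -scalemxAr -scalemxAl -!twM; congr (_ *: tw _).
  rewrite aE ?tet_liftP // dE edge_coord_deck ?tet_liftP //.
  by rewrite mulgA.
have mono_prod p (f : 'I_p -> F) : (forall l, mono (f l)) -> mono (\prod_l f l).
  by move=> h; apply: big_ind.
have dd p (C : 'I_p -> 'M[F]_n) : \det (block_diag C) = \prod_m \det (C m).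
  exact: det_block_diag.
exists (\det A * \det B).
  by rewrite !dd; apply: (monoM); apply: (mono_prod).
by rewrite e !det_mulmx mulrAC.
Qed.

Lemma det_NZ_B (b : 'M[F]_(N * n, (N + N) * n)) :
  exists u (Rs : {set 'I_(N + N)}),
  [/\ mono u, forall m, exists2 r, r \in Rs & r \in porbit (next_node T) m
    & \det (twist (NZ_B L)) * \det (b *m twist (boundary1 L'))
      = u * \det (castmx (esym (mulnDl N N n), erefl)
                         (col_mx (twist (boundary2 L')) b))
          * \prod_(r in Rs) \det (1%:M - hol *%R (next_node T)
               (fun m => tw (next_label (face_cover L') m)) r)].
Proof.
have [u1 m1 e1] := det_NZ_B_change.
have [u2 m2 e2] := @det_incidence _ _ _ L' _ _ tw tw1 twM _ mono1 monoM monoN1 mono_tw.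
have := det_stack L' tw1 twM twist_block b.
have [Rs [hR eR]] := det_twperm (next_node T) (fun m => tw (next_label (face_cover L') m)).
rewrite e2 eR; set s := (-1) ^+ _; set S := \det (castmx _ _).
set P := \prod_(r in Rs) _ => e3.
have sgn : s * s = 1 by rewrite /s -expr2 sqrr_sign.
exists (u1 * (s * u2)), Rs; split=> //.
  apply: (monoM m1); apply: (monoM _ m2); rewrite /s.
  by elim: (N * n)%N => [|k IH]; rewrite ?expr0 // exprS; apply: monoM.
have -> : u1 * (s * u2) * S * P = u1 * (s * (S * (u2 * P))) by ring.
by rewrite e1 e3 !mulrA -[u1 * s * s]mulrA sgn mulr1.
Qed.

End ChangeOfLifts.

(** * From the product over the curves to the power of a single factor *)

Lemma eq_frac_mul (F : fieldType) (x u w q d p : F) : w != 0 -> d != 0 ->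
  x * d = u * q * p -> x = u * w^-1 * (w * (q / d) * p).
Proof.
move=> w0 d0 e; apply: (mulIf d0); rewrite e.
by field; rewrite w0 d0.
Qed.

Lemma prod_eq0 (F : fieldType) (I : finType) (A : {set I}) (f : I -> F) i :
  i \in A -> f i = 0 -> \prod_(j in A) f j = 0.
Proof. by move=> iA fi; rewrite (bigD1 i) //= fi mul0r. Qed.

Lemma mulr_prod_expr (F : fieldType) (v w d q : F) m :
  v * (d * (w * q ^+ m)) = v * w * (d * q ^+ m).
Proof. by ring. Qed.

Section Monomials.
Variable R : realType.
Notation F := (Ct R).

Lemma monomialV (x : F) : monomial x -> monomial x^-1.
Proof.
case=> b [k ->]; exists b, (- k).
by rewrite !mulr1 invfM invr_sign invr_expz.
Qed.

Lemma doteq_prod (I : finType) (Rs : {set I}) (f : I -> F) y :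
  (forall r, r \in Rs -> exists2 u, monomial u & f r = u * y) ->
  exists2 u, monomial u & \prod_(r in Rs) f r = u * y ^+ #|Rs|.
Proof.
move=> h; rewrite -sum1_card; elim/big_rec2: _ => [|r m x rR [u mu ->]].
  by exists 1; [exact: monomial1 | rewrite mulr1].
have [v mv ->] := h r rR; exists (v * u); first exact: monomialM.
by rewrite exprD expr1 mulrACA.
Qed.

End Monomials.

Theorem theorem3p2 (R : realType) (N : nat) (T : ordered_triangulation N)
    (base : 'I_N) (L L' : lifts T base)
    (alpha : pi1 T base -> int)
    (halpha : forall g h, alpha (g * h)%g = alpha g + alpha h)
    (n : nat) (rho : pi1 T base -> 'M[R[i]]_n) (hrho : is_SL_rep rho)
    (Delta : Ct R) :
  let P1 := twist alpha rho (boundary1 L') in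
  let P2 := twist alpha rho (boundary2 L') in
  let detB := \det (twist alpha rho (NZ_B L)) in
  acyclic P2 P1 ->
  is_torsion P2 P1 Delta ->
  detB = 0 \/
  exists (g : pi1 T base) (m : nat),
    [/\ peripheral g, (1 <= m)%N
      & doteq detB (Delta * \det (twist1 alpha rho g - 1%:M) ^+ m)].
Proof.
move=> P1 P2 detB _ [b [_ D0 hD]].
have t1 := tw1 halpha hrho; have tM := twM halpha hrho.
have tdet g : monomial (\det (twist1 alpha rho g)) by exact: det_tw.
have [u [Rs [mu hR]]] := @det_NZ_B _ _ _ L L' _ _ _ t1 tM _
  (@twist_block _ _ _ alpha rho) _ (monomial1 R) (@monomialM R) (monomialN1 R) tdet b.
rewrite -/detB -/P1 -/P2 -/(stack_det P2 b).
set nx := next_node T; set nl := next_label (face_cover L').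
pose hl := hol *%g nx nl.
under eq_bigr do rewrite (tw_hol halpha hrho nx nl) -/(hl _).
set P := \prod_(r in Rs) _ => e.
have {e hD D0} [v mv e] : exists2 v, monomial v & detB = v * (Delta * P).
  case: hD => s [k hD]; set w := (-1) ^+ s * _ in hD.
  have mw : monomial w by exists s, k; rewrite mulr1.
  have w0 := monomial_neq0 mw.
  exists (u * w^-1); first by apply: monomialM => //; exact: monomialV.
  rewrite hD; exact: eq_frac_mul w0 D0 e.
have hF := uproj_face_cover L'; have hG := uglue_face_cover L'.
have n0 : 'I_(N + N) := lshift N base.
have per m : peripheral (hl m) by exact: peripheral_next.
pose f m := \det (1%:M - twist1 alpha rho (hl m)).
have Rs0 : (1 <= #|Rs|)%N.
  by rewrite card_gt0; apply/set0Pn; have [r rR _] := hR n0; exists r.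
have conc : (forall r, r \in Rs -> exists2 w, monomial w &
      f r = w * \det (twist1 alpha rho (hl n0) - 1%:M)) ->
    exists (g : pi1 T base) (m : nat), [/\ peripheral g, (1 <= m)%N
      & doteq detB (Delta * \det (twist1 alpha rho g - 1%:M) ^+ m)].
  (* The exponent is the number of factors in the product, positive because [Rs] meets every
     cycle. *)
  move=> /doteq_prod[w mw eP]; exists (hl n0), #|Rs|; split=> //.
  apply: (doteqP (monomialM mv mw)); rewrite e /P eP; exact: mulr_prod_expr.
(* For [n = 0] every determinant is 1, including that of the zero matrix, so the vanishing argument
   below requires [n] positive. *)
have [en|n_gt0] := posnP n.
  have d1 (A : 'M[Ct R]_n) : \det A = 1 by move: A; rewrite en => A; exact: det_mx00.
  right; apply: conc => r _; exists 1; first exact: monomial1.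
  by rewrite /f !d1 mulr1.
(* A curve with trivial holonomy contributes the determinant of a zero matrix, which kills the
   product. *)
have [[m hm]|hconj] := hol_next_dichotomy hF hG n0.
  left; have [r rR rm] := hR m.
  have hr : hl r = 1%g by exact: hol1_porbit rm hm.
  suff P0 : P = 0 by rewrite e P0 !mulr0.
  apply: (prod_eq0 rR); rewrite hr t1 subrr.
  have d0 k : (0 < k)%N -> \det (0 : 'M[Ct R]_k) = 0 by case: k => // k _; exact: det0.
  exact: d0.
right; apply: conc => r _; have [h [hr|hr]] := hconj r.
  have [w mw we] := det_tw_sub alpha rho (hl n0); exists w; first exact: mw.
  rewrite /f /hl hr (det_tw_conj halpha hrho); exact: we.
have [w mw we] := det_tw_inv halpha hrho (hl n0); exists w; first exact: mw.
rewrite /f /hl hr (det_tw_conj halpha hrho); exact: we.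
Qed.
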